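(* Let $k$ be a field, let $A$ and $B$ be Hopf algebras over $k$, and let $A\triangleright\!\!\!\blacktriangleleft B$ be a bicrossproduct of $A$ and $B$ (with right action $\triangleleft$ of $A$ on $B$ and left coaction $\delta(a)=a^{[-1]}\otimes a^{[0]}$ of $B$ on $A$). Suppose that the antipode of $A$ is bijective and that $\phi:B^{op}\to A$ is a bialgebra morphism such that for all $a\in A$ and $b,b'\in B$: (1) $\phi(b)^{[-1]}\otimes\phi(b)^{[0]}=b_{(1)}S(b_{(3)})\otimes\phi(b_{(2)})$, (2) $\phi(a^{[-1]})\otimes a^{[0]}=S^{-1}(a_{(3)})a_{(1)}\otimes a_{(2)}$, (3) $\phi(b\triangleleft a)=S^{-1}(a_{(2)})\,\phi(b)\,a_{(1)}$, (4) $b'\triangleleft\phi(b)=b_{(1)}b'S(b_{(2)})$. Then $A\triangleright\!\!\!\blacktriangleleft B$ (with its bicrossproduct Hopf algebra structure), together with the Hopf algebra $B$, is an (anti-)right Hopf 2-algebra, i.e. both a right Hopf 2-algebra and an anti-right Hopf 2-algebra, with source and target maps $$s(b)=1\otimes b,\qquad t(b)=\phi(b_{(1)})\otimes b_{(2)},$$ and bialgebroid coproduct and counit $$\blacktriangle(a\otimes b)=(a_{(1)}\otimes 1)\otimes_B(a_{(2)}\otimes b),\qquad \varepsilon_{A\triangleright\!\!\!\blacktriangleleft B}(a\otimes b)=\varepsilon(a)\,b,$$ for $a\in A$, $b\in B$. The inverse of the canonical map $\lambda$ is determined by $$(a\otimes b)_{-}\otimes_{B^{op}}(a\otimes b)_{+}=(S(a_{(1)})\otimes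 1)\otimes_{B^{op}}(a_{(2)}\otimes b),$$ and the inverse of the anti-canonical map $\mu$ is determined by $$(a\otimes b)_{[+]}\otimes^{B^{op}}(a\otimes b)_{[-]}=(a_{(1)}\otimes 1)\otimes^{B^{op}}\bigl(\phi(b_{(1)})S^{-1}(a_{(3)})\otimes b_{(2)}\triangleleft S^{-1}(a_{(2)})\bigr).$$ Such a bicrossproduct Hopf algebra $(A\triangleright\!\!\!\blacktriangleleft B,\phi)$ is called a bicrossed module of Hopf algebras. Moreover, if the antipode of $A$ satisfies $S^2=\mathrm{id}_A$, then $A\triangleright\!\!\!\blacktriangleleft B$ is a Hopf 2-algebra, with antipode of the full Hopf algebroid $$S_{A\triangleright\!\!\!\blacktriangleleft B}(a\otimes b)=\phi(b_{(1)})S(a_{(2)})\otimes b_{(2)}\triangleleft S(a_{(1)}).$$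
   Context: All algebras are unital over a field $k$. Sumless Sweedler notation: $\Delta(h)=h_{(1)}\otimes h_{(2)}$ for Hopf algebra coproducts, $\delta(c)=c^{[-1]}\otimes c^{[0]}$ for left coactions, $\blacktriangle(X)=X^{(1)}\otimes_B X^{(2)}$ for bialgebroid coproducts. $S$ denotes the antipode of the Hopf algebra in question. $B^{op}$ is $B$ with opposite product and the same coproduct. **Module algebra, comodule coalgebra.** A right $H$-module algebra is an algebra $A$ with a right $H$-action $\triangleleft$ such that $(ab)\triangleleft h=(a\triangleleft h_{(1)})(b\triangleleft h_{(2)})$ and $1\triangleleft h=\varepsilon(h)1$. A left $H$-comodule coalgebra is a coalgebra $C$ with a left $H$-coaction such that $c^{[-1]}\otimes c^{[0]}{}_{(1)}\otimes c^{[0]}{}_{(2)}=c_{(1)}{}^{[-1]}c_{(2)}{}^{[-1]}\otimes c_{(1)}{}^{[0]}\otimes c_{(2)}{}^{[0]}$ and $c^{[-1]}\varepsilon(c^{[0]})=\varepsilon(c)1$. **Bicrossproduct.** Let $A,B$ be Hopf algebras such that (i) $A$ is a left $B$-comodule coalgebra with coaction $\delta$ and $B$ is a right $A$-module algebra with action $\triangleleft$; (ii) $\varepsilon(b\triangleleft a)=\varepsilon(b)\varepsilon(a)$ and $\delta(1)=1\otimes 1$; (iii) $(b\triangleleft a)_{(1)}\otimes(b\triangleleft a)_{(2)}=(b_{(1)}\triangleleft a_{(1)})\,a_{(2)}{}^{[-1]}\otimes b_{(2)}\triangleleft a_{(2)}{}^{[0]}$; (iv) $a_{(1)}{}^{[-1]}(b\triangleleft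 a_{(2)})\otimes a_{(1)}{}^{[0]}=(b\triangleleft a_{(1)})\,a_{(2)}{}^{[-1]}\otimes a_{(2)}{}^{[0]}$. The bicrossproduct of $A$ and $B$ is a Hopf algebra $A\triangleright\!\!\!\blacktriangleleft B$ whose underlying vector space is $A\otimes B$, with product $(a\otimes b)(a'\otimes b')=aa'_{(1)}\otimes(b\triangleleft a'_{(2)})b'$, unit $1\otimes 1$, coproduct $\Delta(a\otimes b)=a_{(1)}\otimes a_{(2)}{}^{[-1]}b_{(1)}\otimes a_{(2)}{}^{[0]}\otimes b_{(2)}$, counit $\varepsilon(a\otimes b)=\varepsilon(a)\varepsilon(b)$, and antipode $S(a\otimes b)=S(a^{[0]}{}_{(2)})\otimes S(a^{[-1]}b)\triangleleft S(a^{[0]}{}_{(1)})$. **Right bialgebroid.** A $B$-coring is a coalgebra in the monoidal category of $B$-bimodules. A right $B$-bialgebroid is an algebra $\mathcal R$ with algebra maps $s:B\to\mathcal R$ and $t:B^{op}\to\mathcal R$ with commuting images, and a $B$-coring structure $(\Delta,\varepsilon)$ on $\mathcal R$ for the bimodule structure $b\triangleright X\triangleleft b'=Xs(b')t(b)$ (so $Xs(b)\otimes_B Y=X\otimes_B Yt(b)$), such that: (i) $\Delta$ corestricts to an algebra map $\mathcal R\to\mathcal R\times_B\mathcal R:=\{\sum_i X_i\otimes_B Y_i\mid \sum_i s(b)X_i\otimes_B Y_i=\sum_i X_i\otimes_B t(b)Y_i\ \forall b\in B\}$, an algebra under factorwise multiplication; (ii) $\varepsilon(1)=1_B$ and $\varepsilon(s(\varepsilon(X))Y)=\varepsilon(XY)=\varepsilon(t(\varepsilon(X))Y)$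 for all $X,Y$. **(Anti-)right Hopf algebroid.** A right bialgebroid $\mathcal R$ is a right Hopf algebroid if $\lambda:\mathcal R\otimes_{B^{op}}\mathcal R\to\mathcal R\otimes_B\mathcal R$, $\lambda(X\otimes_{B^{op}}Y)=XY^{(1)}\otimes_B Y^{(2)}$, is invertible, where $Xt(b)\otimes_{B^{op}}Y=X\otimes_{B^{op}}t(b)Y$. It is an anti-right Hopf algebroid if $\mu:\mathcal R\otimes^{B^{op}}\mathcal R\to\mathcal R\otimes_B\mathcal R$, $\mu(X\otimes^{B^{op}}Y)=X^{(1)}\otimes_B YX^{(2)}$, is invertible, where $s(b)X\otimes^{B^{op}}Y=X\otimes^{B^{op}}Ys(b)$. Notation: $X_{-}\otimes_{B^{op}}X_{+}:=\lambda^{-1}(1\otimes_B X)$ and $X_{[+]}\otimes^{B^{op}}X_{[-]}:=\mu^{-1}(X\otimes_B 1)$; these determine $\lambda^{-1}(Y\otimes_B X)=YX_{-}\otimes_{B^{op}}X_{+}$ and $\mu^{-1}(X\otimes_B Y)=X_{[+]}\otimes^{B^{op}}YX_{[-]}$. **Full Hopf algebroid.** A right $B$-bialgebroid $\mathcal R$ is a full Hopf algebroid if there is an invertible anti-algebra map $S:\mathcal R\to\mathcal R$ (its antipode) with $S\circ t=s$, $\;X^{(2)}S^{-1}(X^{(1)})^{(1)}\otimes_B S^{-1}(X^{(1)})^{(2)}=1\otimes_B S^{-1}(X)$, and $S(X^{(2)})^{(1)}\otimes_B X^{(1)}S(X^{(2)})^{(2)}=S(X)\otimes_B 1$ for all $X\in\mathcal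 R$. **Hopf 2-algebra.** An (anti-)right Hopf 2-algebra consists of Hopf algebras $(B,m_B,1_B,\Delta_B,\varepsilon_B,S_B)$ and $(H,m,1_H,\Delta,\varepsilon,S)$ and an (anti-)right Hopf algebroid $(H,m,1_H,\blacktriangle,\varepsilon_H,s,t)$ over $B$ such that: (i) the underlying algebras of the Hopf algebra $H$ and the (anti-)right Hopf algebroid $H$ coincide; (ii) $\varepsilon_H:H\to B$ is a coalgebra map; (iii) the source $s:B\to H$ and target $t:B^{op}\to H$ are bialgebra morphisms; (iv) $(\blacktriangle\otimes\blacktriangle)\circ\Delta=(\mathrm{id}_H\otimes\mathrm{flip}\otimes\mathrm{id}_H)\circ(\Delta\otimes_B\Delta)\circ\blacktriangle$, i.e. for all $X\in H$, $$X_{(1)}{}^{(1)}\otimes_B X_{(1)}{}^{(2)}\otimes X_{(2)}{}^{(1)}\otimes_B X_{(2)}{}^{(2)}=X^{(1)}{}_{(1)}\otimes_B X^{(2)}{}_{(1)}\otimes X^{(1)}{}_{(2)}\otimes_B X^{(2)}{}_{(2)}.$$ Here $\Delta\otimes_B\Delta$ takes values in $(H\otimes H)\otimes_{B\otimes B}(H\otimes H)$, with bimodule structure $(b\otimes b')\triangleright(X\otimes Y)=Xt(b)\otimes Yt(b')$, $(X\otimes Y)\triangleleft(b\otimes b')=Xs(b)\otimes Ys(b')$, and $\mathrm{id}\otimes\mathrm{flip}\otimes\mathrm{id}$ sends $(X\otimes Y)\otimes_{B\otimes B}(Z\otimes W)$ to $(X\otimes_B Z)\otimes(Y\otimes_B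 W)$. An (anti-)right Hopf 2-algebra is a Hopf 2-algebra if the right bialgebroid $(H,m,1_H,\blacktriangle,\varepsilon_H,s,t)$ is a full Hopf algebroid.
   Formalization: In the ''Moreover'' part the antipode of B is also assumed to satisfy S²=id_B: the displayed antipode sends t(b) to 1⊗S_B²(b), so S∘t=s fails otherwise. That the bicrossproduct structure is a Hopf algebra is assumed, as the context asserts. *)

(* Defs.v *)
From HB Require Import structures.
From mathcomp Require Import all_boot all_order all_algebra.
From mathcomp Require Import boolp.

Set Implicit Arguments.
Unset Strict Implicit.
Unset Printing Implicit Defensive.

Import GRing.Theory.
Local Open Scope ring_scope.
Local Open Scope quotient_scope.

Section BalancedTensor.
Variables (k : fieldType) (V W : lmodType k) (R : Type).
Variables (r : V -> R -> V) (l : R -> W -> W).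

(* V ⊗_R W as formal sums of pairs modulo the congruence of k-modules generated
   by bilinearity over k and the relations (r v b, w) = (v, l b w).  The maps
   [r] and [l] are explicit because one algebra H carries several B-module
   structures. *)
Definition fs_scale (a : k) (s : seq (V * W)) : seq (V * W) :=
  [seq (a *: p.1, p.2) | p <- s].

Inductive tens_eq : seq (V * W) -> seq (V * W) -> Prop :=
| te_refl s : tens_eq s s
| te_sym s1 s2 : tens_eq s1 s2 -> tens_eq s2 s1
| te_trans s1 s2 s3 : tens_eq s1 s2 -> tens_eq s2 s3 -> tens_eq s1 s3
| te_cat s1 s2 t1 t2 :
    tens_eq s1 s2 -> tens_eq t1 t2 -> tens_eq (s1 ++ t1) (s2 ++ t2)
| te_catC s1 s2 : tens_eq (s1 ++ s2) (s2 ++ s1)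
| te_scale a s1 s2 : tens_eq s1 s2 -> tens_eq (fs_scale a s1) (fs_scale a s2)
| te_zero w : tens_eq [:: (0, w)] [::]
| te_addl v v' w : tens_eq [:: (v + v', w)] [:: (v, w); (v', w)]
| te_addr v w w' : tens_eq [:: (v, w + w')] [:: (v, w); (v, w')]
| te_scal a v w : tens_eq [:: (a *: v, w)] [:: (v, a *: w)]
| te_bal v b w : tens_eq [:: (r v b, w)] [:: (v, l b w)].

Definition tens_eqb (s t : seq (V * W)) : bool := `[< tens_eq s t >].

Lemma tens_eqb_refl : reflexive tens_eqb.
Proof. by move=> s; apply/asboolP; apply: te_refl. Qed.
Lemma tens_eqb_sym : symmetric tens_eqb.
Proof. by move=> s t; apply/asboolP/asboolP; apply: te_sym. Qed.
Lemma tens_eqb_trans : transitive tens_eqb.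
Proof.
by move=> s t u /asboolP h1 /asboolP h2; apply/asboolP; apply: te_trans h1 h2.
Qed.

Canonical tens_equiv :=
  EquivRel tens_eqb tens_eqb_refl tens_eqb_sym tens_eqb_trans.

Definition btens : Type := {eq_quot tens_equiv}.
HB.instance Definition _ := Choice.on btens.
HB.instance Definition _ := Quotient.on btens.

Definition pure (v : V) (w : W) : btens := \pi_btens [:: (v, w)].

Lemma btens_eqP s t : tens_eq s t <-> \pi_btens s = \pi_btens t.
Proof. by split=> [h | /eqquotP/asboolP//]; apply/eqquotP/asboolP. Qed.

Lemma btensW (P : btens -> Prop) : (forall s, P (\pi_btens s)) -> forall u, P u.
Proof. by move=> h u; rewrite -[u]reprK. Qed.

Let te_repr s : tens_eq (repr (\pi_btens s)) s.
Proof. by apply/btens_eqP; rewrite reprK. Qed.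

Definition btens_add (u v : btens) : btens := \pi_btens (repr u ++ repr v).
Definition btens_scale (a : k) (u : btens) : btens :=
  \pi_btens (fs_scale a (repr u)).

Let addE s t : btens_add (\pi_btens s) (\pi_btens t) = \pi_btens (s ++ t).
Proof. by apply/btens_eqP/te_cat; apply: te_repr. Qed.
Let scaleE a s : btens_scale a (\pi_btens s) = \pi_btens (fs_scale a s).
Proof. by apply/btens_eqP/te_scale; apply: te_repr. Qed.

Let fs_scaleDl a b s : tens_eq (fs_scale (a + b) s) (fs_scale a s ++ fs_scale b s).
Proof.
elim: s => [|[v w] s ih] /=; first exact: te_refl.
rewrite scalerDl -/(fs_scale _ s) -/(fs_scale a s) -/(fs_scale b s).
apply: te_trans (te_cat (te_addl _ _ _) ih) _.
apply: (@te_cat [:: _] [:: _]); first exact: te_refl.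
apply: (@te_trans _ ((fs_scale a s ++ [:: (b *: v, w)]) ++ fs_scale b s)).
  apply: (@te_cat (_ :: fs_scale a s) _ (fs_scale b s)); last exact: te_refl.
  exact: (@te_catC [:: _]).
by rewrite -catA; apply: te_refl.
Qed.

Let fs_scale0 s : tens_eq (fs_scale 0 s) [::].
Proof.
elim: s => [|[v w] s ih] /=; first exact: te_refl.
by rewrite scale0r; apply: te_trans (te_cat (te_zero w) ih) (te_refl _).
Qed.

Let fs_scale1 s : fs_scale 1 s = s.
Proof. by rewrite /fs_scale -[RHS]map_id; apply: eq_map => -[v w]/=; rewrite scale1r. Qed.

Fact btens_addA : associative btens_add.
Proof. by elim/btensW=> s; elim/btensW=> t; elim/btensW=> u; rewrite !addE catA. Qed.
Fact btens_addC : commutative btens_add.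
Proof.
by elim/btensW=> s; elim/btensW=> t; rewrite !addE; apply/btens_eqP/te_catC.
Qed.
Fact btens_add0 : left_id (\pi_btens [::]) btens_add.
Proof. by elim/btensW=> s; rewrite !addE. Qed.
Fact btens_addN : left_inverse (\pi_btens [::]) (btens_scale (-1)) btens_add.
Proof.
elim/btensW=> s; rewrite scaleE addE; apply/btens_eqP.
rewrite -{2}(fs_scale1 s); apply: te_trans (te_sym (fs_scaleDl _ _ _)) _.
by rewrite addNr; apply: fs_scale0.
Qed.
HB.instance Definition _ :=
  GRing.isZmodule.Build btens btens_addA btens_addC btens_add0 btens_addN.

Fact btens_scaleA a b u : btens_scale a (btens_scale b u) = btens_scale (a * b) u.
Proof.
elim/btensW: u => s; rewrite !scaleE /fs_scale -map_comp; congr (\pi_btens _).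
by apply: eq_map => -[v w] /=; rewrite scalerA.
Qed.
Fact btens_scale1 : left_id 1 btens_scale.
Proof. by elim/btensW=> s; rewrite scaleE fs_scale1. Qed.
Fact btens_scaleDr : right_distributive btens_scale +%R.
Proof.
move=> a; elim/btensW=> s; elim/btensW=> t.
rewrite -[X in btens_scale _ X]/(btens_add _ _) -[RHS]/(btens_add _ _).
by rewrite addE !scaleE addE /fs_scale map_cat.
Qed.
Fact btens_scaleDl u : {morph btens_scale^~ u : a b / a + b}.
Proof.
move=> a b; elim/btensW: u => s; rewrite -[RHS]/(btens_add _ _) !scaleE addE.
exact/btens_eqP/fs_scaleDl.
Qed.
HB.instance Definition _ := GRing.Zmodule_isLmodule.Build k btens
  btens_scaleA btens_scale1 btens_scaleDr btens_scaleDl.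

Lemma pureDl v v' w : pure (v + v') w = pure v w + pure v' w.
Proof. by rewrite -[RHS]/(btens_add _ _) addE; apply/btens_eqP/te_addl. Qed.
Lemma pureDr v w w' : pure v (w + w') = pure v w + pure v w'.
Proof. by rewrite -[RHS]/(btens_add _ _) addE; apply/btens_eqP/te_addr. Qed.
Lemma pureZl a v w : pure (a *: v) w = a *: pure v w.
Proof. by rewrite -[RHS]/(btens_scale _ _) scaleE. Qed.
Lemma pureZr a v w : pure v (a *: w) = a *: pure v w.
Proof. by rewrite -pureZl /pure; apply/esym/btens_eqP/te_scal. Qed.
Lemma pure_bal v b w : pure (r v b) w = pure v (l b w).
Proof. exact/btens_eqP/te_bal. Qed.

(* The Sweedler sum of f(v, w) over u = Σ v ⊗ w.  It is computed on a chosen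
   representative; for [f] bilinear and balanced it does not depend on that
   choice, see [tsumE] and [tsum_linear]. *)
Definition tsum (M : nmodType) (u : btens) (f : V -> W -> M) : M :=
  \sum_(p <- repr u) f p.1 p.2.

Lemma piE_sum s : \pi_btens s = \sum_(p <- s) pure p.1 p.2.
Proof.
elim: s => [|p s ih]; first by rewrite big_nil.
by rewrite big_cons -ih -[RHS]/(btens_add _ _) addE -surjective_pairing.
Qed.

Lemma tsum_pure u : tsum u pure = u.
Proof. by rewrite /tsum -piE_sum reprK. Qed.

Lemma btens_ind (P : btens -> Prop) :
  P 0 -> (forall v w u, P u -> P (pure v w + u)) -> forall u, P u.
Proof.
move=> P0 PD; elim/btensW=> s; rewrite piE_sum.
by elim: s => [|p s ih]; rewrite ?big_nil ?big_cons //; apply: PD.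
Qed.

Definition bilin (M : lmodType k) (f : V -> W -> M) : Prop :=
  (forall w, linear (f^~ w)) /\ (forall v, linear (f v)).
Definition balanced (M : Type) (f : V -> W -> M) : Prop :=
  forall v b w, f (r v b) w = f v (l b w).

Lemma tsum_pi (M : lmodType k) (f : V -> W -> M) : bilin f -> balanced f ->
  forall s, tsum (\pi_btens s) f = \sum_(p <- s) f p.1 p.2.
Proof.
move=> [fl fr] fb s; rewrite /tsum.
have f0 w : f 0 w = 0.
  by have := fl w (-1) 0 0; rewrite scaler0 addr0 scaleN1r addNr.
have fZ a v w : f (a *: v) w = a *: f v w.
  by have := fl w a v 0; rewrite addr0 f0 addr0.
have fZr a v w : f v (a *: w) = a *: f v w.
  have fv0 : f v 0 = 0.
    by have := fr v (-1) 0 0; rewrite scaler0 addr0 scaleN1r addNr.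
  by have := fr v a w 0; rewrite addr0 fv0 addr0.
suff hS s1 s2 : tens_eq s1 s2 ->
    \sum_(p <- s1) f p.1 p.2 = \sum_(p <- s2) f p.1 p.2 by apply: hS.
elim=> {s s1 s2} //=.
- by move=> ? ? ? _ -> _ ->.
- by move=> ? ? ? ? _ h1 _ h2; rewrite !big_cat /= h1 h2.
- by move=> ? ?; rewrite !big_cat /= addrC.
- move=> a s1 s2 _ h; rewrite /fs_scale !big_map /=.
  under eq_bigr do rewrite fZ; under [RHS]eq_bigr do rewrite fZ.
  by rewrite -!scaler_sumr h.
- by move=> w; rewrite big_seq1 big_nil f0.
- move=> v v' w; rewrite big_seq1 big_cons big_seq1 /=.
  by have := fl w 1 v v'; rewrite !scale1r.
- move=> v w w'; rewrite big_seq1 big_cons big_seq1 /=.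
  by have := fr v 1 w w'; rewrite !scale1r.
- by move=> a v w; rewrite !big_seq1 /= fZ fZr.
- by move=> v b w; rewrite !big_seq1 /= fb.
Qed.

Lemma tsumE (M : lmodType k) (f : V -> W -> M) v w :
  bilin f -> balanced f -> tsum (pure v w) f = f v w.
Proof. by move=> bf lf; rewrite /pure tsum_pi // big_seq1. Qed.

Lemma tsum_linear (M : lmodType k) (f : V -> W -> M) :
  bilin f -> balanced f -> linear (fun u : btens => tsum u f : M).
Proof.
move=> bf lf a; elim/btensW=> s; elim/btensW=> t.
have -> : a *: \pi_btens s + \pi_btens t = \pi_btens (fs_scale a s ++ t).
  by rewrite -[LHS]/(btens_add (btens_scale _ _) _) scaleE addE.
rewrite !tsum_pi // big_cat /= /fs_scale big_map /=; congr (_ + _).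
case: bf => fl fr; rewrite scaler_sumr; apply: eq_bigr => -[v w] _ /=.
have f0 : f 0 w = 0.
  by have := fl w (-1) 0 0; rewrite scaler0 addr0 scaleN1r addNr.
by have := fl w a v 0; rewrite addr0 f0 addr0.
Qed.

End BalancedTensor.

Notation "\sw_ ( x , y <- u ) F" := (tsum u (fun x y => F))
  (at level 41, x binder, y binder, u at level 50, F at level 41,
   format "\sw_ ( x ,  y  <-  u )  F").

Notation "v ⊠ w" := (pure _ _ v w) (at level 40, no associativity).

(* With no balancing operators, [btens] is the tensor product over k. *)
Definition noactr (V : Type) (v : V) (_ : void) : V := v.
Definition noactl (W : Type) (_ : void) (w : W) : W := w.

Notation "V ⊗ W" := (@btens _ V%type W%type void (@noactr _) (@noactl _))
  (at level 40, no associativity) : type_scope.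
Notation "v ⊗ w" := (@pure _ _ _ void (@noactr _) (@noactl _) v w)
  (at level 40, no associativity) : ring_scope.

Section Hopf.
Variable k : fieldType.

Record hopf_data (H : algType k) := HopfData {
  comul : H -> H ⊗ H;
  counit : H -> k;
  antipode : H -> H }.

Definition tens_mul (G H : algType k) (u v : G ⊗ H) : G ⊗ H :=
  \sw_(x, y <- u) \sw_(x', y' <- v) (x * x') ⊗ (y * y').

Record is_hopf (H : algType k) (D : hopf_data H) : Prop := IsHopf {
  comul_linear : linear (comul D);
  counit_scalar : scalar (counit D);
  antipode_linear : linear (antipode D);
  comul_coassoc : forall x : H,
    \sw_(x1, x2 <- comul D x) \sw_(x11, x12 <- comul D x1) x11 ⊗ (x12 ⊗ x2)
    = \sw_(x1, x2 <- comul D x) x1 ⊗ comul D x2;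
  counit_l : forall x : H, \sw_(x1, x2 <- comul D x) counit D x1 *: x2 = x;
  counit_r : forall x : H, \sw_(x1, x2 <- comul D x) counit D x2 *: x1 = x;
  comul1 : comul D 1 = 1 ⊗ 1;
  comulM : forall x y : H, comul D (x * y) = tens_mul (comul D x) (comul D y);
  counit_monoid_morphism : monoid_morphism (counit D);
  antipode_l : forall x : H,
    \sw_(x1, x2 <- comul D x) antipode D x1 * x2 = (counit D x)%:A;
  antipode_r : forall x : H,
    \sw_(x1, x2 <- comul D x) x1 * antipode D x2 = (counit D x)%:A }.

Record hopfAlg := HopfAlg {
  hopf_sort :> algType k;
  hopf_ops :> hopf_data hopf_sort;
  hopf_laws : is_hopf hopf_ops }.

Definition coalgebra_map (G H : algType k) (DG : hopf_data G) (DH : hopf_data H)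
    (f : G -> H) : Prop :=
  [/\ linear f,
      forall x, comul DH (f x) = \sw_(x1, x2 <- comul DG x) f x1 ⊗ f x2
    & forall x, counit DH (f x) = counit DG x].

Record bicross_data (A B : hopfAlg) := BicrossData {
  act : B -> A -> B;
  coact : A -> B ⊗ A (* a |-> a^[-1] ⊗ a^[0] *) }.

(* These conditions make [bicross] below an algebra, but they do not imply that
   its coproduct is multiplicative (nothing here relates the coaction of a
   product to the coactions of its factors).  That the whole structure
   [bicross_hopf] is a Hopf algebra is therefore a separate requirement
   [is_hopf (bicross_hopf P)] on a bicrossproduct. *)
Record is_bicross (A B : hopfAlg) (P : bicross_data A B) : Prop := IsBicross {
  act_linear_l : forall a, linear (fun b => act P b a);
  act_linear_r : forall b, linear (act P b);
  act1 : forall b, act P b 1 = b;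
  actM : forall b a a', act P b (a * a') = act P (act P b a) a';
  act_mul : forall b b' a, act P (b * b') a
    = \sw_(a1, a2 <- comul A a) act P b a1 * act P b' a2;
  act_one : forall a, act P 1 a = (counit A a)%:A;
  coact_linear : linear (coact P);
  coact_coassoc : forall a,
    \sw_(c, a0 <- coact P a) \sw_(c1, c2 <- comul B c) c1 ⊗ (c2 ⊗ a0)
    = \sw_(c, a0 <- coact P a) c ⊗ coact P a0;
  coact_counit : forall a, \sw_(c, a0 <- coact P a) counit B c *: a0 = a;
  coact_comul : forall a,
    \sw_(c, a0 <- coact P a) c ⊗ comul A a0
    = \sw_(a1, a2 <- comul A a) \sw_(c1, x1 <- coact P a1)
        \sw_(c2, x2 <- coact P a2) (c1 * c2) ⊗ (x1 ⊗ x2);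
  coact_eps : forall a,
    \sw_(c, a0 <- coact P a) counit A a0 *: c = (counit A a)%:A;
  act_eps : forall b a, counit B (act P b a) = counit B b * counit A a;
  coact_one : coact P 1 = 1 ⊗ 1;
  act_comul : forall b a, comul B (act P b a)
    = \sw_(b1, b2 <- comul B b) \sw_(a1, a2 <- comul A a)
        \sw_(c, a0 <- coact P a2) (act P b1 a1 * c) ⊗ act P b2 a0;
  act_coact : forall b a,
    \sw_(a1, a2 <- comul A a) \sw_(c, a0 <- coact P a1) (c * act P b a2) ⊗ a0
    = \sw_(a1, a2 <- comul A a) \sw_(c, a0 <- coact P a2) (act P b a1 * c) ⊗ a0 }.

Record bicross_pair (A B : hopfAlg) := BicrossPair {
  bicross_ops :> bicross_data A B;
  bicross_laws : is_bicross bicross_ops }.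

End Hopf.

Section Linearity.
Variable k : fieldType.
Implicit Types U V W M : lmodType k.

Lemma lin_add U V (f : U -> V) x y : linear f -> f (x + y) = f x + f y.
Proof. by move=> hf; have := hf 1 x y; rewrite !scale1r. Qed.
Lemma lin_scale U V (f : U -> V) a x : linear f -> f (a *: x) = a *: f x.
Proof.
move=> hf; have f0 : f 0 = 0.
  by have := hf (-1) 0 0; rewrite scaler0 addr0 scaleN1r addNr.
by have := hf a x 0; rewrite !addr0 f0 addr0.
Qed.

Lemma lin_id V : linear (fun x : V => x). Proof. by []. Qed.
Lemma lin_pure_l U V W (R : Type) (r : V -> R -> V) (l : R -> W -> W)
    (g : U -> V) w : linear g -> linear (fun x => pure r l (g x) w).
Proof. by move=> hg a x y; rewrite hg pureDl pureZl. Qed.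
Lemma lin_pure_r U V W (R : Type) (r : V -> R -> V) (l : R -> W -> W)
    (g : U -> W) v : linear g -> linear (fun x => pure r l v (g x)).
Proof. by move=> hg a x y; rewrite hg pureDr pureZr. Qed.
Lemma lin_mul_l U (H : algType k) (g : U -> H) c :
  linear g -> linear (fun x => g x * c).
Proof. by move=> hg a x y; rewrite hg mulrDl scalerAl. Qed.
Lemma lin_mul_r U (H : algType k) (g : U -> H) c :
  linear g -> linear (fun x => c * g x).
Proof. by move=> hg a x y; rewrite hg mulrDr scalerAr. Qed.
Lemma lin_comp U V W (f : V -> W) (g : U -> V) :
  linear f -> linear g -> linear (fun x => f (g x)).
Proof. by move=> hf hg a x y; rewrite hg hf. Qed.
Lemma lin_tsum_in U V W M (R : Type) (r : V -> R -> V) (l : R -> W -> W)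
    (u : btens r l) (F : U -> V -> W -> M) :
  (forall v w, linear (fun x => F x v w)) -> linear (fun x => tsum u (F x)).
Proof.
move=> hF a x y; rewrite /tsum scaler_sumr -big_split /=.
by apply: eq_bigr => p _; apply: hF.
Qed.
Lemma lin_tsum_arg U V W M (R : Type) (r : V -> R -> V) (l : R -> W -> W)
    (g : U -> btens r l) (F : V -> W -> M) :
  linear g -> bilin F -> balanced r l F -> linear (fun x => tsum (g x) F).
Proof. by move=> hg bF lF; apply: (lin_comp (tsum_linear bF lF) hg). Qed.

Lemma lin_sum V M (f : V -> M) (I : Type) (s : seq I) (G : I -> V) :
  linear f -> f (\sum_(i <- s) G i) = \sum_(i <- s) f (G i).
Proof.
move=> hf; have f0 : f 0 = 0.
  by have := hf (-1) 0 0; rewrite scaler0 addr0 scaleN1r addNr.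
elim: s => [|i s ih]; rewrite ?big_nil // !big_cons -ih.
by have := hf 1 (G i) (\sum_(j <- s) G j); rewrite !scale1r.
Qed.

Lemma lin_tsum U V W M (R : Type) (r : V -> R -> V) (l : R -> W -> W)
    (f : U -> M) (u : btens r l) (F : V -> W -> U) :
  linear f -> f (tsum u F) = tsum u (fun x y => f (F x y)).
Proof. exact: lin_sum. Qed.

Lemma lin_ext V W M (R : Type) (r : V -> R -> V) (l : R -> W -> W)
    (f g : btens r l -> M) : linear f -> linear g ->
  (forall v w, f (pure r l v w) = g (pure r l v w)) -> forall u, f u = g u.
Proof.
move=> hf hg fg u; rewrite -(tsum_pure u) !lin_tsum //.
by apply: eq_bigr => p _; apply: fg.
Qed.

Lemma eq_tsum V W (M : nmodType) (R : Type) (r : V -> R -> V) (l : R -> W -> W)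
    (u : btens r l) (F G : V -> W -> M) :
  (forall v w, F v w = G v w) -> tsum u F = tsum u G.
Proof. by move=> FG; apply: eq_bigr => p _; apply: FG. Qed.

Lemma tsum_exchange V W V' W' (M : nmodType) (R R' : Type)
    (r : V -> R -> V) (l : R -> W -> W) (r' : V' -> R' -> V')
    (l' : R' -> W' -> W') (u : btens r l) (u' : btens r' l')
    (F : V -> W -> V' -> W' -> M) :
  \sw_(x, y <- u) \sw_(x', y' <- u') F x y x' y'
  = \sw_(x', y' <- u') \sw_(x, y <- u) F x y x' y'.
Proof. exact: exchange_big. Qed.

Lemma balanced0 V W (M : Type) (F : V -> W -> M) :
  balanced (@noactr V) (@noactl W) F.
Proof. by move=> ? []. Qed.

Lemma tsum_tensE V W M (F : V -> W -> M) v w : bilin F ->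
  \sw_(x, y <- v ⊗ w) F x y = F v w.
Proof. by move=> bF; rewrite tsumE //; apply: balanced0. Qed.

Lemma tsum_tsum V W V' W' M (R : Type) (r : V -> R -> V) (l : R -> W -> W)
    (u : btens r l) (G : V -> W -> V' ⊗ W') (F : V' -> W' -> M) : bilin F ->
  \sw_(x', y' <- \sw_(x, y <- u) G x y) F x' y'
  = \sw_(x, y <- u) \sw_(x', y' <- G x y) F x' y'.
Proof.
move=> bF; rewrite (lin_tsum (f := fun t : V' ⊗ W' => tsum t F : M)) //.
by apply: tsum_linear => //; apply: balanced0.
Qed.

Definition trilin U V W M (F : U -> V -> W -> M) : Prop :=
  [/\ forall y z, linear (fun x => F x y z), forall x z, linear (fun y => F x y z)
    & forall x y, linear (F x y)].

End Linearity.

Section BicrossAlgebra.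
Variables (k : fieldType) (A B : hopfAlg k) (P : bicross_pair A B).
Local Notation "b <| a" := (act P b a) (at level 39, left associativity).
Local Notation Δ := (comul A).

Let hA := hopf_laws A.
Let hP := bicross_laws P.

Definition bicross of bicross_pair A B : Type := A ⊗ B.
HB.instance Definition _ := GRing.Lmodule.on (bicross P).

Definition bicross_mul (u v : A ⊗ B) : A ⊗ B :=
  \sw_(a, b <- u) \sw_(a', b' <- v)
    \sw_(a1, a2 <- Δ a') (a * a1) ⊗ ((b <| a2) * b').

Lemma comul_coassoc_tri (C : hopfAlg k) (M : lmodType k)
    (F : C -> C -> C -> M) (x : C) : trilin F ->
  \sw_(x1, x2 <- comul C x) \sw_(x11, x12 <- comul C x1) F x11 x12 x2
  = \sw_(x1, x2 <- comul C x) \sw_(x21, x22 <- comul C x2) F x1 x21 x22.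
Proof.
move=> [F1 F2 F3].
pose f (t : C ⊗ (C ⊗ C)) : M := \sw_(x1, y <- t) \sw_(x2, x3 <- y) F x1 x2 x3.
have bF c : bilin (F c) by split=> *; [apply: F2 | apply: F3].
have bf : bilin (fun x1 (y : C ⊗ C) => \sw_(x2, x3 <- y) F x1 x2 x3 : M).
  split=> [y|c]; first by apply: lin_tsum_in => *; apply: F1.
  by apply: tsum_linear => //; apply: balanced0.
have hf : linear f by apply: tsum_linear => //; apply: balanced0.
have := congr1 f (comul_coassoc (hopf_laws C) x).
rewrite (lin_tsum _ _ hf) (lin_tsum _ _ hf) => E.
transitivity (\sw_(x1, x2 <- comul C x)
    f (\sw_(x11, x12 <- comul C x1) x11 ⊗ (x12 ⊗ x2))).
  apply: eq_tsum => x1 x2; rewrite (lin_tsum _ _ hf); apply: eq_tsum => x11 x12.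
  by rewrite /f !tsum_tensE.
by rewrite E; apply: eq_tsum => x1 x2; rewrite /f tsum_tensE.
Qed.

Let bil_m a b : bilin (fun (a' : A) (b' : B) =>
  \sw_(a1, a2 <- Δ a') (a * a1) ⊗ ((b <| a2) * b') : A ⊗ B).
Proof.
split=> [b' | a'].
  apply: lin_tsum_arg; [exact: comul_linear hA | split | exact: balanced0].
    by move=> y; apply/lin_pure_l/lin_mul_r/lin_id.
  move=> x; apply/lin_pure_r/lin_mul_l; exact: (act_linear_r hP).
by apply: lin_tsum_in => x y; apply/lin_pure_r/lin_mul_r/lin_id.
Qed.

Let bil_ml (a' : A) (b' : B) : bilin (fun (a : A) (b : B) =>
  \sw_(a1, a2 <- Δ a') (a * a1) ⊗ ((b <| a2) * b') : A ⊗ B).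
Proof.
split=> [b | a]; apply: lin_tsum_in => x y.
  by apply/lin_pure_l/lin_mul_l/lin_id.
by apply/lin_pure_r/lin_mul_l/(act_linear_l hP).
Qed.

Let mul_lin_l v : linear (fun u => bicross_mul u v).
Proof.
apply: tsum_linear; last exact: balanced0.
by split=> [b|a]; apply: lin_tsum_in => x y; case: (bil_ml x y).
Qed.

Let mul_lin_r u : linear (bicross_mul u).
Proof.
apply: lin_tsum_in => a b; apply: tsum_linear; last exact: balanced0.
exact: bil_m.
Qed.

Lemma bicross_mulE (a a' : A) (b b' : B) : bicross_mul (a ⊗ b) (a' ⊗ b')
  = \sw_(a1, a2 <- Δ a') (a * a1) ⊗ ((b <| a2) * b').
Proof.
rewrite /bicross_mul tsum_tensE; first by rewrite tsum_tensE; last exact: bil_m.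
by split=> [y|x]; apply: lin_tsum_in => c d; case: (bil_ml c d).
Qed.

Fact bicross_mulA : associative bicross_mul.
Proof.
move=> u v w.
apply: (@lin_ext _ _ _ _ _ _ _ (fun u => bicross_mul u (bicross_mul v w))
  (fun u => bicross_mul (bicross_mul u v) w)) => [||a b].
- exact: mul_lin_l.
- exact: (lin_comp (mul_lin_l w) (mul_lin_l v)).
apply: (@lin_ext _ _ _ _ _ _ _
  (fun v => bicross_mul (a ⊗ b) (bicross_mul v w))
  (fun v => bicross_mul (bicross_mul (a ⊗ b) v) w)) => [||a' b'].
- exact: (lin_comp (mul_lin_r _) (mul_lin_l _)).
- exact: (lin_comp (mul_lin_l _) (mul_lin_r _)).
apply: (@lin_ext _ _ _ _ _ _ _
  (fun w => bicross_mul (a ⊗ b) (bicross_mul (a' ⊗ b') w))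
  (fun w => bicross_mul (bicross_mul (a ⊗ b) (a' ⊗ b')) w)) => [||a'' b''].
- exact: (lin_comp (mul_lin_r _) (mul_lin_r _)).
- exact: mul_lin_r.
rewrite !bicross_mulE (lin_tsum _ _ (mul_lin_r _)) (lin_tsum _ _ (mul_lin_l _)).
transitivity (\sw_(p, q <- Δ a') \sw_(x, y <- Δ a'') \sw_(x1, x2 <- Δ x)
   (a * (p * x1)) ⊗ ((b <| (q * x2)) * ((b' <| y) * b''))).
  rewrite tsum_exchange; apply: eq_tsum => x y; rewrite bicross_mulE comulM //.
  have bf : bilin (fun p q : A =>
      (a * p) ⊗ ((b <| q) * ((b' <| y) * b'')) : A ⊗ B).
    split=> *; first exact/lin_pure_l/lin_mul_r/lin_id.
    exact/lin_pure_r/lin_mul_l/(act_linear_r hP).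
  rewrite tsum_tsum //; apply: eq_tsum => p q.
  by rewrite tsum_tsum //; apply: eq_tsum => x1 x2; rewrite tsum_tensE.
apply: eq_tsum => p q; rewrite bicross_mulE.
rewrite (@comul_coassoc_tri A (A ⊗ B)%type (fun x1 x2 y =>
  (a * (p * x1)) ⊗ ((b <| (q * x2)) * ((b' <| y) * b'')))); last first.
  split=> *.
  - exact/lin_pure_l/lin_mul_r/lin_mul_r/lin_id.
  - apply/lin_pure_r/lin_mul_l/(lin_comp (act_linear_r hP _)).
    exact/lin_mul_r/lin_id.
  - exact/lin_pure_r/lin_mul_r/lin_mul_l/(act_linear_r hP).
apply: eq_tsum => x y; rewrite (act_mul hP).
have hl c : linear (fun z : B => c ⊗ (z * b'') : A ⊗ B).
  exact/lin_pure_r/lin_mul_l/lin_id.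
rewrite (lin_tsum _ _ (hl _)); apply: eq_tsum => y1 y2.
by rewrite (actM hP) !mulrA.
Qed.

Fact bicross_mul1l : left_id (1 ⊗ 1) bicross_mul.
Proof.
apply: (@lin_ext _ _ _ _ _ _ _ (bicross_mul (1 ⊗ 1)) (fun u => u)) => [||a b].
- exact: mul_lin_r.
- exact: lin_id.
have hl : linear (fun x : A => x ⊗ b : A ⊗ B) by apply/lin_pure_l/lin_id.
rewrite bicross_mulE -[in RHS](counit_r hA a) (lin_tsum _ _ hl).
apply: eq_tsum => x y; rewrite mul1r (act_one hP) -scalerAl mul1r.
by rewrite pureZl pureZr.
Qed.

Fact bicross_mul1r : right_id (1 ⊗ 1) bicross_mul.
Proof.
apply: (@lin_ext _ _ _ _ _ _ _ (bicross_mul^~ (1 ⊗ 1)) (fun u => u)) => [||a b].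
- exact: mul_lin_l.
- exact: lin_id.
rewrite bicross_mulE (comul1 hA) tsum_tensE ?mulr1 ?(act1 hP) //; split=> *.
  exact/lin_pure_l/lin_mul_r/lin_id.
exact/lin_pure_r/lin_mul_l/(act_linear_r hP).
Qed.

Fact bicross_mulDl : left_distributive bicross_mul +%R.
Proof. by move=> u v w; apply: lin_add (mul_lin_l w). Qed.
Fact bicross_mulDr : right_distributive bicross_mul +%R.
Proof. by move=> u v w; apply: lin_add (mul_lin_r u). Qed.

Fact bicross_one_neq0 : (1 ⊗ 1 : A ⊗ B) != 0.
Proof.
apply/eqP => h.
have bf : bilin (fun (a : A) (b : B) => counit A a * counit B b : k^o).
  split=> [b|a] c x y.
    by rewrite (counit_scalar hA) mulrDl -mulrA.
  by rewrite (counit_scalar (hopf_laws B)) mulrDr mulrCA.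
have := tsum_tensE 1 1 bf; rewrite h.
have [-> _] := counit_monoid_morphism hA.
have [-> _] := counit_monoid_morphism (hopf_laws B).
have hl := tsum_linear bf (@balanced0 _ _ _ _ _).
have := lin_scale 0 0 hl; rewrite scaler0 scale0r => -> /eqP.
by rewrite mulr1 eq_sym oner_eq0.
Qed.

HB.instance Definition _ := GRing.Zmodule_isNzRing.Build (bicross P)
  bicross_mulA bicross_mul1l bicross_mul1r bicross_mulDl bicross_mulDr
  bicross_one_neq0.

Fact bicross_scalerAl (c : k) (u v : bicross P) : c *: (u * v) = c *: u * v.
Proof. exact/esym/(lin_scale _ _ (mul_lin_l v)). Qed.
HB.instance Definition _ :=
  GRing.Lmodule_isLalgebra.Build k (bicross P) bicross_scalerAl.
Fact bicross_scalerAr (c : k) (u v : bicross P) : c *: (u * v) = u * (c *: v).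
Proof. exact/esym/(lin_scale _ _ (mul_lin_r u)). Qed.
HB.instance Definition _ :=
  GRing.Lalgebra_isAlgebra.Build k (bicross P) bicross_scalerAr.

End BicrossAlgebra.

Section Bialgebroid.
Variables (k : fieldType) (B H : algType k).

(* [cop] takes values in H ⊗_B H, where X s(b) ⊗_B Y = X ⊗_B Y t(b). *)
Record bialgebroid_data := BialgebroidData {
  src : B -> H;
  tgt : B -> H;
  cop : H -> @btens k H H B (fun X b => X * src b) (fun b Y => Y * tgt b);
  cnt : H -> B }.

Variable D : bialgebroid_data.
Local Notation s := (src D).
Local Notation t := (tgt D).
Local Notation "▲" := (cop D).
Local Notation ε := (cnt D).

Definition tensB : Type := btens (fun X b => X * s b) (fun b Y => Y * t b).
HB.instance Definition _ := GRing.Lmodule.on tensB.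

Definition lactB (b : B) (u : tensB) : tensB :=
  \sw_(X, Y <- u) (X * t b) ⊠ Y.
Definition ractB (u : tensB) (b : B) : tensB :=
  \sw_(X, Y <- u) X ⊠ (Y * s b).

(* H ⊗_B (H ⊗_B H) *)
Definition tensBB : Type := @btens k H tensB B (fun X b => X * s b) lactB.
HB.instance Definition _ := GRing.Lmodule.on tensBB.

(* Factorwise product; the outer sum is balanced, hence independent of the
   representative of [u], as soon as [v] lies in the Takeuchi product. *)
Definition tensB_mul (u v : tensB) : tensB :=
  \sw_(X, Y <- u) \sw_(X', Y' <- v) (X * X') ⊠ (Y * Y').

Definition takeuchi (u : tensB) : Prop := forall b : B,
  \sw_(X, Y <- u) (s b * X) ⊠ Y = \sw_(X, Y <- u) X ⊠ (t b * Y) :> tensB.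

(* [B^c] is the algebra B with opposite product. *)
Record is_right_bialgebroid : Prop := IsRightBialgebroid {
  src_linear : linear s;
  src_monoid_morphism : monoid_morphism s;
  tgt_linear : linear t;
  tgt_monoid_morphism : monoid_morphism (t : B^c -> H);
  src_tgt_comm : forall b b', s b * t b' = t b' * s b;
  cop_linear : linear (▲ : H -> tensB);
  cnt_linear : linear ε;
  cop_bimod : forall X b b', ▲ (X * s b' * t b) = ractB (lactB b (▲ X)) b';
  cnt_bimod : forall X b b', ε (X * s b' * t b) = b * ε X * b';
  cop_coassoc : forall X,
    \sw_(X1, X2 <- ▲ X) \sw_(X11, X12 <- ▲ X1) X11 ⊠ (X12 ⊠ X2 : tensB)
    = \sw_(X1, X2 <- ▲ X) X1 ⊠ (▲ X2 : tensB) :> tensBB;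
  cnt_l : forall X, \sw_(X1, X2 <- ▲ X) X2 * t (ε X1) = X;
  cnt_r : forall X, \sw_(X1, X2 <- ▲ X) X1 * s (ε X2) = X;
  cop_takeuchi : forall X, takeuchi (▲ X);
  cop1 : ▲ 1 = 1 ⊠ 1;
  copM : forall X Y, ▲ (X * Y) = tensB_mul (▲ X) (▲ Y);
  cnt1 : ε 1 = 1;
  cntM_src : forall X Y, ε (s (ε X) * Y) = ε (X * Y);
  cntM_tgt : forall X Y, ε (t (ε X) * Y) = ε (X * Y) }.

(* H ⊗_{B^op} H with X t(b) ⊗ Y = X ⊗ t(b) Y *)
Definition tensBop : Type := btens (fun X b => X * t b) (fun b Y => t b * Y).
HB.instance Definition _ := GRing.Lmodule.on tensBop.

(* H ⊗^{B^op} H with s(b) X ⊗ Y = X ⊗ Y s(b) *)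
Definition tensBop' : Type := btens (fun X b => s b * X) (fun b Y => Y * s b).
HB.instance Definition _ := GRing.Lmodule.on tensBop'.

Definition canon_map (u : tensBop) : tensB :=
  \sw_(X, Y <- u) \sw_(Y1, Y2 <- ▲ Y) (X * Y1) ⊠ Y2.
Definition anticanon_map (u : tensBop') : tensB :=
  \sw_(X, Y <- u) \sw_(X1, X2 <- ▲ X) X1 ⊠ (Y * X2).

Definition right_hopf_algebroid : Prop :=
  is_right_bialgebroid /\ bijective canon_map.
Definition anti_right_hopf_algebroid : Prop :=
  is_right_bialgebroid /\ bijective anticanon_map.

Record is_full_antipode (S : H -> H) : Prop := IsFullAntipode {
  full_linear : linear S;
  full_antimorphism : monoid_morphism (S : H^c -> H);
  full_bijective : bijective S;
  full_tgt : forall b, S (t b) = s b;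
  full_inv : forall Sinv : H -> H, cancel S Sinv -> cancel Sinv S -> forall X,
    \sw_(X1, X2 <- ▲ X) \sw_(Z1, Z2 <- ▲ (Sinv X1)) (X2 * Z1) ⊠ Z2
    = 1 ⊠ Sinv X :> tensB;
  full_S : forall X,
    \sw_(X1, X2 <- ▲ X) \sw_(Z1, Z2 <- ▲ (S X2)) Z1 ⊠ (X1 * Z2)
    = S X ⊠ 1 :> tensB }.

Definition full_hopf_algebroid : Prop :=
  is_right_bialgebroid /\ exists S, is_full_antipode S.

Variables (DB : hopf_data B) (DH : hopf_data H).

(* B^op has the opposite product and the same coproduct as B, so [tgt] is a
   coalgebra map for [DB]. *)
Record hopf2_compat : Prop := Hopf2Compat {
  hopf2_base : is_hopf DB;
  hopf2_total : is_hopf DH;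
  hopf2_cnt : coalgebra_map DH DB ε;
  hopf2_src : monoid_morphism s /\ coalgebra_map DB DH s;
  hopf2_tgt : monoid_morphism (t : B^c -> H) /\ coalgebra_map DB DH t;
  hopf2_cop : forall X,
    \sw_(X1, X2 <- comul DH X) (▲ X1 : tensB) ⊗ (▲ X2 : tensB)
    = \sw_(X1, X2 <- ▲ X) \sw_(X11, X12 <- comul DH X1)
        \sw_(X21, X22 <- comul DH X2)
          (X11 ⊠ X21 : tensB) ⊗ (X12 ⊠ X22 : tensB) }.

Definition right_hopf2 : Prop := right_hopf_algebroid /\ hopf2_compat.
Definition anti_right_hopf2 : Prop := anti_right_hopf_algebroid /\ hopf2_compat.
Definition hopf2 : Prop :=
  (right_hopf2 \/ anti_right_hopf2) /\ full_hopf_algebroid.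

End Bialgebroid.

Section BicrossStructure.
Variables (k : fieldType) (A B : hopfAlg k) (P : bicross_pair A B).
Local Notation H := (bicross P).

Definition bicross_hopf : hopf_data H := {|
  comul := fun u : H => \sw_(a, b <- (u : A ⊗ B))
    \sw_(a1, a2 <- comul A a) \sw_(c, a0 <- coact P a2)
      \sw_(b1, b2 <- comul B b)
        (a1 ⊗ (c * b1) : H) ⊗ (a0 ⊗ b2 : H);
  counit := fun u : H => \sw_(a, b <- (u : A ⊗ B)) counit A a * counit B b;
  antipode := fun u : H => \sw_(a, b <- (u : A ⊗ B))
    \sw_(c, a0 <- coact P a) \sw_(x1, x2 <- comul A a0)
      antipode A x2 ⊗ act P (antipode B (c * b)) (antipode A x1) |}.

Variable phi : B -> A.

Definition bicross_src (b : B) : H := 1 ⊗ b.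
Definition bicross_tgt (b : B) : H :=
  \sw_(b1, b2 <- comul B b) phi b1 ⊗ b2.

Definition bicross_bialgebroid : bialgebroid_data B H := {|
  src := bicross_src;
  tgt := bicross_tgt;
  cop := fun u : H => \sw_(a, b <- (u : A ⊗ B)) \sw_(a1, a2 <- comul A a)
    (a1 ⊗ 1 : H) ⊠ (a2 ⊗ b : H);
  cnt := fun u : H => \sw_(a, b <- (u : A ⊗ B)) counit A a *: b |}.

Definition bicross_full_antipode (u : H) : H :=
  \sw_(a, b <- (u : A ⊗ B)) \sw_(a1, a2 <- comul A a)
    \sw_(b1, b2 <- comul B b) (phi b1 * antipode A a2)
      ⊗ act P b2 (antipode A a1).

End BicrossStructure.

Arguments bicross_full_antipode {k A B} P phi u.

Section HopfFacts.
Variables (k : fieldType) (H : hopfAlg k).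
Local Notation Δ := (comul H).
Local Notation S := (antipode H).
Local Notation ε := (counit H).
Let hH := hopf_laws H.

Ltac lin := repeat first
  [ exact: lin_id | exact: (antipode_linear hH)
  | apply: lin_mul_l | apply: lin_mul_r
  | apply: (lin_comp (antipode_linear hH)) ].

Lemma tsum_counit_r (M : lmodType k) (f : H -> M) x : linear f ->
  \sw_(x1, x2 <- Δ x) ε x2 *: f x1 = f x.
Proof.
move=> hf; rewrite -[in RHS](counit_r hH x) (lin_tsum _ _ hf).
by apply: eq_tsum => x1 x2; rewrite lin_scale.
Qed.

Lemma tsum_counit_l (M : lmodType k) (f : H -> M) x : linear f ->
  \sw_(x1, x2 <- Δ x) ε x1 *: f x2 = f x.
Proof.
move=> hf; rewrite -[in RHS](counit_l hH x) (lin_tsum _ _ hf).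
by apply: eq_tsum => x1 x2; rewrite lin_scale.
Qed.

Lemma hopf_antipode1 : S 1 = 1.
Proof.
have := antipode_l hH 1; rewrite (comul1 hH) tsum_tensE.
  by have [-> _] := counit_monoid_morphism hH; rewrite mulr1 scale1r.
by split=> *; lin.
Qed.

Lemma hopf_antipodeM x y : S (x * y) = S y * S x.
Proof.
pose F (x1 x2 x3 y1 y2 y3 : H) := S (x1 * y1) * (x2 * y2) * (S y3 * S x3) : H.
have FE x1 x2 x3 y1 y2 y3 :
    F x1 x2 x3 y1 y2 y3 = S (x1 * y1) * (x2 * (y2 * S y3) * S x3).
  by rewrite /F !mulrA.
transitivity (\sw_(x1, x' <- Δ x) \sw_(x2, x3 <- Δ x')
    \sw_(y1, y' <- Δ y) \sw_(y2, y3 <- Δ y') F x1 x2 x3 y1 y2 y3).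
  have hl : linear (fun z => S (z * y)) by lin.
  rewrite -(tsum_counit_r x hl); apply: eq_tsum => x1 x'.
  have hm : linear (fun z : H => S (x1 * y) * z) by lin.
  transitivity (S (x1 * y) * (ε x')%:A); first by rewrite mulr_algr.
  rewrite -(antipode_r hH) (lin_tsum _ _ hm).
  apply: eq_tsum => x2 x3.
  have hn : linear (fun z => S (x1 * z) * (x2 * S x3)) by lin.
  rewrite -(tsum_counit_r y hn); apply: eq_tsum => y1 y'.
  have ho : linear (fun z => S (x1 * y1) * (x2 * z * S x3)) by lin.
  rewrite (_ : _ *: _ = S (x1 * y1) * (x2 * (ε y')%:A * S x3)); last first.
    by rewrite mulr_algr -scalerAl -scalerAr.
  rewrite -(antipode_r hH) (lin_tsum _ _ ho).
  by apply: eq_tsum => y2 y3; rewrite FE.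
rewrite -(@comul_coassoc_tri _ _ H (fun x1 x2 x3 =>
  \sw_(y1, y' <- Δ y) \sw_(y2, y3 <- Δ y') F x1 x2 x3 y1 y2 y3)); last first.
  by split=> *; do 2![apply: lin_tsum_in => ? ?]; rewrite /F; lin.
have hl : linear (fun z => S y * S z) by lin.
rewrite -(tsum_counit_l x hl); apply: eq_tsum => x' x3.
transitivity (\sw_(y', y3 <- Δ y) ε y' *: (ε x' *: (S y3 * S x3))); last first.
  have hm : linear (fun z : H => ε x' *: (S z * S x3)).
    by move=> a u v; rewrite (antipode_linear hH) mulrDl scalerDr -scalerAl
      !scalerA mulrC.
  exact: tsum_counit_l hm.
transitivity (\sw_(x1, x2 <- Δ x') \sw_(y', y3 <- Δ y)
    \sw_(y1, y2 <- Δ y') F x1 x2 x3 y1 y2 y3).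
  apply: eq_tsum => x1 x2.
  rewrite (@comul_coassoc_tri _ _ H (fun y1 y2 y3 => F x1 x2 x3 y1 y2 y3)) //.
  by split=> *; rewrite /F; lin.
rewrite tsum_exchange; apply: eq_tsum => y' y3.
rewrite scalerA mulrC; have [_ <-] := counit_monoid_morphism hH.
have ho : linear (fun z : H => z * (S y3 * S x3)) by lin.
rewrite -[RHS]mulr_algl -(antipode_l hH) (comulM hH).
have bf : bilin (fun p q : H => S p * q) by split=> *; lin.
rewrite tsum_tsum // (lin_tsum _ _ ho); apply: eq_tsum => x1 x2.
rewrite tsum_tsum // (lin_tsum _ _ ho); apply: eq_tsum => y1 y2.
by rewrite tsum_tensE.
Qed.

End HopfFacts.

Section BicrossHopfE.
Variables (k : fieldType) (A B : hopfAlg k) (P : bicross_pair A B).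
Local Notation H := (bicross P).
Let hA := hopf_laws A.
Let hB := hopf_laws B.
Let hP := bicross_laws P.

Ltac lin := repeat first
  [ exact: lin_id
  | exact: (antipode_linear hA) | exact: (antipode_linear hB)
  | exact: (comul_linear hA) | exact: (comul_linear hB)
  | exact: (coact_linear hP) | exact: balanced0
  | apply: lin_pure_l | apply: lin_pure_r
  | apply: lin_mul_l | apply: lin_mul_r
  | apply: (lin_comp (act_linear_r hP _))
  | apply: (lin_comp (f := fun b => act P b _) (act_linear_l hP _))
  | apply: (lin_comp (antipode_linear hA))
  | apply: (lin_comp (antipode_linear hB))
  | apply: lin_tsum_in => ? ? | apply: lin_tsum_arg | split=> ? ].

Lemma bicross_comulE (a : A) (b : B) : comul (bicross_hopf P) (a ⊗ b : H)
  = \sw_(a1, a2 <- comul A a) \sw_(c, a0 <- coact P a2)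
      \sw_(b1, b2 <- comul B b) (a1 ⊗ (c * b1) : H) ⊗ (a0 ⊗ b2 : H).
Proof. by apply: (tsum_tensE (M := (H ⊗ H)%type)); lin. Qed.

Lemma bicross_counitE (a : A) (b : B) :
  counit (bicross_hopf P) (a ⊗ b : H) = counit A a * counit B b.
Proof.
apply: (tsum_tensE (M := k^o)); split=> [c|c] u x y.
  by rewrite (counit_scalar hA) mulrDl -mulrA.
by rewrite (counit_scalar hB) mulrDr mulrCA.
Qed.

Lemma bicross_antipodeE (a : A) (b : B) : antipode (bicross_hopf P) (a ⊗ b : H)
  = \sw_(c, a0 <- coact P a) \sw_(x1, x2 <- comul A a0)
      antipode A x2 ⊗ act P (antipode B (c * b)) (antipode A x1).
Proof. by apply: (tsum_tensE (M := H)); lin. Qed.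

Lemma bicross_copE phi (a : A) (b : B) :
  cop (bicross_bialgebroid P phi) (a ⊗ b : H)
  = \sw_(a1, a2 <- comul A a) (a1 ⊗ 1 : H) ⊠ (a2 ⊗ b : H)
    :> tensB (bicross_bialgebroid P phi).
Proof.
by apply: (tsum_tensE (M := tensB (bicross_bialgebroid P phi))); lin.
Qed.

Lemma bicross_cntE phi (a : A) (b : B) :
  cnt (bicross_bialgebroid P phi) (a ⊗ b : H) = counit A a *: b.
Proof.
apply: tsum_tensE; split=> [c|c] u x y.
  by rewrite (counit_scalar hA) scalerDl scalerA.
by rewrite scalerDr !scalerA mulrC.
Qed.

Lemma bicross_full_antipodeE phi (a : A) (b : B) : linear phi ->
  bicross_full_antipode P phi (a ⊗ b)
  = \sw_(a1, a2 <- comul A a) \sw_(b1, b2 <- comul B b)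
      (phi b1 * antipode A a2) ⊗ act P b2 (antipode A a1).
Proof.
move=> hphi; apply: (tsum_tensE (M := H)); lin.
exact: hphi.
Qed.

End BicrossHopfE.

Section TargetSquare.
Variables (k : fieldType) (A B : hopfAlg k) (P : bicross_pair A B).
Variable phi : B -> A.
Hypothesis phi_coalg : coalgebra_map B A phi.
Hypothesis phi_act : forall b b',
  act P b' (phi b) = \sw_(b1, b2 <- comul B b) b1 * b' * antipode B b2.
Hypothesis SA2 : forall a, antipode A (antipode A a) = a.
Local Notation "b <| a" := (act P b a) (at level 39, left associativity).
Local Notation SA := (antipode A).
Local Notation SB := (antipode B).
Local Notation Δ := (comul B).
Let hA := hopf_laws A.
Let hB := hopf_laws B.
Let hP := bicross_laws P.

Let phi_lin : linear phi. Proof. by case: phi_coalg. Qed.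
Let phi_comul b : comul A (phi b) = \sw_(b1, b2 <- Δ b) phi b1 ⊗ phi b2.
Proof. by case: phi_coalg. Qed.
Let phi_counit b : counit A (phi b) = counit B b.
Proof. by case: phi_coalg. Qed.

Ltac lin := repeat first
  [ exact: lin_id | exact: phi_lin
  | exact: (antipode_linear hA) | exact: (antipode_linear hB)
  | exact: (act_linear_r hP)
  | apply: lin_pure_l | apply: lin_pure_r
  | apply: lin_mul_l | apply: lin_mul_r
  | apply: (lin_comp (act_linear_r hP _))
  | apply: (lin_comp (f := fun b => b <| _) (act_linear_l hP _))
  | apply: (lin_comp (antipode_linear hA))
  | apply: (lin_comp (antipode_linear hB))
  | apply: (lin_comp phi_lin) ].

Let phi_antipode b :
  \sw_(b1, b2 <- Δ b) phi b2 * SA (phi b1) = (counit B b)%:A.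
Proof.
have bf : bilin (fun p q : A => p * SA q) by split=> *; lin.
have := antipode_r hA (phi b); rewrite phi_comul phi_counit tsum_tsum //.
move/(congr1 SA); rewrite (lin_tsum _ _ (antipode_linear hA)).
rewrite (lin_scale _ _ (antipode_linear hA)) hopf_antipode1 => <-.
by apply: eq_tsum => x y; rewrite tsum_tensE // hopf_antipodeM SA2.
Qed.

(* Consequently the condition S(t(b)) = s(b) on the antipode of a full Hopf
   algebroid forces the antipode of B to be involutive too. *)
Lemma full_antipode_bicross_tgt b :
  bicross_full_antipode P phi (bicross_tgt P phi b) = 1 ⊗ SB (SB b).
Proof.
pose K (x y z1 z2 : B) := (phi z1 * SA (phi y)) ⊗ (z2 <| SA (phi x)) : A ⊗ B.
have bF : bilin (fun (a : A) (c : B) => \sw_(a1, a2 <- comul A a)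
    \sw_(c1, c2 <- Δ c) (phi c1 * SA a2) ⊗ (c2 <| SA a1) : A ⊗ B).
  split=> [c|a].
    apply: lin_tsum_arg; [exact: comul_linear hA | | exact: balanced0].
    by split=> *; apply: lin_tsum_in => *; lin.
  apply: lin_tsum_in => *; apply: lin_tsum_arg;
    [exact: comul_linear hB | | exact: balanced0].
  by split=> *; lin.
rewrite /bicross_full_antipode /bicross_tgt tsum_tsum //.
transitivity (\sw_(b', z <- Δ b) \sw_(x, y <- Δ b')
    \sw_(z1, z2 <- Δ z) K x y z1 z2).
  apply: eq_tsum => b' z; rewrite tsum_tensE // phi_comul.
  rewrite tsum_tsum; last by split=> *; apply: lin_tsum_in => *; lin.
  apply: eq_tsum => x y; rewrite tsum_tensE //.
  by split=> *; apply: lin_tsum_in => *; lin.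
have bK x y : bilin (fun z1 z2 => K x y z1 z2).
  by split=> *; rewrite /K; lin.
rewrite (@comul_coassoc_tri _ _ (A ⊗ B)%type (fun x y z =>
    \sw_(z1, z2 <- Δ z) K x y z1 z2)); last first.
  split=> [*|*|x y]; try by apply: lin_tsum_in => *; rewrite /K; lin.
  by apply: lin_tsum_arg; [exact: comul_linear hB | exact: bK | exact: balanced0].
have hl : linear (fun c : B => 1 ⊗ c : A ⊗ B) by lin.
transitivity (\sw_(x, w <- Δ b) 1 ⊗ (w <| SA (phi x)) : A ⊗ B).
  apply: eq_tsum => x w.
  rewrite -(@comul_coassoc_tri _ _ (A ⊗ B)%type (fun y z1 z2 => K x y z1 z2)).
    have hm : linear (fun z : B => 1 ⊗ (z <| SA (phi x)) : A ⊗ B).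
      by lin.
    rewrite -(tsum_counit_l w hm); apply: eq_tsum => u z2.
    have hn : linear (fun a : A => a ⊗ (z2 <| SA (phi x)) : A ⊗ B) by lin.
    by rewrite -pureZl -phi_antipode (lin_tsum _ _ hn).
  by split=> *; rewrite /K; lin.
rewrite -(lin_tsum (f := fun c : B => 1 ⊗ c : A ⊗ B)) //; congr (1 ⊗ _).
have hS2 : linear (fun d => SB (SB d)) by lin.
have act_tri y : linear (fun u => y <| SA (phi u)) by lin.
have la a : linear (fun c => c <| a) := act_linear_l hP a.
symmetry; rewrite -(tsum_counit_l b hS2).
transitivity (\sw_(c, d <- Δ b) \sw_(u, v <- Δ c)
    SB (SB d) <| phi v <| SA (phi u)).
  apply: eq_tsum => c d.
  rewrite -[X in _ *: X](act1 hP) -(lin_scale _ _ (act_linear_r hP _)).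
  rewrite -phi_antipode (lin_tsum _ _ (act_linear_r hP _)).
  by apply: eq_tsum => u v; rewrite (actM hP).
rewrite (@comul_coassoc_tri _ _ B (fun u v d => SB (SB d) <| phi v <| SA (phi u))).
  apply: eq_tsum => u e; rewrite -(lin_tsum _ _ (la _)); congr (_ <| _).
  transitivity (\sw_(v, d <- Δ e) \sw_(v1, v2 <- Δ v) v1 * SB (v2 * SB d)).
    apply: eq_tsum => v d; rewrite phi_act; apply: eq_tsum => v1 v2.
    by rewrite hopf_antipodeM mulrA.
  rewrite (@comul_coassoc_tri _ _ B (fun v1 v2 d => v1 * SB (v2 * SB d))).
    rewrite -[RHS](counit_r hB); apply: eq_tsum => v1 f.
    have hm : linear (fun z => v1 * SB z) by lin.
    rewrite -(lin_tsum _ _ hm) (antipode_r hB) (lin_scale _ _ hm).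
    by rewrite hopf_antipode1 mulr1.
  by split=> *; lin.
split=> *.
- lin.
- by apply: (lin_comp (la _)); lin.
- by apply: (lin_comp (la _)); apply: (lin_comp (la _)); lin.
Qed.

End TargetSquare.

(* Main.v *)
Require Import Defs.
From HB Require Import structures.
From mathcomp Require Import all_boot all_order all_algebra.

(* Put i(a) = a ⊗ 1, so that a ⊗ b = i(a)s(b) and H is the algebra generated by
   i(A) and s(B) with s(b)i(a) = i(a_1)s(b ◁ a_2).  The conditions on φ amount to
   three relations: s and t commute, t(b)i(a) = i(a_2)t(b ◁ a_1), and
   i(a_2)t(a_1^[-1]) ⊗ a_1^[0] = i(a_1)s(a_2^[-1]) ⊗ a_2^[0].  The first two make
   the image of ▲ lie in the Takeuchi product and let s and t be moved past i(A),
   which is all that is needed to check the bialgebroid axioms on the generators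
   and to see that the candidate inverses
   i(a)s(b) ↦ i(S a_1) ⊗ i(a_2)s(b) and i(a)s(b) ↦ i(a_1) ⊗ t(b)i(S^-1 a_2)
   are balanced; the third one is the compatibility of ▲ with Δ.  The antipode of
   the full Hopf algebroid is the anti-automorphism i(a)s(b) ↦ t(b)i(S a). *)

Set Implicit Arguments.
Unset Strict Implicit.
Unset Printing Implicit Defensive.

Import GRing.Theory.
Local Open Scope ring_scope.

(** * Linearity and Sweedler sums *)

(** Two obstacles shape the proof. A Sweedler sum over a balanced tensor product is evaluated on a
    chosen representative, so it can be computed on the generators i(a)s(b) only once its summand is
    known to be bilinear and balanced; and factorwise products on H ⊗_B H make sense only against
    the Takeuchi product. Both are handled through the left action of H ⊗ H on H ⊗_B H, which always
    exists. With g the candidate of the overview, the inverses are X ⊗ Y ↦ X·g(Y) for λ and X ⊗ Y ↦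
    Y·g(X) for μ, acting on the first and on the second factor. The crux for λ is the balance
    s(b)·g(Y) = g(Y t(b)): only t crosses the tensor sign over B^op, so s(b) is rewritten as
    i(S(φ(b_1)))t(b_2). For μ the balance is immediate, since t(b) stands in front, and the work
    lies in recovering X ⊗ 1 from ▲(X). If S_A^2 = id, then S^-1 and S agree on A, and the full
    antipode sends t(b) to 1 ⊗ S_B^2(b); this is where S_B^2 = id enters. *)

Section MoreLinearity.
Variable k : fieldType.
Implicit Types U V W M : lmodType k.

Lemma lin_scaler U V (c : k) (g : U -> V) : linear g -> linear (fun x => c *: g
  x).
Proof. by move=> hg a x y; rewrite hg scalerDr !scalerA mulrC. Qed.

Lemma lin_coef U V (c : U -> k) (v : V) : scalar c -> linear (fun x => c x *: v).
Proof. by move=> hc a x y; rewrite hc scalerDl scalerA. Qed.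

End MoreLinearity.

Section Collapse.
Variables (k : fieldType) (C : hopfAlg k) (U M : lmodType k).
Variables (m : C -> C -> U) (u : U).
Hypothesis m_counit : forall x,
  \sw_(x1, x2 <- comul C x) m x1 x2 = counit C x *: u.

(** The map [m] stands for any of S(x_1)x_2, x_1S(x_2), S^-1(x_2)x_1, x_2S^-1(x_1), or such a
    product composed with φ. In the names of the four lemmas the first letter tells which end of x_1
    ⊗ x_2 ⊗ x_3 collapses; a second letter tells how the iterated coproduct is bracketed when this
    differs. *)
Lemma collapse_r (f : C -> U -> M) x : bilin f ->
  \sw_(x1, x2 <- comul C x) \sw_(x21, x22 <- comul C x2) f x1 (m x21 x22) = f x u.
Proof.
move=> [fl fr]; rewrite -(tsum_counit_r x (fl u)); apply: eq_tsum => x1 x2.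
by rewrite -(lin_tsum _ _ (fr x1)) m_counit (lin_scale _ _ (fr x1)).
Qed.

Lemma collapse_l (f : U -> C -> M) x : bilin f ->
  \sw_(x1, x2 <- comul C x) \sw_(x11, x12 <- comul C x1) f (m x11 x12) x2 = f u x.
Proof.
move=> [fl fr]; rewrite -(tsum_counit_l x (fr u)); apply: eq_tsum => x1 x2.
by rewrite -(lin_tsum _ _ (fl x2)) m_counit (lin_scale _ _ (fl x2)).
Qed.

Lemma collapse_l_r (f : U -> C -> M) x : bilin m -> bilin f ->
  \sw_(x1, x2 <- comul C x) \sw_(x21, x22 <- comul C x2) f (m x1 x21) x22 = f u x.
Proof.
move=> [ml mr] bf; have [fl fr] := bf;
  rewrite -(collapse_l x bf) -(@comul_coassoc_tri _ _ _ (fun p q => f (m p q)))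
    //.
split=> *; last exact: fr.
  exact: (lin_comp (fl _) (ml _)).
exact: (lin_comp (fl _) (mr _)).
Qed.

Lemma collapse_r_l (f : C -> U -> M) x : bilin m -> bilin f ->
  \sw_(x1, x2 <- comul C x) \sw_(x11, x12 <- comul C x1) f x11 (m x12 x2) = f x u.
Proof.
move=> [ml mr] bf; have [fl fr] := bf;
  rewrite -(collapse_r x bf) (@comul_coassoc_tri _ _ _ (fun p q s => f p (m q
    s))) //.
split=> *; first exact: fl.
  exact: (lin_comp (fr _) (ml _)).
exact: (lin_comp (fr _) (mr _)).
Qed.
End Collapse.

(** * The generators of the bicrossproduct *)

Definition bicross_incl (k : fieldType) (A B : hopfAlg k) (P : bicross_pair A B)
  (a : A) : bicross P := a ⊗ 1.

Section Factorization.
Variables (k : fieldType) (A B : hopfAlg k) (P : bicross_pair A B).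
Local Notation H := (bicross P).
Local Notation i := (bicross_incl P).
Local Notation s := (bicross_src P).
Local Notation "b <| a" := (act P b a) (at level 39, left associativity).
Let hA := hopf_laws A.
Let hB := hopf_laws B.
Let hP := bicross_laws P.

Lemma bicross_incl_linear : linear i.
Proof. exact/lin_pure_l/lin_id. Qed.
Lemma bicross_src_linear : linear s.
Proof. exact/lin_pure_r/lin_id. Qed.

Ltac lin := repeat first
  [ exact: lin_id
  | exact: (act_linear_r hP)
  | apply: lin_pure_l | apply: lin_pure_r
  | apply: lin_mul_l | apply: lin_mul_r
  | apply: (lin_comp (act_linear_r hP _))
  | apply: (lin_comp (f := fun b => act P b _) (act_linear_l hP _)) ].

Let mulE (a a' : A) (b b' : B) : (a ⊗ b : H) * (a' ⊗ b' : H)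
  = \sw_(a1, a2 <- comul A a') (a * a1) ⊗ ((b <| a2) * b').
Proof. exact: bicross_mulE. Qed.

Let mulE1 (a : A) (b b' : B) : (a ⊗ b : H) * (1 ⊗ b' : H) = a ⊗ (b * b').
Proof.
by rewrite mulE (comul1 hA) tsum_tensE ?mulr1 ?(act1 hP) //; split=> *; lin.
Qed.

Lemma bicross_incl1 : i 1 = 1. Proof. by []. Qed.
Lemma bicross_src1 : s 1 = 1. Proof. by []. Qed.

(** A is a subalgebra because it acts on 1 through its counit. *)
Lemma bicross_inclM a a' : i (a * a') = i a * i a'.
Proof.
rewrite /bicross_incl mulE.
have hl : linear (fun x : A => (a * x) ⊗ 1 : A ⊗ B) by lin.
apply: etrans (esym (tsum_counit_r a' hl)) _.
by apply: eq_tsum => x y; rewrite (act_one hP) mulr1 pureZr.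
Qed.

Lemma bicross_srcM b b' : s (b * b') = s b * s b'.
Proof. by rewrite /bicross_src mulE1. Qed.

Lemma bicross_inclMsrc a b : i a * s b = a ⊗ b.
Proof. by rewrite /bicross_incl /bicross_src mulE1 mul1r. Qed.

Lemma bicross_srcMincl b a :
  s b * i a = \sw_(a1, a2 <- comul A a) i a1 * s (b <| a2).
Proof.
rewrite /bicross_src {1}/bicross_incl mulE.
by apply: eq_tsum => x y; rewrite mul1r mulr1 bicross_inclMsrc.
Qed.

Lemma bicross_ext (M : lmodType k) (f g : H -> M) : linear f -> linear g ->
  (forall a b, f (i a * s b) = g (i a * s b)) -> forall X, f X = g X.
Proof.
move=> lf lg fg; apply: (@lin_ext _ _ _ _ _ _ _ (f : A ⊗ B -> M)) => // a b.
by rewrite -bicross_inclMsrc fg.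
Qed.

End Factorization.

(** * The inverse of the antipode *)

Section InverseAntipode.
Variables (k : fieldType) (C : hopfAlg k) (T : C -> C).
Hypotheses (SK : cancel (antipode C) T) (TK : cancel T (antipode C)).
Let hC := hopf_laws C.
Let S_lin := antipode_linear hC.

Lemma antipode_inv_linear : linear T.
Proof.
move=> a x y; apply: (can_inj SK); rewrite TK.
by rewrite S_lin !TK.
Qed.

(** The antipode is injective, reverses products and fixes 1; applied to both sides it gives the
    axiom for S(x_1)x_2. *)
Lemma antipode_inv_l x :
  \sw_(x1, x2 <- comul C x) T x2 * x1 = counit C x *: 1.
Proof.
apply: (can_inj SK); rewrite (lin_tsum _ _ S_lin) (lin_scale _ _ S_lin).
rewrite hopf_antipode1 -(antipode_l hC); apply: eq_tsum => x1 x2.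
by rewrite hopf_antipodeM TK.
Qed.

Lemma antipode_inv_r x :
  \sw_(x1, x2 <- comul C x) x2 * T x1 = counit C x *: 1.
Proof.
apply: (can_inj SK); rewrite (lin_tsum _ _ S_lin) (lin_scale _ _ S_lin).
rewrite hopf_antipode1 -(antipode_r hC); apply: eq_tsum => x1 x2.
by rewrite hopf_antipodeM TK.
Qed.

End InverseAntipode.

(** * What the conditions on φ say about i, s and t *)

Section CrossedRelations.
Variables (k : fieldType) (A B : hopfAlg k) (P : bicross_pair A B).
Variables (T : A -> A) (phi : B -> A).
Hypotheses (SK : cancel (antipode A) T) (TK : cancel T (antipode A)).
Hypothesis phi_alg : monoid_morphism (phi : B^c -> A).
Hypothesis phi_coalg : coalgebra_map B A phi.
Hypothesis phi_coact : forall a : A,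
  \sw_(c, a0 <- coact P a) phi c ⊗ a0
  = \sw_(a1, a23 <- comul A a) \sw_(a2, a3 <- comul A a23) (T a3 * a1) ⊗ a2.
Hypothesis phi_act : forall (a : A) (b : B), phi (act P b a)
  = \sw_(a1, a2 <- comul A a) T a2 * phi b * a1.
Hypothesis act_phi : forall b b' : B, act P b' (phi b)
  = \sw_(b1, b2 <- comul B b) b1 * b' * antipode B b2.
Local Notation H := (bicross P).
Local Notation i := (bicross_incl P).
Local Notation s := (bicross_src P).
Local Notation t := (bicross_tgt P phi).
Local Notation "b <| a" := (act P b a) (at level 39, left associativity).
Local Notation SA := (antipode A).
Local Notation Δ := (comul A).
Local Notation ΔB := (comul B).
Let hA := hopf_laws A.
Let hB := hopf_laws B.
Let hP := bicross_laws P.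
Let T_lin : linear T := antipode_inv_linear SK TK.

Let phi_lin : linear phi. Proof. by case: phi_coalg. Qed.
Let phi_comul b : Δ (phi b) = \sw_(b1, b2 <- ΔB b) phi b1 ⊗ phi b2.
Proof. by case: phi_coalg. Qed.
Let phi_counit b : counit A (phi b) = counit B b.
Proof. by case: phi_coalg. Qed.
Let phiM b b' : phi (b * b') = phi b' * phi b.
Proof. by case: phi_alg => _ h; exact: h. Qed.
Let phi1 : phi 1 = 1. Proof. by case: phi_alg. Qed.

Lemma bicross_tgtE b : t b = \sw_(b1, b2 <- ΔB b) i (phi b1) * s b2.
Proof. by apply: eq_tsum => b1 b2; rewrite bicross_inclMsrc. Qed.

Lemma bicross_tgt_linear : linear t.
Proof.
apply: lin_tsum_arg; [exact: comul_linear hB | | exact: balanced0].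
by split=> ?; [apply: lin_pure_l | apply: lin_pure_r].
Qed.

Ltac lin := repeat first
  [ exact: lin_id | exact: T_lin | exact: phi_lin
  | exact: (antipode_linear hA) | exact: (antipode_linear hB)
  | exact: (comul_linear hA) | exact: (comul_linear hB)
  | exact: (coact_linear hP) | exact: (act_linear_r hP)
  | exact: (act_linear_l hP)
  | exact: bicross_incl_linear | exact: bicross_src_linear
  | exact: bicross_tgt_linear | exact: balanced0
  | apply: (lin_comp (@bicross_incl_linear _ _ _ P))
  | apply: (lin_comp (@bicross_src_linear _ _ _ P))
  | apply: (lin_comp bicross_tgt_linear)
  | apply: lin_mul_l | apply: lin_mul_r
  | apply: lin_pure_l | apply: lin_pure_r
  | apply: (lin_comp (act_linear_r hP _))
  | apply: (lin_comp (f := fun b => act P b _) (act_linear_l hP _))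
  | apply: (lin_comp T_lin) | apply: (lin_comp phi_lin)
  | apply: (lin_comp (antipode_linear hA))
  | apply: (lin_comp (antipode_linear hB))
  | apply: (lin_comp (comul_linear hA))
  | apply: lin_tsum_in => ? ? | apply: lin_tsum_arg | split=> * ].

(** Condition [act_phi] amounts to (b ◁ φ(b'_1))b'_2 = b'_1 b, because the conjugation b'_1 b
    S(b'_2) is followed by b'_3. This is the second factor obtained when s(b) is moved past
    i(φ(b'_1)). *)
Lemma bicross_src_tgt_comm b b' : s b * t b' = t b' * s b.
Proof.
rewrite !bicross_tgtE (lin_tsum _ _ (f := fun X => s b * X)); last by lin.
rewrite (lin_tsum _ _ (f := fun X => X * s b)); last by lin.
transitivity (\sw_(b1, b3 <- ΔB b') \sw_(b11, b12 <- ΔB b1)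
   i (phi b11) * s (b <| phi b12 * b3)).
  apply: eq_tsum => b1 b3; rewrite mulrA bicross_srcMincl phi_comul.
  rewrite tsum_tsum; last by lin.
  rewrite (lin_tsum _ _ (f := fun X => X * s b3)); last by lin.
  by apply: eq_tsum => x y; rewrite tsum_tensE -?mulrA -?bicross_srcM //; lin.
rewrite (@comul_coassoc_tri _ _ _ (fun x y z => i (phi x) * s (b <| phi y *
  z))); last by lin.
apply: eq_tsum => b1 b2.
rewrite -(lin_tsum _ _ (f := fun z => i (phi b1) * s z)); last by lin.
rewrite -mulrA -bicross_srcM; congr (_ * s _).
transitivity (\sw_(x, z <- ΔB b2) \sw_(x1, x2 <- ΔB x) x1 * b * (antipode B x2 *
  z)).
  apply: eq_tsum => x z; rewrite act_phi (lin_tsum _ _ (f := fun X => X * z));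
    last by lin.
  by apply: eq_tsum => x1 x2; rewrite mulrA.
rewrite (@comul_coassoc_tri _ _ _ (fun x y z => x * b * (antipode B y * z)));
  last by lin.
rewrite (@collapse_r _ _ _ _ (fun x y => antipode B x * y) 1 (antipode_l hB)
  (fun x y => x * b * y)) ?mulr1 //; lin.
Qed.

(** φ reverses products and s preserves them, so the expansion of t(bb') reads
    i(φ(b'_1))t(b)s(b'_2); commuting t(b) past s(b'_2) leaves t(b')t(b). *)
Lemma bicross_tgtM b b' : t (b * b') = t b' * t b.
Proof.
rewrite [t b']bicross_tgtE (lin_tsum _ _ (f := fun X => X * t b)); last by lin.
transitivity (\sw_(c1, c2 <- ΔB b') i (phi c1) * (t b * s c2)); last first.
  by apply: eq_tsum => c1 c2; rewrite -mulrA bicross_src_tgt_comm.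
rewrite bicross_tgtE (comulM hB) /tens_mul tsum_tsum; last by lin.
transitivity (\sw_(c1, c2 <- ΔB b') \sw_(b1, b2 <- ΔB b)
    i (phi c1) * (i (phi b1) * s b2 * s c2)); last first.
  apply: eq_tsum => c1 c2; rewrite bicross_tgtE.
  by rewrite (lin_tsum _ _ (f := fun X => i (phi c1) * (X * s c2))) //; lin.
rewrite tsum_exchange; apply: eq_tsum => b1 b2.
rewrite tsum_tsum; last by lin.
apply: eq_tsum => c1 c2; rewrite tsum_tensE; last by lin.
by rewrite phiM bicross_inclM bicross_srcM !mulrA.
Qed.

(** Condition [phi_act] solved for φ(b)a, by cancelling a_3S^-1(a_2). *)
Let phi_actM a b : \sw_(a1, a2 <- Δ a) a2 * phi (b <| a1) = phi b * a.
Proof.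
transitivity (\sw_(a1, a2 <- Δ a) \sw_(x1, x2 <- Δ a1) (a2 * T x2) * (phi b *
  x1)).
  apply: eq_tsum => a1 a2;
    rewrite phi_act (lin_tsum _ _ (f := fun X => a2 * X)); last by lin.
  by apply: eq_tsum => x1 x2; rewrite !mulrA.
rewrite (collapse_r_l (antipode_inv_r SK TK) (f := fun x u => u * (phi b * x)))
  ?mul1r //; lin.
Qed.

Lemma bicross_tgt1 : t 1 = 1.
Proof.
rewrite bicross_tgtE (comul1 hB) tsum_tensE; last by lin.
by rewrite phi1 bicross_incl1 bicross_src1 mulr1.
Qed.

(** The lift of [phi_act] from φ to t. Expanding the coproduct of b ◁ a produces φ(a_2^[-1])φ(b_1 ◁
    a_1) ⊗ b_2 ◁ a_2^[0]. Condition [phi_coact] turns φ(a_2^[-1]) ⊗ a_2^[0] into S^-1(a_4)a_2 ⊗ a_3,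
    and [phi_actM] absorbs a_2φ(b_1 ◁ a_1). What remains is s(b_2) moved past i(A). *)
Lemma bicross_tgt_act b a :
  t (b <| a) = \sw_(a1, a2 <- Δ a) i (T a2) * t b * i a1.
Proof.
rewrite bicross_tgtE (act_comul hP) tsum_tsum; last by lin.
transitivity (\sw_(b1, b2 <- ΔB b) \sw_(a1, a2 <- Δ a)
    i (T a2) * (i (phi b1) * s b2) * i a1); last first.
  rewrite tsum_exchange; apply: eq_tsum => a1 a2; rewrite bicross_tgtE.
  by rewrite (lin_tsum _ _ (f := fun X => i (T a2) * X * i a1)) //; lin.
apply: eq_tsum => b1 b2; rewrite tsum_tsum; last by lin.
pose F a' p x := i p * i (phi (b1 <| a')) * s (b2 <| x).
transitivity (\sw_(a1, a2 <- Δ a) \sw_(x1, x23 <- Δ a2) \sw_(x2, x3 <- Δ x23)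
    F a1 (T x3 * x1) x2).
  apply: eq_tsum => a1 a2.
  have bF : bilin (F a1) by rewrite /F; lin.
  transitivity (tsum (\sw_(c, a0 <- coact P a2) phi c ⊗ a0) (F a1)).
    rewrite !tsum_tsum //; last by lin.
    apply: eq_tsum => c a0; rewrite !tsum_tensE //; last by lin.
    by rewrite /F -bicross_inclM -phiM.
  rewrite phi_coact tsum_tsum //; apply: eq_tsum => x1 x23.
  by rewrite tsum_tsum //; apply: eq_tsum => x2 x3; rewrite tsum_tensE.
rewrite -(@comul_coassoc_tri _ _ _ (fun a1 x1 z => \sw_(x2, x3 <- Δ z)
  F a1 (T x3 * x1) x2)); last by rewrite /F; lin.
transitivity (\sw_(a', z <- Δ a) \sw_(x2, x3 <- Δ z)
    i (T x3) * i (phi b1 * a') * s (b2 <| x2)).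
  apply: eq_tsum => a' z; rewrite tsum_exchange; apply: eq_tsum => x2 x3.
  rewrite -phi_actM.
  rewrite (lin_tsum _ _ (f := fun X => i (T x3) * i X * s (b2 <| x2)));
    last by lin.
  by apply: eq_tsum => a1 x1; rewrite /F !bicross_inclM !mulrA.
rewrite -(@comul_coassoc_tri _ _ _ (fun a' x2 x3 =>
  i (T x3) * i (phi b1 * a') * s (b2 <| x2))); last by lin.
apply: eq_tsum => a1 a2; rewrite -!mulrA bicross_srcMincl.
rewrite (lin_tsum _ _ (f := fun X => i (T a2) * (i (phi b1) * X))); last by lin.
by apply: eq_tsum => x y; rewrite bicross_inclM !mulrA.
Qed.

(** Expanding the right side by [bicross_tgt_act] gives i(a_3S^-1(a_2))t(b)i(a_1), which
    collapses. *)
Lemma bicross_tgtMincl b a :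
  t b * i a = \sw_(a1, a2 <- Δ a) i a2 * t (b <| a1).
Proof.
transitivity (\sw_(a1, a2 <- Δ a) \sw_(x1, x2 <- Δ a1) i (a2 * T x2) * (t b * i
  x1)).
  rewrite (collapse_r_l (antipode_inv_r SK TK) (f := fun x u => i u * (t b * i
    x))); try lin.
  by rewrite bicross_incl1 mul1r.
apply: eq_tsum => a1 a2; rewrite bicross_tgt_act.
rewrite (lin_tsum _ _ (f := fun X => i a2 * X)); last by lin.
by apply: eq_tsum => x y; rewrite bicross_inclM !mulrA.
Qed.

(** An identity in H ⊗ A, tested against a bilinear [G] so that it can be applied inside longer
    Sweedler sums. Since t(c) = i(φ(c_1))s(c_2), coassociativity of the coaction isolates
    φ(a_1^[-1]) ⊗ a_1^[0]; by [phi_coact] the factor in front becomes a_4S^-1(a_3)a_1, with a_2 left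
    to be coacted on, and this collapses. *)
Lemma bicross_tgt_coact (M : lmodType k) (G : H -> A -> M) a : bilin G ->
  \sw_(a1, a2 <- Δ a) \sw_(c, a0 <- coact P a1) G (i a2 * t c) a0
  = \sw_(a1, a2 <- Δ a) \sw_(c, a0 <- coact P a2) G (i a1 * s c) a0.
Proof.
move=> bG; have [Gl Gr] := bG.
pose F (y x : A) : M := \sw_(c, x0 <- coact P x) G (i y * s c) x0.
have bF : bilin F.
  split=> [x|y]; rewrite /F.
    by apply: lin_tsum_in => c x0; apply: (lin_comp (Gl _)); lin.
  apply: lin_tsum_arg; [by lin| |by lin].
  by split=> ?; [apply: (lin_comp (Gl _)); lin | apply: Gr].
have [Fl Fr] := bF.
transitivity (\sw_(a1, a2 <- Δ a) \sw_(x1, x23 <- Δ a1) \sw_(x2, x3 <- Δ x23)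
    F (a2 * T x3 * x1) x2).
  apply: eq_tsum => a1 a2.
  have bf : bilin (fun p x => F (a2 * p) x).
    by split=> ?; [apply: (lin_comp (Fl _)); lin | apply: Fr].
  transitivity (tsum (\sw_(c, a0 <- coact P a1) phi c ⊗ a0) (fun p x => F (a2 *
    p) x)); last first.
    rewrite phi_coact tsum_tsum //; apply: eq_tsum => x1 x23.
    by rewrite tsum_tsum //; apply: eq_tsum => x2 x3; rewrite tsum_tensE // mulrA.
  rewrite tsum_tsum //.
  (* [K] transports coassociativity of the coaction, an identity in B ⊗ (B ⊗ A), to the present sum:
     φ is applied to the first leg and s to the second. *)
  pose K (u : B ⊗ (B ⊗ A)) : M := \sw_(x, v <- u) \sw_(y, z <- v) G (i (a2 * phi
    x) * s y) z.
  have bK2 x : bilin (fun y z => G (i (a2 * phi x) * s y) z).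
    by split=> ?; [apply: (lin_comp (Gl _)); lin | apply: Gr].
  have bK1 : bilin (fun x (v : B ⊗ A) => \sw_(y, z <- v) G (i (a2 * phi x) * s
    y) z).
    split=> [v|x]; last by apply: lin_tsum_arg; [by lin | exact: bK2 | by lin].
    by apply: lin_tsum_in => ? ?; apply: (lin_comp (Gl _)); lin.
  have lK : linear K by apply: lin_tsum_arg; [by lin | exact: bK1 | by lin].
  have := congr1 K (coact_coassoc hP a1).
  rewrite !(lin_tsum _ _ lK) => E.
  transitivity (\sw_(c, a0 <- coact P a1) K (c ⊗ coact P a0)); last first.
    by apply: eq_tsum => c a0; rewrite tsum_tensE // /K tsum_tensE.
  rewrite -E; apply: eq_tsum => c a0; rewrite (lin_tsum _ _ lK) bicross_tgtE.
  rewrite (lin_tsum _ _ (f := fun X => G (i a2 * X) a0)); last first.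
    by apply: (lin_comp (Gl _)); lin.
  by apply: eq_tsum => c1 c2; rewrite /K !tsum_tensE // bicross_inclM mulrA.
pose F3 x1 x23 a2 := \sw_(x2, x3 <- Δ x23) F (a2 * T x3 * x1) x2.
rewrite (@comul_coassoc_tri _ _ _ F3); last first.
  split=> *; rewrite /F3; [apply: lin_tsum_in=> *|apply: lin_tsum_arg;
    [lin| |lin]|apply: lin_tsum_in=> *].
  - by apply: (lin_comp (Fl _)); lin.
  - by split=> *; [apply: Fr|apply: (lin_comp (Fl _)); lin].
  - by apply: (lin_comp (Fl _)); lin.
apply: eq_tsum => x1 y; rewrite /F3.
rewrite (collapse_r_l (m := fun x y => y * T x) (antipode_inv_r SK TK) (f := fun
  x u => F (u * x1) x)) ?mul1r //; first by lin.
by split=> *; [apply: Fr|apply: (lin_comp (Fl _)); lin].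
Qed.

End CrossedRelations.

(** * Left multiplication on the balanced tensor square *)

Section BialgebroidTensor.
Variables (k : fieldType) (B H : algType k) (D : bialgebroid_data B H).
Implicit Types (X Y : H) (u v : tensB D).

Lemma tensB_bal X b Y : (X * src D b) ⊠ Y = X ⊠ (Y * tgt D b) :> tensB D.
Proof. exact: pure_bal. Qed.

(** Balancing multiplies on the right, so this left action of H ⊗ H is defined on all of H ⊗_B H.
    Working with it confines the Takeuchi condition to [tensB_lmul_balanced], where the action is
    required to depend only on the class of (X, Y). *)
Definition tensB_lmul X Y v : tensB D :=
  \sw_(X', Y' <- v) (X * X') ⊠ (Y * Y').

Let lmul_bilin X Y : bilin (fun X' Y' => (X * X') ⊠ (Y * Y') : tensB D).
Proof.
by split=> ?; [apply/lin_pure_l | apply/lin_pure_r]; apply/lin_mul_r/lin_id.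
Qed.

Let lmul_balanced X Y :
  balanced (fun X b => X * src D b) (fun b Y => Y * tgt D b)
    (fun X' Y' => (X * X') ⊠ (Y * Y') : tensB D).
Proof. by move=> X' b Y'; rewrite !mulrA tensB_bal. Qed.

Lemma tensB_lmul_linear X Y : linear (tensB_lmul X Y).
Proof. exact: tsum_linear. Qed.

Lemma tensB_lmul_bilin v : bilin (fun X Y => tensB_lmul X Y v).
Proof.
split=> ?; apply: lin_tsum_in => ? ?.
  exact/lin_pure_l/lin_mul_l/lin_id.
exact/lin_pure_r/lin_mul_l/lin_id.
Qed.

Lemma tensB_lmulE X Y X' Y' :
  tensB_lmul X Y (X' ⊠ Y') = (X * X') ⊠ (Y * Y').
Proof. exact: tsumE. Qed.

Lemma tensB_lmulA X Y X' Y' v :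
  tensB_lmul (X * X') (Y * Y') v = tensB_lmul X Y (tensB_lmul X' Y' v).
Proof.
rewrite [tensB_lmul X' Y' v]/tensB_lmul (lin_tsum _ _ (tensB_lmul_linear X Y)).
by apply: eq_tsum => X'' Y''; rewrite tensB_lmulE !mulrA.
Qed.

Lemma takeuchiE v : takeuchi v <->
  forall b, tensB_lmul (src D b) 1 v = tensB_lmul 1 (tgt D b) v.
Proof.
split=> h b; have := h b; rewrite /takeuchi /tensB_lmul.
  move=> E; transitivity (\sw_(X, Y <- v) (src D b * X) ⊠ Y : tensB D).
    by apply: eq_tsum => X Y; rewrite mul1r.
  by rewrite E; apply: eq_tsum => X Y; rewrite mul1r.
move=> E; transitivity (\sw_(X, Y <- v) (src D b * X) ⊠ (1 * Y) : tensB D).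
  by apply: eq_tsum => X Y; rewrite mul1r.
by rewrite E; apply: eq_tsum => X Y; rewrite mul1r.
Qed.

(** Acting by (X s(b), Y) means acting by (s(b), 1) and afterwards by (X, Y); on the Takeuchi
    product (s(b), 1) acts as (1, t(b)). *)
Lemma tensB_lmul_balanced v : takeuchi v ->
  balanced (fun X b => X * src D b) (fun b Y => Y * tgt D b)
    (fun X Y => tensB_lmul X Y v).
Proof.
move=> /takeuchiE hv X b Y.
rewrite -{1}[Y]mulr1 tensB_lmulA hv -tensB_lmulA.
by rewrite mulr1.
Qed.

Lemma tensB_mulE X Y v : takeuchi v ->
  tensB_mul (X ⊠ Y) v = tensB_lmul X Y v.
Proof.
by move=> hv; apply: tsumE;
  [apply: tensB_lmul_bilin | apply: tensB_lmul_balanced].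
Qed.

Lemma tensB_mul_linear_l v : takeuchi v -> linear (fun u => tensB_mul u v).
Proof.
by move=> hv; apply: tsum_linear;
  [apply: tensB_lmul_bilin | apply: tensB_lmul_balanced].
Qed.

Lemma tensB_mul_linear_r u : linear (tensB_mul u).
Proof. by apply: lin_tsum_in => X Y; apply: tensB_lmul_linear. Qed.

End BialgebroidTensor.

(** * Bialgebroids generated by i(A) and s(B) *)

(* What the bialgebroid axioms need to know about A ▷◂ B, with [T] in the role of
   the inverse antipode of A.  The carrier H and the structure D are abstract, so
   that H = A ⊗ B enters only through its universal property [fac_ext], [fac_rec]. *)
Record factorization (k : fieldType) (A B : hopfAlg k) (H : algType k)
    (D : bialgebroid_data B H) (i : A -> H) (act : B -> A -> B) (phi : B -> A)
    (T : A -> A) : Prop := Factorization {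
  fac_ext : forall (M : lmodType k) (f g : H -> M), linear f -> linear g ->
    (forall a b, f (i a * src D b) = g (i a * src D b)) -> forall X, f X = g X;
  fac_rec : forall (M : lmodType k) (F : A -> B -> M), bilin F ->
    exists2 f : H -> M, linear f & forall a b, f (i a * src D b) = F a b;
  fac_incl_linear : linear i;
  fac_incl1 : i 1 = 1;
  fac_inclM : forall a a', i (a * a') = i a * i a';
  fac_src_linear : linear (src D);
  fac_src1 : src D 1 = 1;
  fac_srcM : forall b b', src D (b * b') = src D b * src D b';
  fac_tgt_linear : linear (tgt D);
  fac_tgt1 : tgt D 1 = 1;
  fac_tgtM : forall b b', tgt D (b * b') = tgt D b' * tgt D b;
  fac_tgtE : forall b,
    tgt D b = \sw_(b1, b2 <- comul B b) i (phi b1) * src D b2;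
  fac_act_linear_l : forall a, linear (fun b => act b a);
  fac_act_linear_r : forall b, linear (act b);
  fac_act1 : forall b, act b 1 = b;
  fac_actM : forall b a a', act b (a * a') = act (act b a) a';
  fac_srcMincl : forall b a,
    src D b * i a = \sw_(a1, a2 <- comul A a) i a1 * src D (act b a2);
  fac_tgtMincl : forall b a,
    tgt D b * i a = \sw_(a1, a2 <- comul A a) i a2 * tgt D (act b a1);
  fac_tgt_act : forall b a,
    tgt D (act b a) = \sw_(a1, a2 <- comul A a) i (T a2) * tgt D b * i a1;
  fac_src_tgt_comm : forall b b', src D b * tgt D b' = tgt D b' * src D b;
  fac_phi : coalgebra_map B A phi;
  fac_cop_linear : linear (cop D : H -> tensB D);
  fac_cop : forall a b, cop D (i a * src D b)
    = \sw_(a1, a2 <- comul A a) i a1 ⊠ (i a2 * src D b) :> tensB D;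
  fac_cnt_linear : linear (cnt D);
  fac_cnt : forall a b, cnt D (i a * src D b) = counit A a *: b }.

Section Factorized.
Variables (k : fieldType) (A B : hopfAlg k) (H : algType k).
Variables (D : bialgebroid_data B H) (i : A -> H) (act : B -> A -> B).
Variables (phi : B -> A) (T : A -> A).
Hypothesis hF : factorization D i act phi T.
Hypotheses (SK : cancel (antipode A) T) (TK : cancel T (antipode A)).
Local Notation s := (src D).
Local Notation t := (tgt D).
Local Notation "▲" := (cop D : H -> tensB D).
Local Notation "b <| a" := (act b a) (at level 39, left associativity).
Local Notation SA := (antipode A).
Local Notation Δ := (comul A).
Local Notation ΔB := (comul B).
Let hA := hopf_laws A.
Let hB := hopf_laws B.
Let T_lin : linear T := antipode_inv_linear SK TK.
Let i_lin := fac_incl_linear hF.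
Let s_lin := fac_src_linear hF.
Let t_lin := fac_tgt_linear hF.
Let cop_lin := fac_cop_linear hF.
Let act_lin_r := fac_act_linear_r hF.
Let act_lin_l := fac_act_linear_l hF.

Let phi_lin : linear phi. Proof. by case: (fac_phi hF). Qed.
Let phi_comul b : Δ (phi b) = \sw_(b1, b2 <- ΔB b) phi b1 ⊗ phi b2.
Proof. by case: (fac_phi hF). Qed.
Let phi_counit b : counit A (phi b) = counit B b.
Proof. by case: (fac_phi hF). Qed.

Ltac lin := repeat first
  [ exact: lin_id | exact: T_lin | exact: phi_lin
  | exact: (antipode_linear hA) | exact: (antipode_linear hB)
  | exact: (comul_linear hA) | exact: (comul_linear hB)
  | exact: act_lin_r | exact: act_lin_l
  | exact: i_lin | exact: s_lin | exact: t_lin | exact: cop_lin | exact: balanced0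
  | apply: (lin_comp i_lin) | apply: (lin_comp s_lin) | apply: (lin_comp t_lin)
  | apply: (lin_comp cop_lin)
  | apply: (lin_comp (@tensB_lmul_linear _ _ _ D _ _))
  | apply: lin_mul_l | apply: lin_mul_r
  | apply: lin_pure_l | apply: lin_pure_r
  | apply: (lin_comp (act_lin_r _))
  | apply: (lin_comp (f := fun b => act b _) (act_lin_l _))
  | apply: (lin_comp T_lin) | apply: (lin_comp phi_lin)
  | apply: (lin_comp (antipode_linear hA))
  | apply: (lin_comp (antipode_linear hB))
  | apply: (lin_comp (comul_linear hA))
  | apply: lin_tsum_in => ? ? | apply: lin_tsum_arg | split=> * ].

(** * Commutation rules involving the antipode of A and its inverse *)

Let SlA a : \sw_(x, y <- Δ a) SA x * y = counit A a *: 1 := antipode_l hA a.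
Let SrA a : \sw_(x, y <- Δ a) x * SA y = counit A a *: 1 := antipode_r hA a.

(** The inverse of the rule [fac_tgtMincl]: moving t past i(A) on the right side gives i(a_3)t(b ◁
    S(a_1)a_2), which collapses. *)
Lemma fac_inclMtgt a b :
  i a * t b = \sw_(a1, a2 <- Δ a) t (b <| SA a1) * i a2.
Proof.
transitivity (\sw_(a1, a2 <- Δ a) \sw_(y1, y2 <- Δ a2) i y2 * t (b <| (SA a1 *
  y1))).
  rewrite (collapse_l_r SlA (f := fun u y => i y * t (b <| u))) ?(fac_act1 hF)
    //; lin.
apply: eq_tsum => a1 a2; rewrite (fac_tgtMincl hF).
by apply: eq_tsum => x y; rewrite (fac_actM hF).
Qed.

Let tgt_act_antipode a b :
  t (b <| SA a) = \sw_(a1, a2 <- Δ a) i a1 * t b * i (SA a2).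
Proof.
transitivity (\sw_(a1, a2 <- Δ a) \sw_(x1, x2 <- Δ a1) t (b <| SA x1) * i (x2 *
  SA a2)).
  rewrite (collapse_r_l SrA (f := fun x u => t (b <| SA x) * i u)) ?(fac_incl1
    hF) ?mulr1 //; lin.
apply: eq_tsum => a1 a2; rewrite fac_inclMtgt.
rewrite (lin_tsum _ _ (f := fun X => X * i (SA a2))); last by lin.
by apply: eq_tsum => x y; rewrite (fac_inclM hF) !mulrA.
Qed.

(* Derived from [fac_inclMtgt] by cancelling S(a_1)a_2 and a_1S(a_2), which spares
   the anti-comultiplicativity of the antipode. *)
Lemma fac_tgtMincl_antipode b a :
  t b * i (SA a) = \sw_(a1, a2 <- Δ a) i (SA a1) * t (b <| SA a2).
Proof.
transitivity (\sw_(a1, a2 <- Δ a) \sw_(x1, x2 <- Δ a2) i (SA a1 * x1) * (t b * i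
  (SA x2))).
  rewrite (collapse_l_r SlA (f := fun u x => i u * (t b * i (SA x))))
    ?(fac_incl1 hF) ?mul1r //; lin.
apply: eq_tsum => a1 a2; rewrite tgt_act_antipode.
rewrite (lin_tsum _ _ (f := fun X => i (SA a1) * X)); last by lin.
by apply: eq_tsum => x y; rewrite (fac_inclM hF) !mulrA.
Qed.

(** The counterpart of [fac_inclMtgt] for s. In s(b)i(a) the last leg of a acts on b, so S^-1 is
    needed here: the right side equals i(a_1)s(b ◁ S^-1(a_3)a_2). *)
Lemma fac_inclMsrc_comm a b :
  i a * s b = \sw_(a1, a2 <- Δ a) s (b <| T a2) * i a1.
Proof.
transitivity (\sw_(a1, a2 <- Δ a) \sw_(x1, x2 <- Δ a1) i x1 * s (b <| (T a2 *
  x2))).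
  rewrite (collapse_r_l (m := fun x y => T y * x) (antipode_inv_l SK TK) (f :=
    fun x u => i x * s (b <| u))) ?(fac_act1 hF) //; lin.
apply: eq_tsum => a1 a2; rewrite (fac_srcMincl hF).
by apply: eq_tsum => x y; rewrite (fac_actM hF).
Qed.

Let src_act_antipode_inv a b :
  s (b <| T a) = \sw_(a1, a2 <- Δ a) i a2 * s b * i (T a1).
Proof.
transitivity (\sw_(a1, a2 <- Δ a) \sw_(x1, x2 <- Δ a2) s (b <| T x2) * i (x1 * T
  a1)).
  rewrite (collapse_l_r (m := fun x y => y * T x) (antipode_inv_r SK TK) (f :=
    fun u x => s (b <| T x) * i u)) ?(fac_incl1 hF) ?mulr1 //; lin.
apply: eq_tsum => a1 a2; rewrite fac_inclMsrc_comm.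
rewrite (lin_tsum _ _ (f := fun X => X * i (T a1))); last by lin.
by apply: eq_tsum => x y; rewrite (fac_inclM hF) !mulrA.
Qed.

Lemma fac_srcMincl_antipode_inv b a :
  s b * i (T a) = \sw_(a1, a2 <- Δ a) i (T a2) * s (b <| T a1).
Proof.
transitivity (\sw_(a1, a2 <- Δ a) \sw_(x1, x2 <- Δ a1) i (T a2 * x2) * (s b * i
  (T x1))).
  rewrite (collapse_r_l (m := fun x y => T y * x) (antipode_inv_l SK TK) (f :=
    fun x u => i u * (s b * i (T x)))) ?(fac_incl1 hF) ?mul1r //; lin.
apply: eq_tsum => a1 a2; rewrite src_act_antipode_inv.
rewrite (lin_tsum _ _ (f := fun X => i (T a2) * X)); last by lin.
by apply: eq_tsum => x y; rewrite (fac_inclM hF) !mulrA.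
Qed.

(** Brings t(b)i(S^-1(a)) to the normal form i(A)s(B), in which the theorem states the inverse of μ
    and, when S^-1 = S, the full antipode. *)
Lemma fac_tgtMincl_antipode_inv b a : t b * i (T a)
  = \sw_(a1, a2 <- Δ a) \sw_(b1, b2 <- ΔB b) i (phi b1 * T a2) * s (b2 <| T a1).
Proof.
rewrite (fac_tgtE hF) (lin_tsum _ _ (f := fun X => X * i (T a))); last by lin.
rewrite tsum_exchange; apply: eq_tsum => b1 b2.
rewrite -mulrA fac_srcMincl_antipode_inv.
rewrite (lin_tsum _ _ (f := fun X => i (phi b1) * X)); last by lin.
by apply: eq_tsum => a1 a2; rewrite mulrA (fac_inclM hF).
Qed.

(** By [fac_tgt_act] the right side is i(S^-1(a_3))t(b)i(a_2S^-1(a_1)). The full antipode carries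
    the rule for s(b)i(a) to this one. *)
Lemma fac_incl_antipode_invMtgt a b :
  i (T a) * t b = \sw_(a1, a2 <- Δ a) t (b <| a2) * i (T a1).
Proof.
transitivity (\sw_(a1, a2 <- Δ a) \sw_(x1, x2 <- Δ a2) i (T x2) * t b * i (x1 *
  T a1)).
  rewrite (collapse_l_r (m := fun x y => y * T x) (antipode_inv_r SK TK) (f :=
    fun u x => i (T x) * t b * i u)) ?(fac_incl1 hF) ?mulr1 //; lin.
apply: eq_tsum => a1 a2; rewrite (fac_tgt_act hF).
rewrite (lin_tsum _ _ (f := fun X => X * i (T a1))); last by lin.
by apply: eq_tsum => x y; rewrite (fac_inclM hF) !mulrA.
Qed.

(** Expand t(b_2) and cancel S(φ(b_1))φ(b_2), which is possible because φ preserves coproduct and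
    counit. It expresses s through t, the only map that crosses the tensor product defining the
    domain of λ. *)
Lemma antipode_phi_tgt b :
  \sw_(b1, b2 <- ΔB b) i (SA (phi b1)) * t b2 = s b.
Proof.
transitivity (\sw_(b1, b2 <- ΔB b) \sw_(x1, x2 <- ΔB b2) i (SA (phi b1) * phi
  x1) * s x2).
  apply: eq_tsum => b1 b2; rewrite (fac_tgtE hF).
  rewrite (lin_tsum _ _ (f := fun X => i (SA (phi b1)) * X)); last by lin.
  by apply: eq_tsum => x y; rewrite (fac_inclM hF) !mulrA.
have Slphi x : \sw_(x1, x2 <- ΔB x) SA (phi x1) * phi x2 = counit B x *: 1.
  rewrite -phi_counit -SlA phi_comul tsum_tsum; last by lin.
  by apply: eq_tsum => x1 x2; rewrite tsum_tensE //; lin.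
rewrite (collapse_l_r Slphi (f := fun u x => i u * s x)) ?(fac_incl1 hF) ?mul1r
  //; lin.
Qed.

(** * Multiplicativity of ▲ and the Takeuchi product *)

Lemma fac_cop_src b : ▲ (s b) = 1 ⊠ s b :> tensB D.
Proof.
rewrite -[s b]mul1r -(fac_incl1 hF) (fac_cop hF) (comul1 hA).
by rewrite (tsum_tensE (M := tensB D)) //; split=> *; lin.
Qed.

Lemma fac_cop_incl a :
  ▲ (i a) = \sw_(a1, a2 <- Δ a) i a1 ⊠ i a2 :> tensB D.
Proof.
rewrite -[i a]mulr1 -(fac_src1 hF) (fac_cop hF).
by apply: eq_tsum => x y; rewrite (fac_src1 hF) mulr1.
Qed.

(** φ is a coalgebra map, so ▲(t(b)) is i(φ(b_1)) ⊗ t(b_2), and t(b_2) crosses ⊗_B to become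
    s(b_2). *)
Lemma fac_cop_tgt b : ▲ (t b) = t b ⊠ 1 :> tensB D.
Proof.
rewrite (fac_tgtE hF) (lin_tsum _ _ cop_lin).
transitivity (\sw_(b1, b2 <- ΔB b) \sw_(x1, x2 <- ΔB b1)
    i (phi x1) ⊠ (i (phi x2) * s b2) : tensB D).
  apply: eq_tsum => b1 b2; rewrite (fac_cop hF) phi_comul.
  rewrite (tsum_tsum (M := tensB D)); last by lin.
  by apply: eq_tsum => x y; rewrite (tsum_tensE (M := tensB D)) //; lin.
rewrite (@comul_coassoc_tri _ _ (tensB D) (fun x1 x2 b2 => i (phi x1) ⊠ (i (phi
  x2) * s b2) : tensB D)); last by lin.
rewrite (lin_tsum _ _ (f := fun X => X ⊠ 1 : tensB D)); last by lin.
apply: eq_tsum => b1 b2; rewrite tensB_bal mul1r (fac_tgtE hF).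
by rewrite (lin_tsum _ _ (f := fun X => i (phi b1) ⊠ X : tensB D)) //; lin.
Qed.

(** Moving s(b) past i(a_1) leaves s(b ◁ a_2), which crosses ⊗_B as t(b ◁ a_2) and lands behind
    i(a_3); [fac_tgtMincl] reads i(a_3)t(b ◁ a_2) as t(b) times i of the remaining leg. *)
Lemma fac_cop_takeuchi X : takeuchi (▲ X).
Proof.
apply/takeuchiE => b; pattern X.
apply: (@fac_ext _ _ _ _ _ _ _ _ _ hF (tensB D) (fun X => tensB_lmul (s b) 1 (▲
  X))
  (fun X => tensB_lmul 1 (t b) (▲ X))); try by lin.
move=> a c; rewrite (fac_cop hF) !(lin_tsum _ _ (@tensB_lmul_linear _ _ _ D _ _)).
transitivity (\sw_(a1, a2 <- Δ a) \sw_(x1, x2 <- Δ a1) i x1 ⊠ (i a2 * t (b <|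
  x2) * s c) : tensB D).
  apply: eq_tsum => a1 a2; rewrite tensB_lmulE mul1r (fac_srcMincl hF).
  rewrite (lin_tsum _ _ (f := fun X => X ⊠ (i a2 * s c) : tensB D)); last by lin.
  apply: eq_tsum => x1 x2; rewrite tensB_bal.
  by rewrite -!mulrA (fac_src_tgt_comm hF).
rewrite (@comul_coassoc_tri _ _ (tensB D) (fun x1 x2 a2 => i x1 ⊠ (i a2 * t (b
  <| x2) * s c) : tensB D)); last by lin.
apply: eq_tsum => a1 a2; rewrite tensB_lmulE mul1r mulrA (fac_tgtMincl hF).
by rewrite (lin_tsum _ _ (f := fun X => i a1 ⊠ (X * s c) : tensB D)) //; lin.
Qed.

Let tensB_mul_gen a b v : takeuchi v -> tensB_mul (▲ (i a * s b)) v
  = \sw_(a1, a2 <- Δ a) tensB_lmul (i a1) (i a2 * s b) v :> tensB D.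
Proof.
move=> hv; rewrite (fac_cop hF) (lin_tsum _ _ (tensB_mul_linear_l hv)).
by apply: eq_tsum => x y; rewrite tensB_mulE.
Qed.

(** Reduction to generators in X requires ▲(Y) to lie in the Takeuchi product. On generators both
    sides are i(a_1a'_1) ⊗ i(a_2a'_2)s((b ◁ a'_3)b'). *)
Lemma fac_copM X Y : ▲ (X * Y) = tensB_mul (▲ X) (▲ Y).
Proof.
pattern X; apply: (@fac_ext _ _ _ _ _ _ _ _ _ hF (tensB D) (fun X => ▲ (X * Y))
    (fun X => tensB_mul (▲ X) (▲ Y))); first by lin.
  exact: (lin_comp (tensB_mul_linear_l (fac_cop_takeuchi Y)) cop_lin).
move=> a b; pattern Y;
  apply: (@fac_ext _ _ _ _ _ _ _ _ _ hF (tensB D) (fun Y => ▲ (i a * s b * Y))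
    (fun Y => tensB_mul (▲ (i a * s b)) (▲ Y))); first by lin.
  exact: (lin_comp (@tensB_mul_linear_r _ _ _ D _) cop_lin).
move=> a' b'; rewrite tensB_mul_gen; last exact: fac_cop_takeuchi.
transitivity (\sw_(y1, y2 <- Δ a') ▲ (i (a * y1) * s ((b <| y2) * b'))).
  rewrite -mulrA [s b * _]mulrA (fac_srcMincl hF).
  rewrite (lin_tsum _ _ (f := fun X => ▲ (i a * (X * s b')))); last by lin.
  by apply: eq_tsum => x y; rewrite (fac_inclM hF) (fac_srcM hF) !mulrA.
transitivity (\sw_(y1, y2 <- Δ a') \sw_(x1, x2 <- Δ y1) \sw_(a1, a2 <- Δ a)
    i (a1 * x1) ⊠ (i (a2 * x2) * s ((b <| y2) * b')) : tensB D).
  apply: eq_tsum => y1 y2; rewrite (fac_cop hF) (comulM hA) tsum_exchange.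
  rewrite (tsum_tsum (M := tensB D)); last by lin.
  apply: eq_tsum => a1 a2; rewrite (tsum_tsum (M := tensB D)); last by lin.
  by apply: eq_tsum => x1 x2; rewrite (tsum_tensE (M := tensB D)) //; lin.
rewrite (@comul_coassoc_tri _ _ (tensB D) (fun x1 x2 y2 => \sw_(a1, a2 <- Δ a)
    i (a1 * x1) ⊠ (i (a2 * x2) * s ((b <| y2) * b')) : tensB D)); last by lin.
transitivity (\sw_(a1, a2 <- Δ a) \sw_(x1, z <- Δ a') \sw_(x2, y2 <- Δ z)
    i (a1 * x1) ⊠ (i (a2 * x2) * s ((b <| y2) * b')) : tensB D).
  rewrite tsum_exchange; apply: eq_tsum => x1 z; exact: tsum_exchange.
apply: eq_tsum => a1 a2; rewrite (fac_cop hF).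
rewrite (lin_tsum _ _ (@tensB_lmul_linear _ _ _ D _ _)); apply: eq_tsum => x1 z.
rewrite tensB_lmulE -(fac_inclM hF) -mulrA [s b * _]mulrA (fac_srcMincl hF).
rewrite (lin_tsum _ _ (f := fun X => i (a1 * x1) ⊠ (i a2 * (X * s b')) : tensB
  D)); last by lin.
by apply: eq_tsum => x2 y2; rewrite !(fac_inclM hF) (fac_srcM hF) !mulrA.
Qed.

Lemma fac_copMsrc b Y : ▲ (s b * Y) = tensB_lmul 1 (s b) (▲ Y).
Proof. by rewrite fac_copM fac_cop_src tensB_mulE //;
  apply: fac_cop_takeuchi. Qed.

Lemma fac_copMtgt b Y : ▲ (t b * Y) = tensB_lmul (t b) 1 (▲ Y).
Proof. by rewrite fac_copM fac_cop_tgt tensB_mulE //;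
  apply: fac_cop_takeuchi. Qed.

Lemma fac_copMincl a Y :
  ▲ (i a * Y) = \sw_(a1, a2 <- Δ a) tensB_lmul (i a1) (i a2) (▲ Y).
Proof.
rewrite fac_copM fac_cop_incl.
rewrite (lin_tsum _ _ (tensB_mul_linear_l (fac_cop_takeuchi Y))).
by apply: eq_tsum => a1 a2; rewrite tensB_mulE //; apply: fac_cop_takeuchi.
Qed.

(** * Bimodule, counit and coassociativity axioms *)

Let cnt_lin := fac_cnt_linear hF.
Ltac linC := repeat first [ progress lin | exact: cnt_lin
  | apply: (lin_comp cnt_lin) ].

(** The outer actions of B descend to H ⊗_B H because s and t commute. *)
Let lact_lin b : linear (lactB (D := D) b).
Proof.
apply: tsum_linear; first by lin.
by move=> X c Y; rewrite -mulrA (fac_src_tgt_comm hF) mulrA tensB_bal.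
Qed.

Let ract_lin b : linear (fun u : tensB D => ractB u b).
Proof.
apply: tsum_linear; first by lin.
by move=> X c Y; rewrite -mulrA -(fac_src_tgt_comm hF) mulrA tensB_bal.
Qed.

Let lactE b X Y : lactB b (X ⊠ Y : tensB D) = (X * t b) ⊠ Y.
Proof.
apply: tsumE; first by lin.
by move=> X' c Y'; rewrite -mulrA (fac_src_tgt_comm hF) mulrA tensB_bal.
Qed.

Let ractE b X Y : ractB (X ⊠ Y : tensB D) b = X ⊠ (Y * s b).
Proof.
apply: tsumE; first by lin.
by move=> X' c Y'; rewrite -mulrA -(fac_src_tgt_comm hF) mulrA tensB_bal.
Qed.

Lemma fac_cop_bimod X b b' : ▲ (X * s b' * t b) = ractB (lactB b (▲ X)) b'.
Proof.
pattern X; apply: (@fac_ext _ _ _ _ _ _ _ _ _ hF (tensB D)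
  (fun X => ▲ (X * s b' * t b)) (fun X => ractB (lactB b (▲ X)) b')).
- by lin.
- exact: (lin_comp (lin_comp (ract_lin b') (lact_lin b)) cop_lin).
move=> a c; rewrite -!mulrA (fac_src_tgt_comm hF) [s c * _]mulrA.
rewrite (fac_src_tgt_comm hF) -mulrA -(fac_srcM hF) fac_copMincl fac_copMtgt.
rewrite fac_cop_src (fac_cop hF) (lin_tsum _ _ (lact_lin b)) (lin_tsum _ _
  (ract_lin b')).
apply: eq_tsum => a1 a2.
by rewrite !tensB_lmulE lactE ractE (fac_srcM hF) !mulr1 mul1r !mulrA.
Qed.

Let cnt_inclMtgt a b c : cnt D (i a * t b * s c) = counit A a *: (b * c).
Proof.
rewrite (fac_tgtE hF) (lin_tsum _ _ (f := fun X => cnt D (i a * X * s c)));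
  last by linC.
rewrite -{2}(counit_l hB b) (lin_tsum _ _ (f := fun X => counit A a *: (X *
  c))); last first.
  by apply/lin_scaler/lin_mul_l/lin_id.
apply: eq_tsum => b1 b2; rewrite mulrA -(fac_inclM hF) -mulrA -(fac_srcM hF).
rewrite (fac_cnt hF); have [_ ->] := counit_monoid_morphism hA.
by rewrite phi_counit -scalerA scalerAl.
Qed.

Lemma fac_cnt_bimod X b b' : cnt D (X * s b' * t b) = b * cnt D X * b'.
Proof.
pattern X; apply: (@fac_ext _ _ _ _ _ _ _ _ _ hF B
  (fun X => cnt D (X * s b' * t b)) (fun X => b * cnt D X * b')); try by linC.
move=> a c; rewrite -!mulrA (fac_src_tgt_comm hF) [s c * _]mulrA.
rewrite (fac_src_tgt_comm hF) -mulrA -(fac_srcM hF) mulrA cnt_inclMtgt (fac_cnt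
  hF).
by rewrite -scalerAl -scalerAr mulrA.
Qed.

Let cop_srcr X b : ▲ (X * s b) = ractB (▲ X) b.
Proof.
rewrite -[X * s b]mulr1 -(fac_tgt1 hF) fac_cop_bimod; congr (ractB _ b).
rewrite -[RHS]tsum_pure; apply: eq_tsum => Y Z.
by rewrite (fac_tgt1 hF) mulr1.
Qed.

Let cop_tgtr X b : ▲ (X * t b) = lactB b (▲ X).
Proof.
rewrite -[X in X * t b]mulr1 -(fac_src1 hF) fac_cop_bimod.
rewrite -[RHS]tsum_pure; apply: eq_tsum => Y Z.
by rewrite (fac_src1 hF) mulr1.
Qed.

Lemma fac_cnt_l X : \sw_(X1, X2 <- ▲ X) X2 * t (cnt D X1) = X.
Proof.
pose f (X1 X2 : H) := X2 * t (cnt D X1).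
have bf : bilin f by rewrite /f; linC.
have lf : balanced (fun X b => X * s b) (fun b Y => Y * t b) f.
  move=> Y b Z; rewrite /f -[Y * s b]mulr1 -(fac_tgt1 hF) fac_cnt_bimod mul1r.
  by rewrite (fac_tgtM hF) mulrA.
pattern X; apply: (@fac_ext _ _ _ _ _ _ _ _ _ hF H (fun X => tsum (▲ X) f)).
- exact: (lin_comp (tsum_linear bf lf) cop_lin).
- exact: lin_id.
move=> a b; rewrite (fac_cop hF) (lin_tsum _ _ (tsum_linear bf lf)).
rewrite -{2}(counit_l hA a) (lin_tsum _ _ (f := fun X => i X * s b)); last by lin.
apply: eq_tsum => a1 a2; rewrite tsumE // /f -[i a1]mulr1 -(fac_src1 hF).
rewrite (fac_cnt hF) (lin_scale _ _ t_lin) (fac_tgt1 hF).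
by rewrite (lin_scale _ _ i_lin) -scalerAr mulr1 scalerAl.
Qed.

Lemma fac_cnt_r X : \sw_(X1, X2 <- ▲ X) X1 * s (cnt D X2) = X.
Proof.
pose f (X1 X2 : H) := X1 * s (cnt D X2).
have bf : bilin f by rewrite /f; linC.
have lf : balanced (fun X b => X * s b) (fun b Y => Y * t b) f.
  move=> Y b Z; rewrite /f -[X in X * t b]mulr1 -(fac_src1 hF) fac_cnt_bimod
    mulr1.
  by rewrite (fac_srcM hF) mulrA.
pattern X; apply: (@fac_ext _ _ _ _ _ _ _ _ _ hF H (fun X => tsum (▲ X) f)).
- exact: (lin_comp (tsum_linear bf lf) cop_lin).
- exact: lin_id.
move=> a b; rewrite (fac_cop hF) (lin_tsum _ _ (tsum_linear bf lf)).
rewrite -{2}(counit_r hA a) (lin_tsum _ _ (f := fun X => i X * s b)); last by lin.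
apply: eq_tsum => a1 a2; rewrite tsumE // /f (fac_cnt hF) (lin_scale _ _ s_lin).
by rewrite (lin_scale _ _ i_lin) -scalerAr -scalerAl.
Qed.

(** Before generators can be used, both sides must be seen as balanced functions [f] and [g] of the
    two legs of ▲(X). For [f] this rests on ▲(X s(b)) = ▲(X)·b, for [g] on ▲(X t(b)) = b·▲(X). *)
Lemma fac_cop_coassoc X :
  \sw_(X1, X2 <- ▲ X) \sw_(X11, X12 <- ▲ X1) X11 ⊠ (X12 ⊠ X2 : tensB D)
  = \sw_(X1, X2 <- ▲ X) X1 ⊠ (▲ X2 : tensB D) :> tensBB D.
Proof.
have bal X1 b (v : tensB D) :
    (X1 * s b) ⊠ v = X1 ⊠ lactB b v :> tensBB D by exact: pure_bal.
pose h X2 X11 X12 : tensBB D := X11 ⊠ (X12 ⊠ X2 : tensB D).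
have bh X2 : bilin (h X2) by rewrite /h; lin.
have lh X2 : balanced (fun X b => X * s b) (fun b Y => Y * t b) (h X2).
  by move=> Y b Z; rewrite /h bal lactE.
have hlin X2 := tsum_linear (bh X2) (lh X2).
pose f X1 X2 : tensBB D := tsum (▲ X1) (h X2).
have bf : bilin f.
  split=> ?; rewrite /f; first exact: (lin_comp (hlin _) cop_lin).
  by apply: lin_tsum_in => *; rewrite /h; lin.
have lf : balanced (fun X b => X * s b) (fun b Y => Y * t b) f.
  move=> Y b Z; rewrite /f cop_srcr /ractB (lin_tsum _ _ (hlin Z)).
  by apply: eq_tsum => U V; rewrite tsumE // /h tensB_bal.
pose g X1 X2 : tensBB D := X1 ⊠ ▲ X2.
have bg : bilin g by rewrite /g; lin.
have lg : balanced (fun X b => X * s b) (fun b Y => Y * t b) g.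
  by move=> Y b Z; rewrite /g bal cop_tgtr.
pattern X; apply: (@fac_ext _ _ _ _ _ _ _ _ _ hF (tensBB D)
    (fun X => tsum (▲ X) f) (fun X => tsum (▲ X) g)).
- exact: (lin_comp (tsum_linear bf lf) cop_lin).
- exact: (lin_comp (tsum_linear bg lg) cop_lin).
move=> a b; rewrite (fac_cop hF).
rewrite (lin_tsum _ _ (tsum_linear bf lf)) (lin_tsum _ _ (tsum_linear bg lg)).
transitivity (\sw_(a1, a2 <- Δ a) \sw_(x1, x2 <- Δ a1)
    i x1 ⊠ (i x2 ⊠ (i a2 * s b) : tensB D) : tensBB D).
  apply: eq_tsum => a1 a2;
    rewrite tsumE // /f fac_cop_incl (lin_tsum _ _ (hlin _)).
  by apply: eq_tsum => x1 x2; rewrite tsumE.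
rewrite (@comul_coassoc_tri _ _ (tensBB D) (fun x1 x2 a2 =>
  i x1 ⊠ (i x2 ⊠ (i a2 * s b) : tensB D) : tensBB D)); last by lin.
apply: eq_tsum => a1 a2; rewrite tsumE // /g (fac_cop hF).
by rewrite (lin_tsum _ _ (f := fun v : tensB D => i a1 ⊠ v : tensBB D)) //; lin.
Qed.

Let cnt_gen_mul a b Y : cnt D (i a * s b * Y) = counit A a *: cnt D (s b * Y).
Proof.
pattern Y; apply: (@fac_ext _ _ _ _ _ _ _ _ _ hF B
  (fun Y => cnt D (i a * s b * Y)) (fun Y => counit A a *: cnt D (s b * Y))).
- by linC.
- by apply: lin_scaler; linC.
move=> a' b'; rewrite -mulrA [s b * _]mulrA (fac_srcMincl hF).
rewrite (lin_tsum _ _ (f := fun X => cnt D (i a * (X * s b')))); last by linC.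
rewrite (lin_tsum _ _ (f := fun X => counit A a *: cnt D (X * s b'))); last first.
  by apply: lin_scaler; linC.
apply: eq_tsum => x y.
rewrite -[i x * _ * _]mulrA -(fac_srcM hF) mulrA -(fac_inclM hF) !(fac_cnt hF).
by have [_ ->] := counit_monoid_morphism hA; rewrite scalerA.
Qed.

(** On a generator i(a)s(c) the two sides are ε(a_2)(b ◁ a_1)c and ε(a_1)(b ◁ a_2)c. This reduces
    the counit axiom for t to the one for s. *)
Let cnt_tgt_mul b Y : cnt D (t b * Y) = cnt D (s b * Y).
Proof.
pattern Y; apply: (@fac_ext _ _ _ _ _ _ _ _ _ hF B
  (fun Y => cnt D (t b * Y)) (fun Y => cnt D (s b * Y))); try by linC.
move=> a' b'; rewrite !mulrA (fac_srcMincl hF) (fac_tgtMincl hF).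
rewrite (lin_tsum _ _ (f := fun X => cnt D (X * s b'))); last by linC.
rewrite (lin_tsum _ _ (f := fun X => cnt D (X * s b'))); last by linC.
have hl : linear (fun a => (b <| a) * b') by lin.
transitivity ((b <| a') * b');
  [rewrite -(tsum_counit_r a' hl)|rewrite -(tsum_counit_l a' hl)];
    apply: eq_tsum => x y.
  by rewrite cnt_inclMtgt.
by rewrite -mulrA -(fac_srcM hF) (fac_cnt hF).
Qed.

Lemma fac_cntM_src X Y : cnt D (s (cnt D X) * Y) = cnt D (X * Y).
Proof.
pattern X; apply: (@fac_ext _ _ _ _ _ _ _ _ _ hF B
  (fun X => cnt D (s (cnt D X) * Y)) (fun X => cnt D (X * Y))); try by linC.
move=> a b; rewrite (fac_cnt hF) cnt_gen_mul (lin_scale _ _ s_lin) -scalerAl.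
exact: lin_scale.
Qed.

Lemma fac_right_bialgebroid : is_right_bialgebroid D.
Proof.
split.
- exact: s_lin.
- by split=> [|x y]; [exact: (fac_src1 hF) | exact: (fac_srcM hF)].
- exact: t_lin.
- by split=> [|x y]; [exact: (fac_tgt1 hF) | exact: (fac_tgtM hF)].
- exact: fac_src_tgt_comm hF.
- exact: cop_lin.
- exact: cnt_lin.
- exact: fac_cop_bimod.
- exact: fac_cnt_bimod.
- exact: fac_cop_coassoc.
- exact: fac_cnt_l.
- exact: fac_cnt_r.
- exact: fac_cop_takeuchi.
- have := fac_cop_src 1; by rewrite (fac_src1 hF).
- exact: fac_copM.
- rewrite -[1 in LHS]mulr1 -{1}(fac_incl1 hF) -(fac_src1 hF) (fac_cnt hF).
  by have [-> _] := counit_monoid_morphism hA; rewrite scale1r.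
- exact: fac_cntM_src.
- by move=> X Y; rewrite cnt_tgt_mul fac_cntM_src.
Qed.

(** * The canonical map λ *)

Let canon_lmul X Y : \sw_(Y1, Y2 <- ▲ Y) (X * Y1) ⊠ Y2 = tensB_lmul X 1 (▲ Y).
Proof. by apply: eq_tsum => Y1 Y2; rewrite mul1r. Qed.

Let canon_bilin : bilin (fun X Y => \sw_(Y1, Y2 <- ▲ Y) (X * Y1) ⊠ Y2 : tensB D).
Proof.
split=> [Y|X]; first by lin.
move=> a Y Z; rewrite !canon_lmul.
exact: (lin_comp (tensB_lmul_linear X 1) cop_lin).
Qed.

Let canon_balanced : balanced (fun X b => X * t b) (fun b Y => t b * Y)
  (fun X Y => \sw_(Y1, Y2 <- ▲ Y) (X * Y1) ⊠ Y2 : tensB D).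
Proof. by move=> X b Y; rewrite !canon_lmul fac_copMtgt -tensB_lmulA mulr1. Qed.

Let canon_lin : linear (@canon_map k B H D).
Proof. exact: tsum_linear canon_bilin canon_balanced. Qed.

Lemma fac_canonE X Y :
  canon_map (X ⊠ Y : tensBop D) = tensB_lmul X 1 (▲ Y).
Proof. by rewrite /canon_map (tsumE _ _ canon_bilin canon_balanced) canon_lmul.
  Qed.

Let bop_bal X b Y : (X * t b) ⊠ Y = X ⊠ (t b * Y) :> tensBop D.
Proof. exact: pure_bal. Qed.

Lemma fac_canon_gen a b : canon_map
    (\sw_(a1, a2 <- Δ a) i (SA a1) ⊠ (i a2 * s b) : tensBop D)
  = 1 ⊠ (i a * s b).
Proof.
rewrite (lin_tsum _ _ canon_lin).
transitivity (\sw_(a1, a2 <- Δ a) \sw_(x1, x2 <- Δ a2)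
    i (SA a1 * x1) ⊠ (i x2 * s b) : tensB D).
  apply: eq_tsum => a1 a2; rewrite fac_canonE (fac_cop hF).
  rewrite (lin_tsum _ _ (tensB_lmul_linear _ _)); apply: eq_tsum => x1 x2.
  by rewrite tensB_lmulE (fac_inclM hF) mul1r.
rewrite (collapse_l_r SlA (f := fun u x => i u ⊠ (i x * s b) : tensB D));
  try by lin.
by rewrite (fac_incl1 hF).
Qed.

(** Here [g] is to be Y ↦ λ^-1(1 ⊗ Y) and [L X] multiplies the first factor by X, so the inverse has
    to be X ⊗ Y ↦ [L X (g Y)]. Both maps commute with this multiplication, which reduces the two
    composites to [canon_g] and [invcop]. *)
Lemma fac_canon_bij : bijective (@canon_map k B H D).
Proof.
pose F a b : tensBop D := \sw_(a1, a2 <- Δ a) i (SA a1) ⊠ (i a2 * s b).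
have [|g glin gE] := fac_rec hF (F := F); first by rewrite /F; lin.
pose L X (v : tensBop D) : tensBop D := \sw_(U, V <- v) (X * U) ⊠ V.
have bL X : bilin (fun U V => (X * U) ⊠ V : tensBop D) by lin.
have lL X : balanced (fun X b => X * t b) (fun b Y => t b * Y)
    (fun U V => (X * U) ⊠ V : tensBop D).
  by move=> U b V; rewrite mulrA bop_bal.
have Llin X : linear (L X) by apply: tsum_linear (bL X) (lL X).
have LlinX v : linear (L^~ v) by apply: lin_tsum_in => *; lin.
have LE X U V : L X (U ⊠ V) = (X * U) ⊠ V by exact: tsumE (bL X) (lL X).
have LM X Y v : L (X * Y) v = L X (L Y v).
  rewrite [L Y v]/L (lin_tsum _ _ (Llin X)); apply: eq_tsum => U V.
  by rewrite LE mulrA.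
(* This is what makes the inverse balanced over B. Write s(b) as i(S(φ(b_1)))t(b_2), move t(b_2)
   behind i(S(a_1)), and let the resulting t(b_2 ◁ S(a_2)) cross the tensor sign; with i(a_3) it
   recombines to i(a_2)t(b_2). Expanding t(b_2) once more exhibits the coproduct of aφ(b_1), on
   which [g] is known. *)
have gtgt b Y : L (s b) (g Y) = g (Y * t b).
  pattern Y; apply: (@fac_ext _ _ _ _ _ _ _ _ _ hF (tensBop D)
    (fun Y => L (s b) (g Y)) (fun Y => g (Y * t b))).
  - exact: (lin_comp (Llin _) glin).
  - by apply: (lin_comp glin); lin.
  move=> a c; rewrite gE /F (lin_tsum _ _ (Llin _)).
  transitivity (\sw_(a1, a2 <- Δ a) \sw_(b1, b2 <- ΔB b)
      (i (SA (phi b1)) * (t b2 * i (SA a1))) ⊠ (i a2 * s c) : tensBop D).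
    apply: eq_tsum => a1 a2; rewrite LE -antipode_phi_tgt.
    rewrite (lin_tsum _ _ (f := fun X => (X * i (SA a1)) ⊠ (i a2 * s c) :
      tensBop D)); last by lin.
    by apply: eq_tsum => b1 b2; rewrite mulrA.
  transitivity (\sw_(b1, b2 <- ΔB b) \sw_(a1, a2 <- Δ a)
      (i (SA (phi b1)) * i (SA a1)) ⊠ (i a2 * (t b2 * s c)) : tensBop D).
    rewrite tsum_exchange; apply: eq_tsum => b1 b2.
    transitivity (\sw_(a1, a2 <- Δ a) \sw_(x1, x2 <- Δ a1)
        (i (SA (phi b1)) * i (SA x1) * t (b2 <| SA x2)) ⊠ (i a2 * s c) : tensBop
          D).
      apply: eq_tsum => a1 a2; rewrite fac_tgtMincl_antipode.
      rewrite (lin_tsum _ _ (f := fun X => (i (SA (phi b1)) * X) ⊠ (i a2 * s c)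
        : tensBop D)); last by lin.
      by apply: eq_tsum => x1 x2; rewrite mulrA.
    rewrite (@comul_coassoc_tri _ _ (tensBop D) (fun x1 x2 a2 =>
      (i (SA (phi b1)) * i (SA x1) * t (b2 <| SA x2)) ⊠ (i a2 * s c) : tensBop
        D)); last by lin.
    apply: eq_tsum => a1 a2; rewrite [i a2 * _]mulrA fac_inclMtgt.
    rewrite (lin_tsum _ _ (f := fun X => (i (SA (phi b1)) * i (SA a1)) ⊠ (X * s
      c) : tensBop D)); last by lin.
    by apply: eq_tsum => x1 x2; rewrite bop_bal mulrA.
  transitivity (\sw_(b1, b2 <- ΔB b) \sw_(x1, x2 <- ΔB b2) \sw_(a1, a2 <- Δ a)
      (i (SA (a1 * phi b1))) ⊠ (i (a2 * phi x1) * s (x2 * c)) : tensBop D).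
    apply: eq_tsum => b1 b2; rewrite tsum_exchange; apply: eq_tsum => a1 a2.
    rewrite (fac_tgtE hF) (lin_tsum _ _ (f := fun X => (i (SA (phi b1)) * i (SA
      a1)) ⊠ (i a2 * (X * s c)) : tensBop D)); last by lin.
    apply: eq_tsum => x1 x2.
    by rewrite hopf_antipodeM !(fac_inclM hF) (fac_srcM hF) !mulrA.
  rewrite -(@comul_coassoc_tri _ _ (tensBop D) (fun b1 x1 x2 => \sw_(a1, a2 <- Δ
    a)
    (i (SA (a1 * phi b1))) ⊠ (i (a2 * phi x1) * s (x2 * c)) : tensBop D));
      last by lin.
  rewrite -mulrA (fac_src_tgt_comm hF) (fac_tgtE hF).
  rewrite (lin_tsum _ _ (f := fun X => g (i a * (X * s c)))); last first.
    by apply: (lin_comp glin); lin.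
  apply: eq_tsum => b1 b2.
  rewrite mulrA mulrA -(fac_inclM hF) -mulrA -(fac_srcM hF) gE /F (comulM hA).
  rewrite (tsum_tsum (M := tensBop D)); last by lin.
  rewrite tsum_exchange; apply: eq_tsum => a1 a2.
  rewrite (tsum_tsum (M := tensBop D)); last by lin.
  rewrite phi_comul (tsum_tsum (M := tensBop D)); last first.
    by split=> *; apply: lin_tsum_arg; lin.
  by apply: eq_tsum => x1 x2; rewrite !(tsum_tensE (M := tensBop D)) //; lin.
pose G X Y := L X (g Y).
have bG : bilin G.
  by split=> ?; [apply: LlinX | apply: (lin_comp (Llin _) glin)].
have lG : balanced (fun X b => X * s b) (fun b Y => Y * t b) G.
  by move=> X b Y; rewrite /G LM gtgt.
pose inv (v : tensB D) : tensBop D := tsum v G.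
have invlin : linear inv := tsum_linear bG lG.
have invE X Y : inv (X ⊠ Y) = L X (g Y) by exact: tsumE bG lG.
have inv_lmul X v : inv (tensB_lmul X 1 v) = L X (inv v).
  rewrite /tensB_lmul (lin_tsum _ _ invlin) [inv v]/inv (lin_tsum _ _ (Llin X)).
  by apply: eq_tsum => U V; rewrite invE mul1r LM.
have invcop Y : inv (▲ Y) = 1 ⊠ Y.
  pattern Y; apply: (@fac_ext _ _ _ _ _ _ _ _ _ hF (tensBop D)
    (fun Y => inv (▲ Y)) (fun Y => 1 ⊠ Y)); [exact: lin_comp|by lin|].
  move=> a b; rewrite (fac_cop hF) (lin_tsum _ _ invlin).
  transitivity (\sw_(a1, a2 <- Δ a) \sw_(x1, x2 <- Δ a2)
      i (a1 * SA x1) ⊠ (i x2 * s b) : tensBop D).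
    apply: eq_tsum => a1 a2; rewrite invE gE /F (lin_tsum _ _ (Llin _)).
    by apply: eq_tsum => x1 x2; rewrite LE (fac_inclM hF).
  rewrite (collapse_l_r SrA (f := fun u x => i u ⊠ (i x * s b) : tensBop D));
    try by lin.
  by rewrite (fac_incl1 hF).
have canon_g Y : canon_map (g Y) = 1 ⊠ Y.
  pattern Y; apply: (@fac_ext _ _ _ _ _ _ _ _ _ hF (tensB D)
    (fun Y => canon_map (g Y)) (fun Y => 1 ⊠ Y)); [exact: lin_comp|by lin|].
  by move=> a b; rewrite gE fac_canon_gen.
have canonL X v : canon_map (L X v) = tensB_lmul X 1 (canon_map v).
  rewrite [in RHS]/canon_map [in LHS]/L (lin_tsum _ _ canon_lin).
  rewrite (lin_tsum _ _ (tensB_lmul_linear X 1)); apply: eq_tsum => U V.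
  by rewrite fac_canonE canon_lmul -tensB_lmulA mulr1.
exists inv.
- apply: (@lin_ext _ _ _ (tensBop D) _ _ _ (fun u => inv (canon_map u)) (fun u
  => u)).
  + exact: lin_comp.
  + exact: lin_id.
  by move=> X Y; rewrite fac_canonE inv_lmul invcop LE mulr1.
- apply: (@lin_ext _ _ _ (tensB D) _ _ _ (fun u => canon_map (inv u)) (fun u =>
  u)).
  + exact: lin_comp.
  + exact: lin_id.
  by move=> X Y; rewrite invE canonL canon_g tensB_lmulE mulr1 mul1r.
Qed.

(** * The anti-canonical map μ *)

Let anticanon_lmul X Y : \sw_(X1, X2 <- ▲ X) X1 ⊠ (Y * X2) = tensB_lmul 1 Y (▲ X).
Proof. by apply: eq_tsum => X1 X2; rewrite mul1r. Qed.

Let anticanon_bilin : bilin (fun X Y => \sw_(X1, X2 <- ▲ X) X1 ⊠ (Y * X2) :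
  tensB D).
Proof.
split=> [Y|X]; last by lin.
move=> a X Z; rewrite !anticanon_lmul.
exact: (lin_comp (tensB_lmul_linear 1 Y) cop_lin).
Qed.

Let anticanon_balanced : balanced (fun X b => s b * X) (fun b Y => Y * s b)
  (fun X Y => \sw_(X1, X2 <- ▲ X) X1 ⊠ (Y * X2) : tensB D).
Proof. by move=> X b Y;
  rewrite !anticanon_lmul fac_copMsrc -tensB_lmulA mulr1. Qed.

Let anticanon_lin : linear (@anticanon_map k B H D).
Proof. exact: tsum_linear anticanon_bilin anticanon_balanced. Qed.

Lemma fac_anticanonE X Y :
  anticanon_map (X ⊠ Y : tensBop' D) = tensB_lmul 1 Y (▲ X).
Proof.
by rewrite /anticanon_map (tsumE _ _ anticanon_bilin anticanon_balanced)
  anticanon_lmul.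
Qed.

Let bop'_bal X b Y : (s b * X) ⊠ Y = X ⊠ (Y * s b) :> tensBop' D.
Proof. exact: pure_bal. Qed.

Let TlA a : \sw_(x, y <- Δ a) T y * x = counit A a *: 1 := antipode_inv_l SK TK a.
Let TrA a : \sw_(x, y <- Δ a) y * T x = counit A a *: 1 := antipode_inv_r SK TK a.

(** Cancelling S^-1(a_3)a_2 leaves i(a) ⊗ t(b), and t(b) crosses ⊗_B as s(b); hence the factor t(b)
    in the formula. *)
Lemma fac_anticanon_gen a b : anticanon_map
    (\sw_(a1, a2 <- Δ a) i a1 ⊠ (t b * i (T a2)) : tensBop' D)
  = (i a * s b) ⊠ 1.
Proof.
rewrite (lin_tsum _ _ anticanon_lin).
transitivity (\sw_(a1, a2 <- Δ a) \sw_(x1, x2 <- Δ a1)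
    i x1 ⊠ (t b * i (T a2 * x2)) : tensB D).
  apply: eq_tsum => a1 a2; rewrite fac_anticanonE fac_cop_incl.
  rewrite (lin_tsum _ _ (tensB_lmul_linear _ _)); apply: eq_tsum => x1 x2.
  by rewrite tensB_lmulE (fac_inclM hF) mul1r mulrA.
rewrite (collapse_r_l (m := fun x y => T y * x) TlA (f := fun x u => i x ⊠ (t b
  * i u) : tensB D)); try by lin.
by rewrite (fac_incl1 hF) tensB_bal mulr1 mul1r.
Qed.

(** The scheme is that of [fac_canon_bij] with multiplication on the second factor. The balance
    [gsrc] only uses that t reverses products; the relations between s and i(A) are needed in
    [invcop]. *)
Lemma fac_anticanon_bij : bijective (@anticanon_map k B H D).
Proof.
pose F a b : tensBop' D := \sw_(a1, a2 <- Δ a) i a1 ⊠ (t b * i (T a2)).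
have [|g glin gE] := fac_rec hF (F := F); first by rewrite /F; lin.
pose L Y (v : tensBop' D) : tensBop' D := \sw_(U, V <- v) U ⊠ (Y * V).
have bL Y : bilin (fun U V => U ⊠ (Y * V) : tensBop' D) by lin.
have lL Y : balanced (fun X b => s b * X) (fun b Y => Y * s b)
    (fun U V => U ⊠ (Y * V) : tensBop' D).
  by move=> U b V; rewrite mulrA bop'_bal.
have Llin Y : linear (L Y) by apply: tsum_linear (bL Y) (lL Y).
have LlinX v : linear (L^~ v) by apply: lin_tsum_in => *; lin.
have LE Y U V : L Y (U ⊠ V) = U ⊠ (Y * V) by exact: tsumE (bL Y) (lL Y).
have LM X Y v : L (X * Y) v = L X (L Y v).
  rewrite [L Y v]/L (lin_tsum _ _ (Llin X)); apply: eq_tsum => U V.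
  by rewrite LE mulrA.
have gsrc b X : L (t b) (g X) = g (X * s b).
  pattern X; apply: (@fac_ext _ _ _ _ _ _ _ _ _ hF (tensBop' D)
    (fun X => L (t b) (g X)) (fun X => g (X * s b))).
  - exact: (lin_comp (Llin _) glin).
  - by apply: (lin_comp glin); lin.
  move=> a c; rewrite -mulrA -(fac_srcM hF) !gE /F (lin_tsum _ _ (Llin _)).
  by apply: eq_tsum => a1 a2; rewrite LE (fac_tgtM hF) mulrA.
pose G X Y := L Y (g X).
have bG : bilin G.
  by split=> ?; [apply: (lin_comp (Llin _) glin) | apply: LlinX].
have lG : balanced (fun X b => X * s b) (fun b Y => Y * t b) G.
  by move=> X b Y; rewrite /G LM gsrc.
pose inv (v : tensB D) : tensBop' D := tsum v G.
have invlin : linear inv := tsum_linear bG lG.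
have invE X Y : inv (X ⊠ Y) = L Y (g X) by exact: tsumE bG lG.
have inv_lmul Y v : inv (tensB_lmul 1 Y v) = L Y (inv v).
  rewrite /tensB_lmul (lin_tsum _ _ invlin) [inv v]/inv (lin_tsum _ _ (Llin Y)).
  by apply: eq_tsum => U V; rewrite invE mul1r LM.
(* The second factor is i(a_3)s(b)i(S^-1(a_2)). Moving s(b) to the right end turns it into
   i(a_4S^-1(a_3))s(b ◁ S^-1(a_2)), which collapses; the remaining s crosses to the left of i(a_1),
   and [fac_inclMsrc_comm] recovers i(a)s(b). *)
have invcop X : inv (▲ X) = X ⊠ 1.
  pattern X; apply: (@fac_ext _ _ _ _ _ _ _ _ _ hF (tensBop' D)
    (fun X => inv (▲ X)) (fun X => X ⊠ 1)); [exact: lin_comp|by lin|].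
  move=> a b; rewrite (fac_cop hF) (lin_tsum _ _ invlin).
  transitivity (\sw_(a1, a2 <- Δ a) \sw_(x1, x2 <- Δ a1) \sw_(y1, y2 <- Δ x2)
      i x1 ⊠ (i (a2 * T y2) * s (b <| T y1)) : tensBop' D).
    apply: eq_tsum => a1 a2; rewrite invE -[i a1]mulr1 -(fac_src1 hF) gE /F.
    rewrite (lin_tsum _ _ (Llin _)); apply: eq_tsum => x1 x2.
    rewrite LE (fac_tgt1 hF) mul1r -mulrA fac_srcMincl_antipode_inv.
    rewrite (lin_tsum _ _ (f := fun X => i x1 ⊠ (i a2 * X) : tensBop' D));
      last by lin.
    by apply: eq_tsum => y1 y2; rewrite mulrA -(fac_inclM hF).
  rewrite (@comul_coassoc_tri _ _ (tensBop' D) (fun x1 x2 a2 => \sw_(y1, y2 <- Δ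
    x2)
      i x1 ⊠ (i (a2 * T y2) * s (b <| T y1)) : tensBop' D)); last by lin.
  rewrite fac_inclMsrc_comm (lin_tsum _ _ (f := fun X => X ⊠ 1 : tensBop' D));
    last by lin.
  apply: eq_tsum => x1 z.
  rewrite (collapse_r_l (m := fun x y => y * T x) TrA (f := fun x u => i x1 ⊠ (i
    u * s (b <| T x)) : tensBop' D)); try by lin.
  by rewrite bop'_bal (fac_incl1 hF).
have anticanon_g X : anticanon_map (g X) = X ⊠ 1.
  pattern X; apply: (@fac_ext _ _ _ _ _ _ _ _ _ hF (tensB D)
    (fun X => anticanon_map (g X)) (fun X => X ⊠ 1)); [exact: lin_comp|by lin|].
  by move=> a b; rewrite gE fac_anticanon_gen.
have anticanonL Y v : anticanon_map (L Y v) = tensB_lmul 1 Y (anticanon_map v).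
  rewrite [in RHS]/anticanon_map [in LHS]/L (lin_tsum _ _ anticanon_lin).
  rewrite (lin_tsum _ _ (tensB_lmul_linear 1 Y)); apply: eq_tsum => U V.
  by rewrite fac_anticanonE anticanon_lmul -tensB_lmulA mulr1.
exists inv.
- apply: (@lin_ext _ _ _ (tensBop' D) _ _ _ (fun u => inv (anticanon_map u))
  (fun u => u)).
  + exact: lin_comp.
  + exact: lin_id.
  by move=> X Y; rewrite fac_anticanonE inv_lmul invcop LE mulr1.
- apply: (@lin_ext _ _ _ (tensB D) _ _ _ (fun u => anticanon_map (inv u)) (fun u
  => u)).
  + exact: lin_comp.
  + exact: lin_id.
  by move=> X Y; rewrite invE anticanonL anticanon_g tensB_lmulE mulr1 mul1r.
Qed.

(** * The antipode of the full Hopf algebroid *)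

Section FullAntipode.
Variable S : H -> H.
Hypothesis SA2 : forall a, SA (SA a) = a.
Hypothesis S_lin : linear S.
Hypothesis SE : forall a b, S (i a * s b) = t b * i (SA a).
Hypothesis S_tgt : forall b, S (t b) = s b.

Let TE a : T a = SA a. Proof. by rewrite -{1}[a]SA2 SK. Qed.

Let SAl a : \sw_(x, y <- Δ a) SA y * x = counit A a *: 1.
Proof. by rewrite -TlA; apply: eq_tsum => x y; rewrite TE. Qed.

Let SAr a : \sw_(x, y <- Δ a) y * SA x = counit A a *: 1.
Proof. by rewrite -TrA; apply: eq_tsum => x y; rewrite TE. Qed.

Let S_incl a : S (i a) = i (SA a).
Proof. by rewrite -[i a]mulr1 -(fac_src1 hF) SE (fac_tgt1 hF) mul1r. Qed.

Let S_src b : S (s b) = t b.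
Proof.
by rewrite -[s b]mul1r -(fac_incl1 hF) SE hopf_antipode1 (fac_incl1 hF) mulr1.
Qed.

(** On generators the claim is that S carries s(b)i(a) = i(a_1)s(b ◁ a_2) to i(S(a))t(b) = t(b ◁
    a_2)i(S(a_1)), and this is [fac_incl_antipode_invMtgt] with S^-1 = S on A. *)
Let SM X Y : S (X * Y) = S Y * S X.
Proof.
pattern X; apply: (@fac_ext _ _ _ _ _ _ _ _ _ hF H
  (fun X => S (X * Y)) (fun X => S Y * S X)).
- by apply: (lin_comp S_lin); lin.
- exact: lin_mul_r.
move=> a b; pattern Y; apply: (@fac_ext _ _ _ _ _ _ _ _ _ hF H
  (fun Y => S (i a * s b * Y)) (fun Y => S Y * S (i a * s b))).
- by apply: (lin_comp S_lin); lin.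
- exact: lin_mul_l.
move=> a' b'; rewrite !SE -mulrA [s b * _]mulrA (fac_srcMincl hF).
rewrite (lin_tsum _ _ (f := fun X => S (i a * (X * s b')))); last first.
  by apply: (lin_comp S_lin); lin.
rewrite -mulrA [i _ * (t b * _)]mulrA -[SA a']TE fac_incl_antipode_invMtgt.
rewrite (lin_tsum _ _ (f := fun X => t b' * (X * i (SA a)))); last by lin.
apply: eq_tsum => x y.
rewrite -[i x * _ * _]mulrA -(fac_srcM hF) mulrA -(fac_inclM hF) SE.
by rewrite (fac_tgtM hF) hopf_antipodeM (fac_inclM hF) TE !mulrA.
Qed.

(** Besides S_A^2 = id this uses S(t(b)) = s(b). It identifies any inverse of S with S itself in the
    axiom that involves S^-1. *)
Let SS X : S (S X) = X.
Proof.
pattern X; apply: (@fac_ext _ _ _ _ _ _ _ _ _ hF H (fun X => S (S X))).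
- exact: (lin_comp S_lin S_lin).
- exact: lin_id.
by move=> a b; rewrite SE SM S_incl S_tgt SA2.
Qed.

(* Insert S(a_4)a_3 = ε in the second factor; then ▲ is applied to a_2S(a_1) = ε. *)
Let cop_antipode_inv a :
  \sw_(a1, a2 <- Δ a) tensB_lmul (i a2) 1 (▲ (i (SA a1))) = 1 ⊠ i (SA a).
Proof.
pose K a1 x1 u := tensB_lmul (i x1) (i u) (▲ (i (SA a1))).
have K_lin1 x1 u : linear (fun a1 => K a1 x1 u).
  by apply: (lin_comp (tensB_lmul_linear _ _)); lin.
have K_lin2 a1 u : linear (fun x1 => K a1 x1 u).
  exact: (lin_comp (f := fun Z => tensB_lmul Z _ _) (proj1 (tensB_lmul_bilin _)
    _) i_lin).
have K_lin3 a1 x1 : linear (K a1 x1).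
  exact: (lin_comp (proj2 (tensB_lmul_bilin _) _) i_lin).
transitivity (\sw_(a1, w <- Δ a) \sw_(a2, a3 <- Δ w) \sw_(x1, x2 <- Δ a2)
    K a1 x1 (SA a3 * x2)).
  apply: eq_tsum => a1 w.
  rewrite (collapse_r_l (m := fun x y => SA y * x) SAl (f := K a1)); try by lin.
  by rewrite /K (fac_incl1 hF).
rewrite -(@comul_coassoc_tri _ _ (tensB D) (fun a1 a2 a3 =>
  \sw_(x1, x2 <- Δ a2) K a1 x1 (SA a3 * x2))); last first.
  split=> *.
  - by apply: lin_tsum_in => *; apply: K_lin1.
  - apply: lin_tsum_arg; [by lin| |by lin].
    by split=> ?; [apply: K_lin2 | apply: (lin_comp (K_lin3 _ _)); lin].
  - by apply: lin_tsum_in => *; apply: (lin_comp (K_lin3 _ _)); lin.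
have hl : linear (fun x => 1 ⊠ i (SA x) : tensB D) by lin.
rewrite -[RHS](tsum_counit_l a hl); apply: eq_tsum => z a3.
transitivity (\sw_(a1, a2 <- Δ z) tensB_lmul 1 (i (SA a3)) (▲ (i (a2 * SA a1)))).
  apply: eq_tsum => a1 a2; rewrite (fac_inclM hF) fac_copMincl.
  rewrite (lin_tsum _ _ (tensB_lmul_linear _ _)); apply: eq_tsum => x1 x2.
  by rewrite -tensB_lmulA mul1r -(fac_inclM hF).
rewrite -(lin_tsum _ _ (f := fun x => tensB_lmul 1 (i (SA a3)) (▲ (i x))));
  last first.
  by apply: (lin_comp (tensB_lmul_linear _ _)); lin.
rewrite SAr (lin_scale _ _ i_lin) (lin_scale _ _ cop_lin).
rewrite (lin_scale _ _ (tensB_lmul_linear _ _)) (fac_incl1 hF) -(fac_src1 hF).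
by rewrite fac_cop_src tensB_lmulE (fac_src1 hF) !mulr1.
Qed.

(** The mirror image of [cop_antipode_inv]: insert S(a_1)a_2 = ε in the first factor; then ▲ is
    applied to a_2S(a_3) = ε. *)
Let cop_antipode a :
  \sw_(a1, a2 <- Δ a) tensB_lmul 1 (i a1) (▲ (i (SA a2))) = i (SA a) ⊠ 1.
Proof.
pose K u x2 a3 := tensB_lmul (i u) (i x2) (▲ (i (SA a3))).
have K_lin3 u x2 : linear (K u x2).
  by apply: (lin_comp (tensB_lmul_linear _ _)); lin.
have K_lin1 x2 a3 : linear (fun u => K u x2 a3).
  exact: (lin_comp (f := fun Z => tensB_lmul Z _ _) (proj1 (tensB_lmul_bilin _)
    _) i_lin).
have K_lin2 u a3 : linear (fun x2 => K u x2 a3).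
  exact: (lin_comp (proj2 (tensB_lmul_bilin _) _) i_lin).
transitivity (\sw_(w, a3 <- Δ a) \sw_(a1, a2 <- Δ w) \sw_(x1, x2 <- Δ a2)
    K (SA a1 * x1) x2 a3).
  apply: eq_tsum => w a3.
  rewrite (collapse_l_r SlA (f := fun u x2 => K u x2 a3)); try by lin.
  by rewrite /K (fac_incl1 hF).
rewrite (@comul_coassoc_tri _ _ (tensB D) (fun a1 a2 a3 =>
  \sw_(x1, x2 <- Δ a2) K (SA a1 * x1) x2 a3)); last first.
  split=> *.
  - by apply: lin_tsum_in => *;
    apply: (lin_comp (f := fun u => K u _ _) (K_lin1 _ _)); lin.
  - apply: lin_tsum_arg; [by lin| |by lin].
    by split=> ?; [apply: (lin_comp (f := fun u => K u _ _) (K_lin1 _ _));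
      lin | apply: K_lin2].
  - by apply: lin_tsum_in => *; apply: K_lin3.
have hl : linear (fun x => i (SA x) ⊠ 1 : tensB D) by lin.
rewrite -[RHS](tsum_counit_r a hl); apply: eq_tsum => a1 z.
transitivity (\sw_(a2, a3 <- Δ z) tensB_lmul (i (SA a1)) 1 (▲ (i (a2 * SA a3)))).
  apply: eq_tsum => a2 a3; rewrite (fac_inclM hF) fac_copMincl.
  rewrite (lin_tsum _ _ (tensB_lmul_linear _ _)); apply: eq_tsum => x1 x2.
  by rewrite -tensB_lmulA mul1r -(fac_inclM hF).
rewrite -(lin_tsum _ _ (f := fun x => tensB_lmul (i (SA a1)) 1 (▲ (i x))));
  last first.
  by apply: (lin_comp (tensB_lmul_linear _ _)); lin.
rewrite SrA (lin_scale _ _ i_lin) (lin_scale _ _ cop_lin).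
rewrite (lin_scale _ _ (tensB_lmul_linear _ _)) (fac_incl1 hF) -(fac_src1 hF).
by rewrite fac_cop_src tensB_lmulE (fac_src1 hF) !mulr1.
Qed.

Lemma fac_full_antipode : is_full_antipode D S.
Proof.
split.
- exact: S_lin.
- split=> [|x y]; last exact: SM.
  have S1 : S 1 = 1 by rewrite -(fac_incl1 hF) S_incl hopf_antipode1.
  exact: S1.
- by exists S.
- exact: S_tgt.
- move=> Sinv SinvK _ X.
  have SinvE Y : Sinv Y = S Y by rewrite -{1}[Y]SS SinvK.
  pose f X1 X2 := tensB_lmul X2 1 (▲ (S X1)).
  transitivity (tsum (▲ X) f).
    apply: eq_tsum => X1 X2; rewrite SinvE.
    by apply: eq_tsum => Z1 Z2; rewrite mul1r.
  have bf : bilin f.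
    split=> ?; last exact: (proj1 (tensB_lmul_bilin _) _).
    exact: (lin_comp (tensB_lmul_linear _ _) (lin_comp cop_lin S_lin)).
  have lf : balanced (fun X b => X * s b) (fun b Y => Y * t b) f.
    by move=> Y b Z; rewrite /f SM S_src fac_copMtgt -tensB_lmulA mulr1.
  rewrite SinvE; pattern X; apply: (@fac_ext _ _ _ _ _ _ _ _ _ hF (tensB D)
    (fun X => tsum (▲ X) f) (fun X => 1 ⊠ S X)).
  + exact: (lin_comp (tsum_linear bf lf) cop_lin).
  + by apply: lin_pure_r S_lin.
  move=> a b; rewrite (fac_cop hF) (lin_tsum _ _ (tsum_linear bf lf)).
  (* The factor s(b) of X_2 = i(a_2)s(b) acts on the first leg of ▲(S(i(a_1))); by the Takeuchi
     condition it may act as t(b) on the second leg instead, where t(b)i(S(a)) = S(i(a)s(b)) is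
     wanted. *)
  transitivity (tensB_lmul 1 (t b)
      (\sw_(a1, a2 <- Δ a) tensB_lmul (i a2) 1 (▲ (i (SA a1))))).
    rewrite (lin_tsum _ _ (tensB_lmul_linear _ _)); apply: eq_tsum => a1 a2.
    rewrite tsumE // /f -[1 in LHS]mulr1 tensB_lmulA.
    have /takeuchiE -> := fac_cop_takeuchi (S (i a1)).
    by rewrite S_incl -!tensB_lmulA !mulr1 !mul1r.
  by rewrite cop_antipode_inv tensB_lmulE mulr1 SE.
- move=> X.
  pose f X1 X2 := tensB_lmul 1 X1 (▲ (S X2)).
  transitivity (tsum (▲ X) f).
    by apply: eq_tsum => X1 X2; apply: eq_tsum => Z1 Z2; rewrite mul1r.
  have bf : bilin f.
    split=> ?; first exact: (proj2 (tensB_lmul_bilin _) _).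
    exact: (lin_comp (tensB_lmul_linear _ _) (lin_comp cop_lin S_lin)).
  have lf : balanced (fun X b => X * s b) (fun b Y => Y * t b) f.
    by move=> Y b Z; rewrite /f SM S_tgt fac_copMsrc -tensB_lmulA mulr1.
  pattern X; apply: (@fac_ext _ _ _ _ _ _ _ _ _ hF (tensB D)
    (fun X => tsum (▲ X) f) (fun X => S X ⊠ 1)).
  + exact: (lin_comp (tsum_linear bf lf) cop_lin).
  + by apply: lin_pure_l S_lin.
  move=> a b; rewrite (fac_cop hF) (lin_tsum _ _ (tsum_linear bf lf)).
  transitivity (tensB_lmul (t b) 1
      (\sw_(a1, a2 <- Δ a) tensB_lmul 1 (i a1) (▲ (i (SA a2))))).
    rewrite (lin_tsum _ _ (tensB_lmul_linear _ _)); apply: eq_tsum => a1 a2.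
    by rewrite tsumE // /f SE fac_copMtgt -!tensB_lmulA !mulr1 !mul1r.
  by rewrite cop_antipode tensB_lmulE mulr1 SE.
Qed.

End FullAntipode.

(** * Compatibility of the Hopf algebra and bialgebroid structures *)

Section HopfCompatibility.
Variables (DH : hopf_data H) (coact : A -> B ⊗ A).
Hypothesis hH : is_hopf DH.
Hypothesis coact_lin : linear coact.
Hypothesis coact1 : coact 1 = 1 ⊗ 1.
Hypothesis coact_comul : forall a,
  \sw_(c, a0 <- coact a) c ⊗ Δ a0
  = \sw_(a1, a2 <- Δ a) \sw_(c1, x1 <- coact a1)
      \sw_(c2, x2 <- coact a2) (c1 * c2) ⊗ (x1 ⊗ x2).
Hypothesis coact_eps : forall a,
  \sw_(c, a0 <- coact a) counit A a0 *: c = (counit A a)%:A.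
Hypothesis coact_phi : forall b, coact (phi b)
  = \sw_(b1, b23 <- ΔB b) \sw_(b2, b3 <- ΔB b23)
      (b1 * antipode B b3) ⊗ phi b2.
Hypothesis tgt_coact : forall (M : lmodType k) (G : H -> A -> M) a, bilin G ->
  \sw_(a1, a2 <- Δ a) \sw_(c, a0 <- coact a1) G (i a2 * t c) a0
  = \sw_(a1, a2 <- Δ a) \sw_(c, a0 <- coact a2) G (i a1 * s c) a0.
Hypothesis comul_gen : forall a b, comul DH (i a * s b)
  = \sw_(a1, a2 <- Δ a) \sw_(c, a0 <- coact a2) \sw_(b1, b2 <- ΔB b)
      (i a1 * s (c * b1)) ⊗ (i a0 * s b2).
Hypothesis counit_gen : forall a b,
  counit DH (i a * s b) = counit A a * counit B b.

Ltac linE := repeat first [ progress linC | exact: coact_lin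
  | exact: (comul_linear hH)
  | apply: (lin_comp (comul_linear hH)) | apply: (lin_comp (comul_linear hB))
  | apply: (lin_comp coact_lin) ].

Let comul_src b : comul DH (s b) = \sw_(b1, b2 <- ΔB b) s b1 ⊗ s b2.
Proof.
rewrite -[s b]mul1r -(fac_incl1 hF) comul_gen (comul1 hA).
rewrite (tsum_tensE (M := (H ⊗ H)%type)); last by linE.
rewrite coact1 (tsum_tensE (M := (H ⊗ H)%type)); last by linE.
by apply: eq_tsum => b1 b2; rewrite (fac_incl1 hF) !mul1r.
Qed.

(** By [coact_phi] the coproduct of t(b) is φ(b_1) ⊗ b_2S(b_4)b_5 ⊗ φ(b_3) ⊗ b_6, and S(b_4)b_5
    cancels. *)
Let comul_tgt b : comul DH (t b) = \sw_(b1, b2 <- ΔB b) t b1 ⊗ t b2.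
Proof.
pose K x p q v : (H ⊗ H)%type := (i (phi x) * s p) ⊗ (i (phi q) * s v).
transitivity (\sw_(b1, b2 <- ΔB b) \sw_(x1, x2 <- ΔB b1) \sw_(p, z <- ΔB x2)
    \sw_(q, r <- ΔB z) \sw_(y1, y2 <- ΔB b2) K x1 (p * (antipode B r * y1)) q y2).
  rewrite (fac_tgtE hF) (lin_tsum _ _ (comul_linear hH)); apply: eq_tsum => b1 b2.
  rewrite comul_gen phi_comul (tsum_tsum (M := (H ⊗ H)%type)); last by linE.
  apply: eq_tsum => x1 x2; rewrite (tsum_tensE (M := (H ⊗ H)%type)); last by linE.
  rewrite coact_phi (tsum_tsum (M := (H ⊗ H)%type)); last by linE.
  apply: eq_tsum => p z; rewrite (tsum_tsum (M := (H ⊗ H)%type)); last by linE.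
  apply: eq_tsum => q r; rewrite (tsum_tensE (M := (H ⊗ H)%type)); last by linE.
  by apply: eq_tsum => y1 y2; rewrite /K mulrA.
rewrite (@comul_coassoc_tri _ _ _ (fun x1 x2 b2 => \sw_(p, z <- ΔB x2)
    \sw_(q, r <- ΔB z) \sw_(y1, y2 <- ΔB b2) K x1 (p * (antipode B r * y1)) q
      y2)); last first.
  by rewrite /K; linE.
transitivity (\sw_(b1, w <- ΔB b) \sw_(x1, p <- ΔB b1) \sw_(q, v <- ΔB w) K x1 p
  q v).
  rewrite (@comul_coassoc_tri _ _ _ (fun x1 p w => \sw_(q, v <- ΔB w) K x1 p q
    v)); last first.
    by rewrite /K; linE.
  apply: eq_tsum => x1 z.
  rewrite (@comul_coassoc_tri _ _ _ (fun p y b2 =>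
    \sw_(q, r <- ΔB y) \sw_(y1, y2 <- ΔB b2) K x1 (p * (antipode B r * y1)) q
      y2)); last first.
    by rewrite /K; linE.
  apply: eq_tsum => p w.
  rewrite (@comul_coassoc_tri _ _ _ (fun q r b2 =>
    \sw_(y1, y2 <- ΔB b2) K x1 (p * (antipode B r * y1)) q y2)); last first.
    by rewrite /K; linE.
  apply: eq_tsum => q v.
  rewrite (collapse_l_r (antipode_l hB) (f := fun u y => K x1 (p * u) q y));
    try by rewrite /K; linE.
  by rewrite mulr1.
apply: eq_tsum => b1 w; rewrite !(fac_tgtE hF).
rewrite (lin_tsum _ _ (f := fun X => X ⊗ tsum (ΔB w) (fun q v => i (phi q) * s
  v) : (H ⊗ H)%type)); last by linE.
apply: eq_tsum => x1 p.
by rewrite (lin_tsum _ _ (f := fun X => (i (phi x1) * s p) ⊗ X : (H ⊗ H)%type))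
  //; linE.
Qed.

Let counit_src b : counit DH (s b) = counit B b.
Proof.
rewrite -[s b]mul1r -(fac_incl1 hF) counit_gen.
by have [-> _] := counit_monoid_morphism hA; rewrite mul1r.
Qed.

Let counit_tgt b : counit DH (t b) = counit B b.
Proof.
have cH : linear (counit DH : H -> k^o) by exact: (counit_scalar hH).
have cB : linear (counit B : B -> k^o) by exact: (counit_scalar hB).
rewrite (fac_tgtE hF) (lin_tsum _ _ cH) -(tsum_counit_l b cB).
by apply: eq_tsum => b1 b2; rewrite counit_gen phi_counit.
Qed.

(** On generators both sides are ε(a)b_1 ⊗ b_2; on the right this is [coact_eps]. *)
Let cnt_comul X :
  ΔB (cnt D X) = \sw_(X1, X2 <- comul DH X) cnt D X1 ⊗ cnt D X2.
Proof.
have bf : bilin (fun X1 X2 => cnt D X1 ⊗ cnt D X2 : (B ⊗ B)%type) by linE.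
pattern X; apply: (@fac_ext _ _ _ _ _ _ _ _ _ hF (B ⊗ B)%type
  (fun X => ΔB (cnt D X))
  (fun X => \sw_(X1, X2 <- comul DH X) cnt D X1 ⊗ cnt D X2)); try by linE.
move=> a b; rewrite comul_gen (fac_cnt hF) (lin_scale _ _ (comul_linear hB)).
have hl : linear (fun c : B => \sw_(b1, b2 <- ΔB b) (c * b1) ⊗ b2 : (B ⊗
  B)%type) by linE.
transitivity (\sw_(b1, b2 <- ΔB b) ((counit A a)%:A * b1) ⊗ b2 : (B ⊗ B)%type).
  rewrite -[in LHS](tsum_pure (ΔB b)) (lin_tsum _ _ (f := fun u : (B ⊗ B)%type
    => counit A a *: u)); last first.
    by apply/lin_scaler/lin_id.
  by apply: eq_tsum => b1 b2; rewrite mulr_algl pureZl.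
rewrite -coact_eps (lin_tsum _ _ hl).
rewrite (tsum_tsum (M := (B ⊗ B)%type)) //.
transitivity (\sw_(a1, a2 <- Δ a) counit A a1 *: (\sw_(c, a0 <- coact a2)
   \sw_(b1, b2 <- ΔB b) ((counit A a0 *: c) * b1) ⊗ b2 : (B ⊗ B)%type)).
  have hm : linear (fun a2 => \sw_(c, a0 <- coact a2)
      \sw_(b1, b2 <- ΔB b) ((counit A a0 *: c) * b1) ⊗ b2 : (B ⊗ B)%type).
    apply: lin_tsum_arg; [exact: coact_lin| |exact: balanced0]; split=> ?.
      by apply: lin_tsum_in => *; apply/lin_pure_l/lin_mul_l/lin_scaler/lin_id.
    apply: lin_tsum_in => *; apply/lin_pure_l/lin_mul_l.
    exact: lin_coef (counit_scalar hA).
  by rewrite (tsum_counit_l a hm).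
apply: eq_tsum => a1 a2; rewrite (tsum_tsum (M := (B ⊗ B)%type)) //.
rewrite (lin_tsum _ _ (f := fun u : (B ⊗ B)%type => counit A a1 *: u));
  last first.
  by apply/lin_scaler/lin_id.
apply: eq_tsum => c a0; rewrite (tsum_tsum (M := (B ⊗ B)%type)) //.
rewrite (lin_tsum _ _ (f := fun u : (B ⊗ B)%type => counit A a1 *: u));
  last first.
  by apply/lin_scaler/lin_id.
apply: eq_tsum => b1 b2;
  rewrite (tsum_tensE (M := (B ⊗ B)%type)) // !(fac_cnt hF).
by rewrite pureZl pureZr -scalerAl pureZl.
Qed.

Let comulM_tsum (M : lmodType k) (g : H -> H -> M) X Y : bilin g ->
  \sw_(U, V <- comul DH (X * Y)) g U V
  = \sw_(X1, X2 <- comul DH X) \sw_(Y1, Y2 <- comul DH Y) g (X1 * Y1) (X2 * Y2).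
Proof.
move=> bg; rewrite (comulM hH) /tens_mul tsum_tsum //; apply: eq_tsum => X1 X2.
by rewrite tsum_tsum //; apply: eq_tsum => Y1 Y2; rewrite tsum_tensE.
Qed.

(** On i(a)s(b) the left side has the legs i(a_1), i(a_2)s(a_3^[-1]a_4^[-1]b_1), i(a_3^[0]),
    i(a_4^[0])s(b_2), by [coact_comul]. On the right s(a_2^[-1]) crosses ⊗_B, so the second leg is
    i(a_3)t(a_2^[-1])s(a_4^[-1]b_1) and the third i(a_2^[0]). The two agree by [tgt_coact]. *)
Lemma fac_hopf2_cop X :
  \sw_(X1, X2 <- comul DH X) (▲ X1 : tensB D) ⊗ (▲ X2 : tensB D)
  = \sw_(X1, X2 <- ▲ X) \sw_(X11, X12 <- comul DH X1)
      \sw_(X21, X22 <- comul DH X2)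
        (X11 ⊠ X21 : tensB D) ⊗ (X12 ⊠ X22 : tensB D).
Proof.
pose M : lmodType k := (tensB D ⊗ tensB D)%type.
pose f X1 X2 : M := \sw_(X11, X12 <- comul DH X1)
      \sw_(X21, X22 <- comul DH X2)
        (X11 ⊠ X21 : tensB D) ⊗ (X12 ⊠ X22 : tensB D).
have bf : bilin f by rewrite /f; linE.
(* Balance over B holds since s and t both preserve coproducts: b_1 crosses in the first pair and
   b_2 in the second. *)
have lf : balanced (fun X b => X * s b) (fun b Y => Y * t b) f.
  move=> X1 b X2; rewrite /f (comulM_tsum (M := M)); last by linE.
  apply: eq_tsum => U1 U2; rewrite (comulM_tsum (M := M)); last by linE.
  rewrite comul_src comul_tgt (tsum_tsum (M := M)); last by linE.
  rewrite [RHS]tsum_exchange [RHS](tsum_tsum (M := M)); last by linE.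
  apply: eq_tsum => c1 c2; rewrite (tsum_tensE (M := M)); last by linE.
  rewrite (tsum_tensE (M := M)); last by linE.
  by apply: eq_tsum => V1 V2; rewrite !tensB_bal.
pattern X; apply: (@fac_ext _ _ _ _ _ _ _ _ _ hF M
  (fun X => \sw_(X1, X2 <- comul DH X) (▲ X1 : tensB D) ⊗ (▲ X2 : tensB D))
  (fun X => tsum (▲ X) f)).
- by linE.
- exact: (lin_comp (tsum_linear bf lf) cop_lin).
move=> a b; rewrite (fac_cop hF) (lin_tsum _ _ (tsum_linear bf lf)).
pose G x Y c p q : M := \sw_(b1, b2 <- ΔB b)
  (i x ⊠ (Y * s (c * b1)) : tensB D) ⊗ (i p ⊠ (i q * s b2) : tensB D).
transitivity (\sw_(a1, a2 <- Δ a) \sw_(x1, x2 <- Δ a1) \sw_(p, q <- Δ a2)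
    \sw_(c1, p0 <- coact p) \sw_(c2, q0 <- coact q) G x1 (i x2 * s c1) c2 p0 q0).
  rewrite comul_gen (tsum_tsum (M := M)); last by linE.
  apply: eq_tsum => a1 a2; rewrite (tsum_tsum (M := M)); last by linE.
  (* [K] makes [coact_comul], an identity in B ⊗ (A ⊗ A), applicable to a_2 inside the sum. *)
  pose K (u : (B ⊗ (A ⊗ A))%type) : M := \sw_(c, v <- u) \sw_(p, q <- v)
    \sw_(x1, x2 <- Δ a1) G x1 (i x2) c p q.
  have lK : linear K by rewrite /K /G; linE.
  have KE c p q : K (c ⊗ (p ⊗ q)) = \sw_(x1, x2 <- Δ a1) G x1 (i x2) c p q.
    by rewrite /K !(tsum_tensE (M := M)) //; rewrite /G; linE.
  transitivity (\sw_(c, a0 <- coact a2) K (c ⊗ Δ a0)).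
    apply: eq_tsum => c a0.
    rewrite /K (tsum_tensE (M := M)); last by rewrite /G; linE.
    rewrite (tsum_tsum (M := M)); last by linE.
    transitivity (\sw_(b1, b2 <- ΔB b) \sw_(p, q <- Δ a0) \sw_(x1, x2 <- Δ a1)
      (i x1 ⊠ (i x2 * s (c * b1)) : tensB D) ⊗ (i p ⊠ (i q * s b2) : tensB D) :
        M).
      apply: eq_tsum => b1 b2; rewrite (tsum_tensE (M := M)); last by linE.
      rewrite !(fac_cop hF) tsum_exchange.
      rewrite (lin_tsum _ _ (f := fun u : tensB D => u ⊗ tsum (Δ a0)
        (fun p q => i p ⊠ (i q * s b2) : tensB D) : M)); last by linE.
      apply: eq_tsum => x1 x2.
      by rewrite (lin_tsum _ _ (f := fun u : tensB D =>
        (i x1 ⊠ (i x2 * s (c * b1)) : tensB D) ⊗ u : M)) //; linE.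
    rewrite tsum_exchange; apply: eq_tsum => p q; exact: tsum_exchange.
  rewrite -(lin_tsum _ _ lK) coact_comul (lin_tsum _ _ lK).
  rewrite [RHS]tsum_exchange; apply: eq_tsum => p q.
  rewrite (lin_tsum _ _ lK).
  rewrite [RHS]tsum_exchange; apply: eq_tsum => c1 p0.
  rewrite (lin_tsum _ _ lK).
  rewrite [RHS]tsum_exchange; apply: eq_tsum => c2 q0.
  rewrite KE; apply: eq_tsum => x1 x2; apply: eq_tsum => b1 b2.
  by rewrite -!mulrA -(fac_srcM hF).
rewrite (@comul_coassoc_tri _ _ M (fun x1 x2 a2 => \sw_(p, q <- Δ a2)
    \sw_(c1, p0 <- coact p) \sw_(c2, q0 <- coact q) G x1 (i x2 * s c1) c2 p0
      q0)); last first.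
  by rewrite /G; linE.
transitivity (\sw_(a1, a2 <- Δ a) \sw_(u1, u2 <- Δ a1) \sw_(v1, v2 <- Δ a2)
    \sw_(c1, p0 <- coact u2) \sw_(c2, q0 <- coact v2) G u1 (i v1 * t c1) c2 p0
      q0); last first.
  apply: eq_tsum => a1 a2; rewrite tsumE // /f.
  rewrite -[i a1]mulr1 -(fac_src1 hF) comul_gen (tsum_tsum (M := M));
    last by linE.
  apply: eq_tsum => u1 u2; rewrite [LHS]tsum_exchange (tsum_tsum (M := M));
    last by linE.
  apply: eq_tsum => c1 p0; rewrite (comul1 hB) (tsum_tsum (M := M)); last by linE.
  rewrite (tsum_tensE (M := M)); last by linE.
  rewrite (tsum_tensE (M := M)); last by linE.
  rewrite comul_gen (tsum_tsum (M := M)); last by linE.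
  apply: eq_tsum => v1 v2; rewrite (tsum_tsum (M := M)); last by linE.
  apply: eq_tsum => c2 q0; rewrite (tsum_tsum (M := M)); last by linE.
  apply: eq_tsum => b1 b2; rewrite (tsum_tensE (M := M)); last by linE.
  by rewrite (fac_src1 hF) !mulr1 tensB_bal -!mulrA (fac_src_tgt_comm hF).
rewrite (@comul_coassoc_tri _ _ M (fun u1 u2 a2 => \sw_(v1, v2 <- Δ a2)
    \sw_(c1, p0 <- coact u2) \sw_(c2, q0 <- coact v2) G u1 (i v1 * t c1) c2 p0
      q0)); last first.
  by rewrite /G; linE.
apply: eq_tsum => x1 z.
(* Rebracketing puts the second and third legs of a into a single w, the only place where the two
   sides still differ. *)
rewrite -(@comul_coassoc_tri _ _ M (fun x2 p q =>
    \sw_(c1, p0 <- coact p) \sw_(c2, q0 <- coact q) G x1 (i x2 * s c1) c2 p0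
      q0)); last first.
  by rewrite /G; linE.
rewrite -(@comul_coassoc_tri _ _ M (fun u2 v1 v2 =>
    \sw_(c1, p0 <- coact u2) \sw_(c2, q0 <- coact v2) G x1 (i v1 * t c1) c2 p0
      q0)); last first.
  by rewrite /G; linE.
apply: eq_tsum => w q.
rewrite (@tgt_coact M (fun Y p0 => \sw_(c2, q0 <- coact q) G x1 Y c2 p0 q0)) //.
by rewrite /G; linE.
Qed.

Lemma fac_hopf2_compat : hopf2_compat D B DH.
Proof.
split.
- exact: hB.
- exact: hH.
- split; [exact: cnt_lin | exact: cnt_comul | move=> X].
  have cH : linear (counit DH : H -> k^o) by exact: (counit_scalar hH).
  have cB : linear (counit B : B -> k^o) by exact: (counit_scalar hB).
  pattern X; apply: (@fac_ext _ _ _ _ _ _ _ _ _ hF (k^o : lmodType k)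
    (fun X => counit B (cnt D X) : k^o) (counit DH : H -> k^o)) => //.
    exact: (lin_comp cB cnt_lin).
  move=> a b; rewrite (fac_cnt hF) counit_gen.
  exact: (lin_scale _ _ cB).
- split; first by split=> [|x y]; [exact: (fac_src1 hF) | exact: (fac_srcM hF)].
  by split; [exact: s_lin | exact: comul_src | exact: counit_src].
- split; first by split=> [|x y]; [exact: (fac_tgt1 hF) | exact: (fac_tgtM hF)].
  by split; [exact: t_lin | exact: comul_tgt | exact: counit_tgt].
- exact: fac_hopf2_cop.
Qed.

End HopfCompatibility.

End Factorized.

(** * The bicrossproduct as a Hopf 2-algebra *)

Section BicrossFactorization.
Variables (k : fieldType) (A B : hopfAlg k) (P : bicross_pair A B).
Variables (T : A -> A) (phi : B -> A).
Hypotheses (SK : cancel (antipode A) T) (TK : cancel T (antipode A)).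
Hypothesis phi_alg : monoid_morphism (phi : B^c -> A).
Hypothesis phi_coalg : coalgebra_map B A phi.
Hypothesis phi_coact : forall a : A,
  \sw_(c, a0 <- coact P a) phi c ⊗ a0
  = \sw_(a1, a23 <- comul A a) \sw_(a2, a3 <- comul A a23) (T a3 * a1) ⊗ a2.
Hypothesis phi_act : forall (a : A) (b : B), phi (act P b a)
  = \sw_(a1, a2 <- comul A a) T a2 * phi b * a1.
Hypothesis act_phi : forall b b' : B, act P b' (phi b)
  = \sw_(b1, b2 <- comul B b) b1 * b' * antipode B b2.
Let hA := hopf_laws A.
Let hB := hopf_laws B.
Let hP := bicross_laws P.

Lemma bicross_factorization :
  factorization (bicross_bialgebroid P phi) (bicross_incl P) (act P) phi T.
Proof.
split.
- by move=> M f g; apply: bicross_ext.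
- move=> M F bF; exists (fun u : bicross P => \sw_(a, b <- (u : A ⊗ B)) F a b).
    by apply: tsum_linear => //; apply: balanced0.
  by move=> a b; rewrite bicross_inclMsrc tsum_tensE.
- exact: bicross_incl_linear.
- exact: bicross_incl1.
- exact: bicross_inclM.
- exact: bicross_src_linear.
- exact: bicross_src1.
- exact: bicross_srcM.
- exact: bicross_tgt_linear.
- by apply: bicross_tgt1; case: phi_alg.
- exact: (bicross_tgtM phi_alg phi_coalg act_phi).
- exact: bicross_tgtE.
- exact: (act_linear_l hP).
- exact: (act_linear_r hP).
- exact: (act1 hP).
- exact: (actM hP).
- exact: bicross_srcMincl.
- exact: (bicross_tgtMincl SK TK phi_alg phi_coalg phi_coact phi_act).
- exact: (bicross_tgt_act SK TK phi_alg phi_coalg phi_coact phi_act).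
- exact: (bicross_src_tgt_comm phi_coalg act_phi).
- exact: phi_coalg.
- apply: tsum_linear; last exact: balanced0; split=> *; last first.
    by apply: lin_tsum_in => *; apply/lin_pure_r/lin_pure_r/lin_id.
  apply: lin_tsum_arg; [exact: comul_linear hA| |exact: balanced0].
  by split=> *; [apply/lin_pure_l | apply/lin_pure_r]; apply/lin_pure_l/lin_id.
- move=> a b; rewrite bicross_inclMsrc bicross_copE.
  by apply: eq_tsum => x y; rewrite bicross_inclMsrc.
- apply: tsum_linear; last exact: balanced0.
  split=> ?; [exact: lin_coef (counit_scalar hA) | exact/lin_scaler/lin_id].
- by move=> a b; rewrite bicross_inclMsrc bicross_cntE.
Qed.

Lemma bicross_full_antipode_linear : linear (bicross_full_antipode P phi).
Proof.
have [phi_lin _ _] := phi_coalg.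
apply: tsum_linear; last exact: balanced0; split=> [b|a].
  apply: lin_tsum_arg; [exact: comul_linear hA| |exact: balanced0].
  split=> ?; apply: lin_tsum_in => *.
    apply/lin_pure_r/(lin_comp (act_linear_r hP _)).
    exact: antipode_linear hA.
  exact/lin_pure_l/lin_mul_r/antipode_linear/hA.
apply: lin_tsum_in => *.
apply: lin_tsum_arg; [exact: comul_linear hB| |exact: balanced0].
split=> ?; first exact/lin_pure_l/lin_mul_l.
exact/lin_pure_r/act_linear_l/hP.
Qed.

Hypothesis HP : is_hopf (bicross_hopf P).
Hypothesis coact_phi : forall b : B, coact P (phi b)
  = \sw_(b1, b23 <- comul B b) \sw_(b2, b3 <- comul B b23)
      (b1 * antipode B b3) ⊗ phi b2.

Lemma bicross_hopf2_compat :
  hopf2_compat (bicross_bialgebroid P phi) B (bicross_hopf P).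
Proof.
apply: (fac_hopf2_compat bicross_factorization HP (coact_linear hP)
  (coact_one hP) (coact_comul hP) (coact_eps hP) coact_phi).
- by move=> M G a bG; apply: (bicross_tgt_coact SK TK phi_coalg phi_coact).
- move=> a b; rewrite bicross_inclMsrc bicross_comulE.
  apply: eq_tsum => a1 a2; apply: eq_tsum => c a0; apply: eq_tsum => b1 b2.
  by rewrite !bicross_inclMsrc.
- by move=> a b; rewrite bicross_inclMsrc bicross_counitE.
Qed.

End BicrossFactorization.

Theorem theorem3p4 (k : fieldType) (A B : hopfAlg k) (P : bicross_pair A B)
    (HP : is_hopf (bicross_hopf P))
    (SAinv : A -> A)
    (SAK : cancel (antipode A) SAinv) (SAinvK : cancel SAinv (antipode A))
    (phi : B -> A)
    (phi_alg : monoid_morphism (phi : B^c -> A))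
    (phi_coalg : coalgebra_map B A phi)
    (cond1 : forall b : B, coact P (phi b)
       = \sw_(b1, b23 <- comul B b) \sw_(b2, b3 <- comul B b23)
           (b1 * antipode B b3) ⊗ phi b2)
    (cond2 : forall a : A,
       \sw_(c, a0 <- coact P a) phi c ⊗ a0
       = \sw_(a1, a23 <- comul A a) \sw_(a2, a3 <- comul A a23)
           (SAinv a3 * a1) ⊗ a2)
    (cond3 : forall (a : A) (b : B), phi (act P b a)
       = \sw_(a1, a2 <- comul A a) SAinv a2 * phi b * a1)
    (cond4 : forall b b' : B, act P b' (phi b)
       = \sw_(b1, b2 <- comul B b) b1 * b' * antipode B b2) :
  let H := bicross P in
  let D := bicross_bialgebroid P phi in
  let HH := bicross_hopf P in
  [/\ right_hopf2 D B HH /\ anti_right_hopf2 D B HH,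
      [/\ forall b : B, src D b = 1 ⊗ b,
          forall b : B, tgt D b = \sw_(b1, b2 <- comul B b) phi b1 ⊗ b2,
          forall (a : A) (b : B), cop D (a ⊗ b : H)
            = \sw_(a1, a2 <- comul A a) (a1 ⊗ 1 : H) ⊠ (a2 ⊗ b : H) :> tensB D
        & forall (a : A) (b : B), cnt D (a ⊗ b : H) = counit A a *: b],
      (forall canon_inv : tensB D -> tensBop D,
         cancel (@canon_map k B H D) canon_inv ->
         cancel canon_inv (@canon_map k B H D) ->
         forall (a : A) (b : B), canon_inv (1 ⊠ (a ⊗ b : H))
           = \sw_(a1, a2 <- comul A a)
               (antipode A a1 ⊗ 1 : H) ⊠ (a2 ⊗ b : H) :> tensBop D),
      (forall anticanon_inv : tensB D -> tensBop' D,
         cancel (@anticanon_map k B H D) anticanon_inv ->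
         cancel anticanon_inv (@anticanon_map k B H D) ->
         forall (a : A) (b : B), anticanon_inv ((a ⊗ b : H) ⊠ 1)
           = \sw_(a1, a23 <- comul A a) \sw_(a2, a3 <- comul A a23)
               \sw_(b1, b2 <- comul B b)
                 (a1 ⊗ 1 : H)
                 ⊠ ((phi b1 * SAinv a3) ⊗ act P b2 (SAinv a2) : H)
             :> tensBop' D)
    & (forall a : A, antipode A (antipode A a) = a) ->
      (forall b : B, antipode B (antipode B b) = b) ->
      [/\ hopf2 D B HH,
          is_full_antipode D (bicross_full_antipode P phi)
        & forall (a : A) (b : B), bicross_full_antipode P phi (a ⊗ b : H)
            = \sw_(a1, a2 <- comul A a) \sw_(b1, b2 <- comul B b)
                (phi b1 * antipode A a2) ⊗ act P b2 (antipode A a1)]].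
Proof.
move=> H D HH.
have phi_lin : linear phi by case: phi_coalg.
have hF := bicross_factorization SAK SAinvK phi_alg phi_coalg cond2 cond3 cond4.
have hC := bicross_hopf2_compat SAK SAinvK phi_alg phi_coalg cond2 cond3 cond4
  HP cond1.
have hD : is_right_bialgebroid D := fac_right_bialgebroid hF.
have hR : right_hopf2 D B HH.
  by split=> //; split=> //; apply: fac_canon_bij hF.
split.
- split=> //; split=> //; split=> //.
  exact: fac_anticanon_bij hF SAK SAinvK.
- split=> //; [exact: bicross_copE | exact: bicross_cntE].
(* Any inverse returns the unique preimage, so it suffices to apply λ to the claimed value. *)
- move=> cinv cK _ a b; rewrite -[RHS]cK; congr cinv.
  rewrite -bicross_inclMsrc; apply: etrans (esym (fac_canon_gen hF a b)) _.
  congr (canon_map _); apply: eq_tsum => a1 a2.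
  by rewrite bicross_inclMsrc.
- move=> cinv cK _ a b; rewrite -[RHS]cK; congr cinv.
  rewrite -bicross_inclMsrc;
    apply: etrans (esym (fac_anticanon_gen hF SAK SAinvK a b)) _.
  congr (anticanon_map _); apply: eq_tsum => a1 a23.
  have hl : linear (fun X : H => bicross_incl P a1 ⊠ X : tensBop' D).
    exact/lin_pure_r/lin_id.
  (* The second factor t(b)i(S^-1(a)) is put in the normal form of the statement; this splits a into
     three legs. *)
  rewrite (fac_tgtMincl_antipode_inv hF SAK SAinvK) (lin_tsum _ _ hl).
  apply: eq_tsum => a2 a3; rewrite (lin_tsum _ _ hl).
  by apply: eq_tsum => b1 b2; rewrite bicross_inclMsrc.
- move=> SA2 SB2.
  have SinvE a : SAinv a = antipode A a by rewrite -{1}[a]SA2 SAK.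
  have hS : is_full_antipode D (bicross_full_antipode P phi).
    apply: (fac_full_antipode hF SAK SAinvK SA2).
    + exact: bicross_full_antipode_linear.
    + move=> a b; rewrite bicross_inclMsrc bicross_full_antipodeE //.
      rewrite -SinvE (fac_tgtMincl_antipode_inv hF SAK SAinvK).
      apply: eq_tsum => a1 a2; apply: eq_tsum => b1 b2.
      by rewrite bicross_inclMsrc !SinvE.
    (* The value found is 1 ⊗ S_B^2(b), and it equals s(b) because the antipode of B is
       involutive. *)
    + move=> b; apply: etrans (full_antipode_bicross_tgt phi_coalg cond4 SA2 b) _.
      by rewrite SB2.
  split=> //.
  + by split; [left | split=> //; exists (bicross_full_antipode P phi)].
  + by move=> a b; apply: bicross_full_antipodeE.
Qed.
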